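(* Let $(X^*,u^* )$ be a Pontryagin local $L^2$-minimizer at the initial assignment $X_0\in L^2(\Omega,\mathcal F,\mathbb P;\mathbb R^d)$ for the mean field type linear-quadratic problem with dynamics $\frac{d}{dt}X(t,\omega)=A(t)X(t,\omega)+B(t)u(t,\omega)$ and cost \[\begin{split}J(X,u)=&\tfrac12\mathbb E\Big(\int_0^T[X^T(t)Q_x(t)X(t)+u^T(t)R(t)u(t)]dt+X^T(T)K_xX(T)\Big)\\&+\tfrac12\int_0^T\mathbb E\big[(X(t)-\mathbb EX(t))^TQ_m(t)(X(t)-\mathbb EX(t))\big]dt\\&+\tfrac12\mathbb E\big[(X(T)-\mathbb EX(T))^TK_m(X(T)-\mathbb EX(T))\big].\end{split}\] Then, writing $\overline X^*(t)=\mathbb EX^*(t)$, \[u^*(t,\omega)=-R^{-1}(t)B^T(t)\big[P_1(t)(X^*(t,\omega)-\overline X^*(t))+P_2(t)\overline X^*(t)\big]\] (for a.e. $t$ and $\mathbb P$-a.e. $\omega$), where $P_1(\cdot)$ is the matrix-valued function solving the Riccati differential equation \[\frac{d}{dt}P_1(t)=-P_1(t)A(t)-A^T(t)P_1(t)+P_1(t)B(t)R^{-1}(t)B^T(t)P_1(t)-(Q_x(t)+Q_m(t))\] with the boundary condition $P_1(T)=K_x+K_m$, while $P_2(\cdot)$ satisfies the Riccati differential equation \[\frac{d}{dt}P_2(t)=-P_2(t)A(t)-A^T(t)P_2(t)+P_2(t)B(t)R^{-1}(t)B^T(t)P_2(t)-Q_x(t)\] and the boundary condition $P_2(T)=K_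x$.
   Context: Here $p=2$, $T>0$, $d,d'\in\mathbb N$, $U=\mathbb R^{d'}$, $(\Omega,\mathcal F,\mathbb P)$ is a standard probability space (i.e. $(\Omega,\mathcal F)$ is a standard Borel space) and $\mathbb E$ is expectation. Superscript $T$ on vectors and matrices denotes transposition. $A(t),Q_x(t),Q_m(t),K_x,K_m$ are $d\times d$ matrices, $B(t)$ is a $d\times d'$ matrix, $R(t)$ is a $d'\times d'$ matrix; $Q_x(t),Q_m(t),K_x,K_m,R(t)$ are symmetric and $R(t)>0$ (positive definite). The matrix functions $A,B,R,Q_x,Q_m$ are continuous on $[0,T]$. $\mathcal X^2$ is the set of $X:[0,T]\times\Omega\to\mathbb R^d$ such that $\omega\mapsto X(\cdot,\omega)$ takes values in $C([0,T];\mathbb R^d)$ $\mathbb P$-a.s. and belongs to $L^2(\Omega,\mathcal F,\mathbb P;C([0,T];\mathbb R^d))$ (sup-norm), with $\|X\|_{\mathcal X^2}=(\mathbb E\sup_{t}\|X(t)\|^2)^{1/2}$. Let $\lambda$ be Lebesgue measure on $[0,T]$ and $\mathcal B_T$ the Lebesgue $\sigma$-algebra. $\mathcal A_L(X_0)$ is the set of pairs $(X,u)$ with $X\in\mathcal X^2$, $u\in L^2([0,T]\times\Omega,\mathcal B_T\otimes\mathcal F,\lambda\otimes\mathbb P;\mathbb R^{d'})$, such that for $\mathbb P$-a.e. $\omega$, $X(\cdot,\omega)$ solves (in integral form) $\frac{d}{dt}X(t,\omega)=A(t)X(t,\omega)+B(t)u(t,\omega)$, and $X(0)=X_0$ $\mathbb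 P$-a.s. $(X^*,u^* )\in\mathcal A_L(X_0)$ is a Pontryagin local $L^2$-minimizer at $X_0$ if there is $\varepsilon>0$ such that $J(X^*,u^* )\le J(X,u)$ for every $(X,u)\in\mathcal A_L(X_0)$ with $\|X-X^*\|_{\mathcal X^2}\le\varepsilon$ and $(\lambda\otimes\mathbb P)\{(t,\omega):u^*(t,\omega)\neq u(t,\omega)\}\le\varepsilon$.
   Formalization: The existence on [0,T] of the solutions P_1 and P_2 of the two Riccati equations is assumed, not concluded; without sign conditions on Q_x, Q_m, K_x, K_m a minimizer may exist although a Riccati solution blows up inside [0,T]. *)

(* Defs.v *)
From HB Require Import structures.
From mathcomp Require Import all_boot all_order all_algebra.
From mathcomp Require Import all_classical all_reals all_analysis.

Set Implicit Arguments.
Unset Strict Implicit.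
Unset Printing Implicit Defensive.

Import Order.TTheory GRing.Theory Num.Theory.
Import numFieldNormedType.Exports.

Local Open Scope classical_set_scope.
Local Open Scope ring_scope.

(* The real line carrying the Lebesgue (completed Borel) sigma-algebra; the
   underlying type is convertible to R. *)
Notation lebesgueType R := (caratheodory_type ((@wlength R idfun)^*)%mu).

Notation leb := completed_lebesgue_measure.

(* A Polish space is a separable, complete, Hausdorff pseudometric space. *)
Definition standard_borel (R : realType) (d : measure_display)
    (Omega : measurableType d) : Prop :=
  exists (S : completePseudoMetricType R) (f : Omega -> S),
    [/\ hausdorff_space S,
        exists D : set S, countable D /\ dense D,
        bijective f &
        forall E : set S, measurable (f @^-1` E) <-> <<s @open S >> E].

Definition enorm (R : realType) (n : nat) (x : 'cV[R]_n) : R :=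
  Num.sqrt (\sum_i (x i 0) ^+ 2).

Definition quad (R : realType) (n : nat) (Q : 'M[R]_n) (x : 'cV[R]_n) : R :=
  (x^T *m Q *m x) 0 0.

Definition posdef (R : realType) (n : nat) (Q : 'M[R]_n) : Prop :=
  Q^T = Q /\ forall x : 'cV[R]_n, x != 0 -> 0 < quad Q x.

Section spaces.
Context {R : realType} {dO : measure_display} {Omega : measurableType dO}.
Variable P : probability Omega R.

Definition L2_rv (n : nat) (X0 : Omega -> 'cV[R]_n) : Prop :=
  (forall i, measurable_fun setT (fun w => X0 w i 0)) /\
  (\int[P]_w ((enorm (X0 w)) ^+ 2)%:E < +oo)%E.

Variable T : R.

Definition simple_path (n : nat) (Z : Omega -> R -> 'cV[R]_n) : Prop :=
  [/\ finite_set (range Z),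
      forall y, measurable (Z @^-1` [set y]) &
      forall w, {within `[0, T], continuous (Z w)}].

(* Bochner measurability, up to a P-null set, of w |-> X(., w) as a map into
   C([0,T]; R^n) with the sup norm. *)
Definition strongly_measurable (n : nat) (X : R -> Omega -> 'cV[R]_n) : Prop :=
  exists Z : nat -> Omega -> R -> 'cV[R]_n,
    (forall k, simple_path (Z k)) /\
    {ae P, forall w,
       {uniform `[0, T], (fun k => Z k w) @ \oo --> (fun t => X t w)}}.

Definition X2norm (n : nat) (X : R -> Omega -> 'cV[R]_n) : \bar R :=
  ((\int[P]_w ereal_sup [set ((enorm (X t w)) ^+ 2)%:E | t in `[0%R, T]])
     `^ 2^-1)%E.

Definition X2 (n : nat) (X : R -> Omega -> 'cV[R]_n) : Prop :=
  [/\ {ae P, forall w, {within `[0, T], continuous (fun t => X t w)}},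
      strongly_measurable X &
      (X2norm X < +oo)%E].

Definition time_space : set (lebesgueType R * Omega) := `[0, T] `*` setT.

Definition L2_control (m : nat) (u : R -> Omega -> 'cV[R]_m) : Prop :=
  (forall i, measurable_fun time_space
     (fun z : lebesgueType R * Omega => u z.1 z.2 i 0)) /\
  (\int[leb \x P]_(z in time_space) ((enorm (u z.1 z.2)) ^+ 2)%:E < +oo)%E.

Definition mean (n : nat) (X : R -> Omega -> 'cV[R]_n) (t : R) : 'cV[R]_n :=
  \col_i fine 'E_P[fun w => X t w i 0].

Definition solves (n m : nat) (A : R -> 'M[R]_n) (B : R -> 'M[R]_(n, m))
    (x : R -> 'cV[R]_n) (v : R -> 'cV[R]_m) : Prop :=
  forall t, t \in `[0, T] ->
    x t = x 0 + \col_i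
      \int[leb]_(s in `[0, t]) ((A s *m x s + B s *m v s) i 0).

Definition admissible (n m : nat) (A : R -> 'M[R]_n) (B : R -> 'M[R]_(n, m))
    (X0 : Omega -> 'cV[R]_n)
    (X : R -> Omega -> 'cV[R]_n) (u : R -> Omega -> 'cV[R]_m) : Prop :=
  [/\ X2 X,
      L2_control u,
      {ae P, forall w, solves A B (fun t => X t w) (fun t => u t w)} &
      {ae P, forall w, X 0 w = X0 w}].

Definition cost (n m : nat) (Qx Qm : R -> 'M[R]_n) (Kx Km : 'M[R]_n)
    (Ru : R -> 'M[R]_m)
    (X : R -> Omega -> 'cV[R]_n) (u : R -> Omega -> 'cV[R]_m) : R :=
  2^-1 * fine 'E_P[fun w =>
     \int[leb]_(t in `[0, T]) (quad (Qx t) (X t w) + quad (Ru t) (u t w))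
     + quad Kx (X T w)]
  + 2^-1 * \int[leb]_(t in `[0, T])
      fine 'E_P[fun w => quad (Qm t) (X t w - mean X t)]
  + 2^-1 * fine 'E_P[fun w => quad Km (X T w - mean X T)].

Definition pontryagin_local_L2_minimizer (n m : nat)
    (A : R -> 'M[R]_n) (B : R -> 'M[R]_(n, m)) (X0 : Omega -> 'cV[R]_n)
    (J : (R -> Omega -> 'cV[R]_n) -> (R -> Omega -> 'cV[R]_m) -> R)
    (Xs : R -> Omega -> 'cV[R]_n) (us : R -> Omega -> 'cV[R]_m) : Prop :=
  admissible A B X0 Xs us /\
  exists2 e : R, 0 < e &
    forall X u, admissible A B X0 X u ->
      (X2norm (fun t w => X t w - Xs t w)%R <= e%:E)%E ->
      ((leb \x P) [set z | time_space z /\ us z.1 z.2 <> u z.1 z.2]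
         <= e%:E)%E ->
      J Xs us <= J X u.

End spaces.

(* With Pi continuous on [0,T], the equation on ]0,T[ gives the one-sided
   derivatives at 0 and T as well, so this is a classical solution on [0,T]. *)
Definition riccati_solution (R : realType) (n m : nat) (T : R)
    (A : R -> 'M[R]_n) (B : R -> 'M[R]_(n, m)) (Ru : R -> 'M[R]_m)
    (Q : R -> 'M[R]_n) (K : 'M[R]_n) (Pi : R -> 'M[R]_n) : Prop :=
  [/\ {within `[0, T], continuous Pi},
      forall t, t \in `]0, T[ ->
        is_derive t 1 Pi
          (- (Pi t *m A t) - (A t)^T *m Pi t
           + Pi t *m B t *m invmx (Ru t) *m (B t)^T *m Pi t - Q t) &
      Pi T = K].

(* Main.v *)
Require Import Defs.
From HB Require Import structures.
From mathcomp Require Import all_boot all_order all_algebra.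
From mathcomp Require Import all_classical all_reals all_analysis.
From mathcomp Require Import measurable_realfun.
From mathcomp Require Import ring lra.

(** The first-order condition at the minimizer splits into two deterministic
    linear-quadratic problems, each of which yields one of the two feedback
    laws.

    Write m = E X. Let F be an event, eta a continuous control vanishing
    outside an interval ]a, b[, and y the solution of y' = A y + B eta with
    y(0) = 0. Adding th 1_F (y, eta) to the optimal pair keeps it admissible,
    moves the state by at most a multiple of |th| in sup norm and changes the
    control on a set of measure at most b - a. So these are competitors as soon
    as b - a <= e and th is small, where e is the size of the neighbourhood in
    which the pair is optimal. The cost is a quadratic polynomial in th
    ([cost_expansion]), hence its linear coefficient vanishes
    ([first_variation_eq0]). This coefficient sees X and u only through the
    deterministic vectors E[1_F X(t)] and E[1_F u(t)], which solve the state
    equation again ([mean_on_dynamics]).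

    For the sure event the variance terms drop out: the pair (m, E u) is
    stationary for the deterministic problem with weights Qx, Kx. Subtracting
    P(F) times this identity from the one for F shows that the pair
    (E[1_F (X - m)], E[1_F (u - E u)]) is stationary for the deterministic
    problem with weights Qx + Qm, Kx + Km.

    A stationary pair (x, u) of a deterministic problem obeys the Riccati
    feedback law ([stationary_feedback]). Let p solve p' = - A^T p - Q x with
    p(T) = K x(T). Integration by parts turns stationarity into R u + B^T p = 0,
    and perturbations on short intervals are enough for that
    ([short_support_primitive0]). Then p - Pi x solves a homogeneous linear equation
    with final value 0 by the Riccati equation, so p = Pi x.

    Adding the two laws, E[1_F r(t)] has zero integral over every [0, t], where
    r = u + R^-1 B^T (P1 (X - m) + P2 m). Since F is arbitrary, the integral of
    r vanishes on all rectangles of [0, T] x Omega, hence r = 0 almost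
    everywhere ([pintegrable_ae0]).

    Admissibility is an almost sure property, so the argument is carried out
    for a jointly measurable version of the pair which solves the equation for
    every outcome ([regular_version]); passing back to the given pair relies on
    [integral_off_null], which compares integrals of functions that agree off a
    null set and may fail to be measurable. *)

Set Implicit Arguments.
Unset Strict Implicit.
Unset Printing Implicit Defensive.

Import Order.TTheory GRing.Theory Num.Theory.
Import numFieldNormedType.Exports.

Local Open Scope classical_set_scope.
Local Open Scope ring_scope.

(** * Integrals against the completed Lebesgue measure *)

Section leb_bridge.
Context {R : realType}.
Notation mul := (@completed_lebesgue_measure R).
Notation mu := (@lebesgue_measure R).

Lemma measurable_leb (A : set R) :
  measurable (A : set (measurableTypeR R)) -> measurable (A : set (lebesgueType R)).
Proof. exact: sub_caratheodory. Qed.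

Lemma measurable_id_leb :
  measurable_fun setT (idfun : lebesgueType R -> measurableTypeR R).
Proof. by move=> _ A mA; rewrite setTI preimage_id; exact: measurable_leb. Qed.

Lemma measurable_fun_leb (D : set R) (f : R -> R) :
  measurable (D : set (measurableTypeR R)) ->
  measurable_fun (D : set (measurableTypeR R)) f ->
  measurable_fun (D : set (lebesgueType R)) (f : lebesgueType R -> R).
Proof. by move=> mD mf _ Y mY; apply: measurable_leb; exact: mf. Qed.

Lemma measurable_itv_leb (i : interval R) : measurable ([set` i] : set (lebesgueType R)).
Proof. by apply: measurable_leb; exact: measurable_itv. Qed.

(** The Borel Lebesgue measure is the image of the completed one under the
    identity. *)
Lemma ge0_integral_leb (D : set R) (f : measurableTypeR R -> \bar R) :
  measurable (D : set (measurableTypeR R)) ->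
  measurable_fun (D : set (measurableTypeR R)) f -> (forall x, D x -> 0 <= f x)%E ->
  (\int[mul]_(x in (D : set (lebesgueType R))) f x =
    \int[mu]_(x in (D : set (measurableTypeR R))) f x)%E.
Proof.
move=> mD mf f0.
have H := @ge0_integral_pushforward _ _ (lebesgueType R) (measurableTypeR R) R idfun
  measurable_id_leb mul D (f : measurableTypeR R -> \bar R) mD mf.
rewrite (_ : \int[mu]_(x in (D : set (measurableTypeR R))) f x =
  \int[pushforward mul (idfun : lebesgueType R ->
  measurableTypeR R)]_(x in (D : set (measurableTypeR R))) f x)%E //.
by rewrite H // => y /set_mem; exact: f0.
Qed.

Lemma integral_leb (D : set R) (f : measurableTypeR R -> \bar R) :
  measurable (D : set (measurableTypeR R)) ->
  measurable_fun (D : set (measurableTypeR R)) f ->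
  (\int[mul]_(x in (D : set (lebesgueType R))) f x =
    \int[mu]_(x in (D : set (measurableTypeR R))) f x)%E.
Proof.
move=> mD mf.
rewrite integralE [RHS]integralE !ge0_integral_leb //.
  exact: measurable_funeneg.
exact: measurable_funepos.
Qed.

Lemma integrable_leb (D : set R) (f : measurableTypeR R -> \bar R) :
  measurable (D : set (measurableTypeR R)) ->
  mu.-integrable D f -> mul.-integrable (D : set (lebesgueType R)) f.
Proof.
move=> mD /integrableP[mf fi]; apply/integrableP; split.
  by move=> _ Y mY; apply: measurable_leb; exact: mf.
by rewrite ge0_integral_leb //; apply: measurableT_comp.
Qed.

Lemma continuous_integrable_leb (f : R -> R) (a b : R) : continuous f ->
  mul.-integrable (`[a, b] : set (lebesgueType R)) (EFin \o f).
Proof.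
move=> cf; apply: integrable_leb; first exact: measurable_itv.
apply: continuous_compact_integrable; first exact: segment_compact.
exact: continuous_subspaceT.
Qed.

Lemma Rintegral_leb (f : R -> R) (a b : R) : continuous f ->
  \int[mul]_(x in (`[a, b] : set (lebesgueType R))) f x = \int[mu]_(x in `[a, b]) f x.
Proof.
move=> cf; rewrite /Rintegral integral_leb //.
apply/measurable_EFinP; apply: measurable_funTS; exact: continuous_measurable_fun.
Qed.

End leb_bridge.

(** * Calculus of matrix-valued functions *)

Section calculus.
Context {R : realType}.
Notation mul := (@completed_lebesgue_measure R).
Notation mu := (@lebesgue_measure R).

(** The retraction of the line onto [0, T]: composing with it turns continuity
    within [0, T] into continuity on the line, and gives meaning to data
    outside [0, T]. *)
Definition clamp (T t : R) : R := Num.max 0 (Num.min T t).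

Lemma clamp_in (T t : R) : 0 < T -> clamp T t \in `[0, T].
Proof.
move=> T0; rewrite in_itv /= /clamp le_max lexx /= ge_max (ltW T0) /=.
by rewrite ge_min lexx.
Qed.

Lemma clamp_id (T t : R) : t \in `[0, T] -> clamp T t = t.
Proof. by rewrite in_itv /= => /andP[t0 tT]; rewrite /clamp min_r // max_r. Qed.

Lemma continuous_clamp (T : R) : continuous (clamp T).
Proof.
move=> x; apply: (@continuous_max _ _ (fun=> 0) (fun t => Num.min T t)).
  exact: cvg_cst.
by apply: (@continuous_min _ _ (fun=> T) id); [exact: cvg_cst|exact: cvg_id].
Qed.

Lemma continuous_comp_clamp (V : topologicalType) (T : R) (f : R -> V) : 0 < T ->
  {within `[0, T], continuous f} -> continuous (f \o clamp T).
Proof.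
move=> T0 /subspace_continuousP cf x.
have ct : clamp T x \in `[0, T] by exact: clamp_in.
apply: cvg_comp (cf _ ct).
move=> U wU; have {wU} : \near x, (clamp T x \in `[0, T] -> U (clamp T x)).
  exact: (@continuous_clamp T x _ wU).
by apply: filterS => y; apply; exact: clamp_in.
Qed.

Definition mx_cts m n (M : R -> 'M[R]_(m, n)) :=
  forall i j, continuous (fun t => M t i j).

Definition mx_derive m n (M : R -> 'M[R]_(m, n)) (t : R) (D : 'M[R]_(m, n)) :=
  forall i j, is_derive t (1 : R) (fun s => M s i j) (D i j).

Lemma continuous_sumf (n : nat) (f : 'I_n -> R -> R) :
  (forall i, continuous (f i)) -> continuous (fun t => \sum_i f i t).
Proof.
move=> cf; apply: continuous_big => //.
exact: add_continuous.
Qed.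

Lemma is_derive_sumf (n : nat) (f : 'I_n -> R -> R) (t : R) (D : 'I_n -> R) :
  (forall i, is_derive t (1 : R) (f i) (D i)) ->
  is_derive t (1 : R) (fun s => \sum_i f i s) (\sum_i D i).
Proof.
move=> df; have := @is_derive_sum R R^o R^o n f t 1 D df.
by rewrite (_ : \sum_(i < n) f i = fun s => \sum_i f i s) // funeqE => s; rewrite fct_sumE.
Qed.

Lemma mx_cts_cst m n (M : 'M[R]_(m, n)) : mx_cts (fun=> M).
Proof. by move=> i j x; exact: cvg_cst. Qed.

Lemma mx_ctsD m n (M N : R -> 'M[R]_(m, n)) : mx_cts M -> mx_cts N -> mx_cts (fun t => M t + N t).
Proof.
move=> cM cN i j; under eq_fun do rewrite mxE.
by move=> x; apply: cvgD; [exact: cM|exact: cN].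
Qed.

Lemma mx_ctsN m n (M : R -> 'M[R]_(m, n)) : mx_cts M -> mx_cts (fun t => - M t).
Proof.
move=> cM i j; under eq_fun do rewrite mxE.
by move=> x; apply: cvgN; exact: cM.
Qed.

Lemma mx_ctsT m n (M : R -> 'M[R]_(m, n)) : mx_cts M -> mx_cts (fun t => (M t)^T).
Proof.
by move=> cM i j; under eq_fun do rewrite mxE; exact: cM.
Qed.

Lemma mx_ctsM m n p (M : R -> 'M[R]_(m, n)) (N : R -> 'M[R]_(n, p)) :
  mx_cts M -> mx_cts N -> mx_cts (fun t => M t *m N t).
Proof.
move=> cM cN i j; under eq_fun do rewrite mxE.
by apply: continuous_sumf => k x; apply: cvgM; [exact: cM|exact: cN].
Qed.

Lemma mx_ctsZ m n (a : R -> R) (M : R -> 'M[R]_(m, n)) :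
  continuous a -> mx_cts M -> mx_cts (fun t => a t *: M t).
Proof.
move=> ca cM i j; under eq_fun do rewrite mxE.
by move=> x; apply: cvgM; [exact: ca|exact: cM].
Qed.

Lemma mx_deriveD m n (M N : R -> 'M[R]_(m, n)) t dM dN :
  mx_derive M t dM -> mx_derive N t dN -> mx_derive (fun t => M t + N t) t (dM + dN).
Proof.
move=> hM hN i j; under eq_fun do rewrite mxE.
by rewrite mxE; apply: is_deriveD; [exact: hM|exact: hN].
Qed.

Lemma mx_deriveN m n (M : R -> 'M[R]_(m, n)) t dM :
  mx_derive M t dM -> mx_derive (fun t => - M t) t (- dM).
Proof.
move=> hM i j; under eq_fun do rewrite mxE.
by rewrite mxE; apply: is_deriveN; exact: hM.
Qed.

Lemma mx_deriveT m n (M : R -> 'M[R]_(m, n)) t dM :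
  mx_derive M t dM -> mx_derive (fun t => (M t)^T) t (dM^T).
Proof. by move=> hM i j; under eq_fun do rewrite mxE; rewrite mxE; exact: hM. Qed.

Lemma mx_deriveM m n p (M : R -> 'M[R]_(m, n)) (N : R -> 'M[R]_(n, p)) t dM dN :
  mx_derive M t dM -> mx_derive N t dN ->
  mx_derive (fun t => M t *m N t) t (dM *m N t + M t *m dN).
Proof.
move=> hM hN i j; under eq_fun do rewrite mxE.
rewrite !mxE -big_split /=; apply: is_derive_sumf => k.
have H := @is_deriveM R R^o (fun s => M s i k) (fun s => N s k j) t 1 _ _ (hM i k) (hN k j).
apply: (is_derive_eq H); rewrite /GRing.scale /=; ring.
Qed.

Lemma mx_derive_is_derive m n (M : R -> 'M[R]_(m, n)) t D :
  is_derive t (1 : R) M D -> mx_derive M t D.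
Proof.
move=> [dM <-] i j; apply: DeriveDef; first by move/derivable_mxP : dM; exact.
by rewrite derive_mx // mxE.
Qed.

Lemma ftc_leb (T : R) (f F : R -> R) : continuous f -> continuous F ->
  (forall t, t \in `]0, T[ -> is_derive t (1 : R) F (f t)) ->
  forall t, t \in `[0, T] -> \int[mul]_(s in (`[0%R, t] : set (lebesgueType R))) f s = F t - F 0.
Proof.
move=> cf cF dF t; rewrite in_itv /= => /andP[]; rewrite le_eqVlt => /predU1P[<- _|t0 tT].
  by rewrite Rintegral_leb // set_itv1 Rintegral_set1 subrr.
rewrite Rintegral_leb // /Rintegral (@continuous_FTC2 R f F) //.
- exact: continuous_subspaceT.
- split.
  + move=> x; rewrite in_itv /= => /andP[x0 xt]; apply: ex_derive; apply: dF.
    by rewrite in_itv /= x0 (lt_le_trans xt).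
  + by apply: cvg_at_right_filter; exact: cF.
  + by apply: cvg_at_left_filter; exact: cF.
- move=> x; rewrite in_itv /= => /andP[x0 xt]; rewrite derive1E.
  by apply: derive_val; apply: dF; rewrite in_itv /= x0 (lt_le_trans xt).
Qed.

Lemma primitive_derive (T : R) (f G : R -> R) (c : R) : continuous f ->
  (forall t, t \in `[0, T] -> G t = c + \int[mul]_(s in (`[0%R, t] : set (lebesgueType R))) f s) ->
  forall t, t \in `]0, T[ -> is_derive t (1 : R) G (f t).
Proof.
move=> cf GE t tT; have := tT; rewrite in_itv /= => /andP[t0 t1].
have [dF F'] := @continuous_FTC1_closed R f 0 t T t1
  (continuous_compact_integrable (@segment_compact _ _ _) (continuous_subspaceT cf)) t0 (cf t).
rewrite derive1E in F'.
have H := is_deriveD (is_derive_cst c t (1 : R)) (DeriveDef dF F').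
rewrite add0r in H.
apply: (near_eq_is_derive _ H).
near=> x; rewrite GE ?Rintegral_leb //.
by apply: subset_itv_oo_cc; near: x; exact: near_in_itvoo.
Unshelve. all: by end_near. Qed.

Lemma primitive_continuous (T : R) (f : R -> R) : 0 < T -> continuous f ->
  continuous (fun t => \int[mul]_(s in (`[0%R, clamp T t] : set (lebesgueType R))) f s).
Proof.
move=> T0 cf.
under eq_fun do rewrite Rintegral_leb //.
apply: (@continuous_comp_clamp _ T (fun t => \int[mu]_(s in `[0, t]) f s)) => //.
apply: parameterized_integral_continuous; first exact: ltW.
apply: continuous_compact_integrable; first exact: segment_compact.
exact: continuous_subspaceT.
Qed.

End calculus.

(** * Existence for linear differential equations *)

Section linear_ode.
Context {R : realType}.
Notation mul := (@completed_lebesgue_measure R).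

Lemma mx_cts_bounded m n (T : R) (M : R -> 'M[R]_(m, n)) : 0 <= T -> mx_cts M ->
  exists2 C : R, 0 < C & forall t, t \in `[0, T] -> forall i j, `|M t i j| <= C.
Proof.
move=> T0 cM.
have H (ij : 'I_m * 'I_n) : exists C : R, forall t, t \in `[0, T] -> `|M t ij.1 ij.2| <= C.
  have cn : {within `[0, T], continuous (fun t => `|M t ij.1 ij.2|)}.
    apply: continuous_subspaceT => x; apply: cvg_norm; exact: cM.
  have [c _ cmax] := EVT_max T0 cn.
  by exists (`|M c ij.1 ij.2|) => t tT; exact: cmax.
have [C CP] := choice H.
exists (1 + \sum_ij `|C ij|).
  by rewrite ltr_pwDl // sumr_ge0.
move=> t tT i j; apply: (le_trans (CP (i, j) t tT)).
apply: (le_trans (ler_norm _)).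
by rewrite (bigD1 (i, j)) //= addrCA lerDl addr_ge0 // sumr_ge0.
Qed.

Lemma le_geometric_le0 (a c : R) : (forall k, a <= c * 2^-1 ^+ k) -> a <= 0.
Proof.
move=> H.
have h0 : (fun k => c * 2^-1 ^+ k : R) @ \oo --> c * 0.
  apply: cvgM; first exact: cvg_cst.
  by apply: cvg_expr; rewrite ger0_norm ?invr_ge0 // invf_lt1 // ltr1n.
rewrite mulr0 in h0.
rewrite -(cvg_lim (@Rhausdorff R) h0); apply: limr_ge; first by apply/cvg_ex; exists 0.
by apply: nearW => k; exact: H.
Qed.

Lemma Rintegral_bound (f g : R -> R) (t : R) : continuous f -> continuous g ->
  (forall s, s \in `[0, t] -> `|f s| <= g s) ->
  `|\int[mul]_(s in (`[0%R, t] : set (lebesgueType R))) f s| <=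
  \int[mul]_(s in (`[0%R, t] : set (lebesgueType R))) g s.
Proof.
move=> cf cg fg.
apply: (le_trans (le_normr_Rintegral _ _)).
- exact: measurable_itv_leb.
- exact: continuous_integrable_leb.
apply: le_Rintegral.
- exact: measurable_itv_leb.
- apply: (@continuous_integrable_leb _ (fun s => `|f s|)).
  by move=> x; apply: cvg_norm; exact: cf.
- exact: continuous_integrable_leb.
- by move=> s st; exact: fg.
Qed.

Lemma Rintegral_leb_cst (c t : R) : 0 <= t ->
  \int[mul]_(s in (`[0%R, t] : set (lebesgueType R))) c = c * t.
Proof.
move=> t0; rewrite Rintegral_leb; last by move=> x; exact: cvg_cst.
rewrite Rintegral_cst //= lebesgue_measure_itv /= lte_fin.
by case: ltgtP t0 => // [_ _|<- _]; rewrite ?sube0 ?subr0.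
Qed.

Lemma mulmx_bound n (M : 'M[R]_n) (v : 'cV[R]_n) (m b : R) (i : 'I_n) : 0 <= b ->
  (forall i j, `|M i j| <= m) -> (forall j, `|v j 0| <= b) ->
  `|(M *m v) i 0| <= n%:R * m * b.
Proof.
move=> b0 hM hv; rewrite mxE.
apply: (le_trans (ler_norm_sum _ _ _)).
apply: (@le_trans _ _ (\sum_(j < n) m * b)).
  by apply: ler_sum => j _; rewrite normrM ler_pM.
by rewrite sumr_const card_ord -[leLHS]mulr_natl mulrA.
Qed.

(** The gain of one Picard step: with x = e^(K t) and q = n M / K, the left-
    hand side is the integral over [0, t] of n M p e^(K s), and q <= 1/2. *)
Lemma halving (p q x : R) : 0 <= p -> 0 <= q -> q <= 2^-1 -> 0 <= x ->
  p * q * x - p * q <= p * 2^-1 * x.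
Proof.
move=> p0 q0 q2 x0; have h1 : 0 <= p * x * (2^-1 - q) by rewrite !mulr_ge0 // subr_ge0.
have h2 : 0 <= p * q by exact: mulr_ge0.
by rewrite mulrBr in h1; lra.
Qed.

Section picard.
Variables (n : nat) (T : R) (A : R -> 'M[R]_n) (f : R -> 'cV[R]_n) (y0 : 'cV[R]_n).
Hypotheses (T0 : 0 < T) (cA : mx_cts A) (cf : mx_cts f).

Let step (z : R -> 'cV[R]_n) (t : R) : 'cV[R]_n :=
  y0 + \col_i \int[mul]_(s in (`[0%R, clamp T t] : set (lebesgueType R))) (A s *m z s + f s) i 0.

Let zs k := iter k step (fun=> y0).

Let mx_cts_rhs z : mx_cts z -> mx_cts (fun s => A s *m z s + f s).
Proof. by move=> cz; apply: mx_ctsD => //; exact: mx_ctsM. Qed.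

Let mx_cts_step z : mx_cts z -> mx_cts (step z).
Proof.
move=> cz i j; rewrite ord1 /step.
under eq_fun do rewrite !mxE.
move=> x; apply: cvgD; first exact: cvg_cst.
apply: (@primitive_continuous _ T (fun s => (A s *m z s + f s) i 0)) => //.
exact: mx_cts_rhs.
Qed.

Let mx_cts_zs k : mx_cts (zs k).
Proof. by elim: k => [|k IH]; [exact: mx_cts_cst|exact: mx_cts_step]. Qed.

Let zs_clamp k t : zs k t = zs k (clamp T t).
Proof.
case: k => [|k]; first by [].
by rewrite /zs iterS /step [in RHS](@clamp_id _ T (clamp T t)) // clamp_in.
Qed.

Let step_diff (z w : R -> 'cV[R]_n) (M b : R) (g : R -> R) : mx_cts z -> mx_cts w -> continuous g ->
  (forall t, t \in `[0, T] -> forall i j, `|A t i j| <= M) ->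
  (forall t, t \in `[0, T] -> 0 <= g t) ->
  (forall t, t \in `[0, T] -> forall i, `|z t i 0 - w t i 0| <= g t) ->
  forall t, t \in `[0, T] -> forall i,
  `|step z t i 0 - step w t i 0| <=
    \int[mul]_(s in (`[0%R, t] : set (lebesgueType R))) (n%:R * M * g s).
Proof.
move=> cz cw cg hM g0 zw t tT i.
rewrite /step clamp_id // !mxE opprD addrACA subrr add0r.
rewrite -RintegralB.
- apply: Rintegral_bound.
  + by move=> x; apply: cvgB; exact: mx_cts_rhs.
  + by move=> x; apply: cvgM; [exact: cvg_cst|exact: cg].
  + move=> s; rewrite in_itv /= => /andP[s0 st].
    have sT : s \in `[0, T].
      by move: tT; rewrite !in_itv /= s0 => /andP[_]; exact: le_trans.
    have -> : (A s *m z s + f s) i 0 - (A s *m w s + f s) i 0 = (A s *m (z s - w s)) i 0.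
      by rewrite mulmxBr !mxE opprD addrACA subrr addr0.
    apply: mulmx_bound; [exact: g0|exact: hM|].
    by move=> j; rewrite !mxE; exact: zw.
- exact: measurable_itv_leb.
- by apply: continuous_integrable_leb; exact: mx_cts_rhs.
- by apply: continuous_integrable_leb; exact: mx_cts_rhs.
Qed.

(** Picard iteration. In the weighted norm sup |z(t)| e^(- K t) with K > 2 n
    M, where M bounds the entries of A, each step halves the distance between
    iterates, so they converge uniformly on all of [0, T] however large T is.
    *)
Lemma linear_ode_exists : exists y : R -> 'cV[R]_n, [/\ mx_cts y, y 0 = y0 &
  forall t, t \in `[0, T] -> forall i, y t i 0 = y0 i 0 +
    \int[mul]_(s in (`[0%R, t] : set (lebesgueType R))) (A s *m y s + f s) i 0].
Proof.
have [M M0 hM] := mx_cts_bounded (ltW T0) cA.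
have p2 k : 0 <= 2^-1 ^+ k :> R by rewrite exprn_ge0 // invr_ge0.
have [C C0 hC] : exists2 C : R, 0 < C & forall t, t \in `[0, T] ->
  forall i j, `|(zs 1 t - zs 0 t) i j| <= C.
  by apply: mx_cts_bounded; [exact: ltW|apply: mx_ctsD; [exact: mx_cts_zs|apply: mx_ctsN;
    exact: mx_cts_zs]].
(* the summand 1 keeps K positive in dimension 0 *)
pose K : R := 2 * (n%:R * M) + 1.
have nM0 : 0 <= n%:R * M by rewrite mulr_ge0 // ltW.
have K0 : 0 < K by rewrite /K; lra.
pose e (t : R) : R := expR (K * t).
have ce (c : R) : continuous (fun t => c * e t).
  move=> x; apply: cvgM; first exact: cvg_cst.
  apply: (@continuous_comp _ _ _ (fun t => K * t) expR).
    by apply: cvgM; [exact: cvg_cst|exact: cvg_id].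
  exact: continuous_expR.
have inte (c t : R) : t \in `[0, T] ->
    \int[mul]_(s in (`[0%R, t] : set (lebesgueType R))) (c * e s) = c / K * e t - c / K.
  move=> tT.
  have Hd s : s \in `]0, T[ -> is_derive s (1:R) (fun s => c / K * e s) (c * e s).
    move=> _.
    have H : is_derive s (1:R) (fun x => K * x) (K *: 1) by exact: is_deriveZ.
    have H1 := @is_derive1_comp R expR (fun x => K * x) s _ _ (is_derive_expR (K * s)) H.
    have H2 := @is_deriveZ R R^o R^o (expR \o (fun x => K * x)) (c / K) s 1 _ H1.
    apply: (is_derive_eq H2).
    rewrite /GRing.scale /= /e; field.
    by rewrite gt_eqF.
  by rewrite (ftc_leb (ce c) (ce (c / K)) Hd tT) /e mulr0 expR0 mulr1.
have bnd k : forall t, t \in `[0, T] -> forall i,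
    `|zs k.+1 t i 0 - zs k t i 0| <= C * 2^-1 ^+ k * e t.
  elim: k => [|k IH] t tT i.
    have := hC t tT i 0; rewrite expr0 mulr1 !mxE => /le_trans; apply.
    rewrite ler_peMr ?(ltW C0) // /e -expR0 ler_expR mulr_ge0 // ?(ltW K0) //.
    by move: tT; rewrite in_itv /= => /andP[].
  have Hs := @step_diff (zs k.+1) (zs k) M 0 (fun t => C * 2^-1 ^+ k * e t)
    (@mx_cts_zs k.+1) (@mx_cts_zs k) (ce _) hM _ IH t tT i.
  apply: (le_trans (Hs _)).
    move=> s _; by rewrite !mulr_ge0 ?expR_ge0 ?(ltW C0) //.
  rewrite (@eq_Rintegral _ _ _ mul _ (fun s => n%:R * M * (C * 2^-1 ^+ k) * e s)); last first.
    by move=> s _; rewrite !mulrA.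
  rewrite inte //.
  have P0 : 0 <= C * 2^-1 ^+ k by rewrite mulr_ge0 ?(ltW C0) //.
  have e0 : 0 <= e t by exact: expR_ge0.
  have hK : n%:R * M / K <= 2^-1.
    by rewrite ler_pdivrMr // /K; lra.
  have hK0 : 0 <= n%:R * M / K by rewrite divr_ge0 // ltW.
  have -> : n%:R * M * (C * 2^-1 ^+ k) / K = (C * 2^-1 ^+ k) * (n%:R * M / K) by ring.
  by rewrite exprSr (mulrA C (2^-1 ^+ k)); exact: halving.
pose E := e T.
have bndE k t i : `|zs k.+1 t i 0 - zs k t i 0| <= C * E * 2^-1 ^+ k.
  rewrite zs_clamp [zs k t]zs_clamp.
  apply: (le_trans (bnd k _ (clamp_in t T0) i)).
  rewrite mulrAC ler_wpM2r // ler_wpM2l ?(ltW C0) //.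
  rewrite /E /e ler_expR ler_pM2l //.
  by have := clamp_in t T0; rewrite in_itv /= => /andP[].
pose D := 2 * (C * E).
have D0 : 0 <= D by rewrite mulr_ge0 // mulr_ge0 ?(ltW C0) // expR_ge0.
have tail k l t i : `|zs (k + l)%N t i 0 - zs k t i 0| <= D * 2^-1 ^+ k - D * 2^-1 ^+ (k + l).
  elim: l => [|l IH]; first by rewrite addn0 !subrr normr0.
  rewrite addnS; apply: (le_trans (ler_distD (zs (k + l)%N t i 0) _ _)).
  have := bndE (k + l)%N t i.
  rewrite exprS /D; move: IH; rewrite /D.
  set a := `|_|; set b := `|_|; set c := 2^-1 ^+ (k + l); set h := 2^-1 ^+ k.
  lra.
have tail' k m t i : (k <= m)%N -> `|zs m t i 0 - zs k t i 0| <= D * 2^-1 ^+ k.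
  move=> km; rewrite -(subnKC km); apply: (le_trans (tail _ _ _ _)).
  by rewrite gerBl mulr_ge0 //.
have geo0 (c e' : R) : 0 < e' -> exists k, c * 2^-1 ^+ k < e'.
  move=> e'0; apply: contrapT => /forallNP H.
  have : e' <= 0.
    by apply: (@le_geometric_le0 _ c) => k; rewrite leNgt; apply/negP; exact: H.
  by rewrite leNgt e'0.
have cvgz t i : cvg (zs k t i 0 @[k --> \oo]).
  apply: cauchy_cvg; apply: cauchy_exP => e' e'0.
  have [k hk] := geo0 D e' e'0.
  exists (zs k t i 0); exists k => // m /= km.
  rewrite /ball /= distrC; exact: le_lt_trans (tail' _ _ _ _ km) hk.
pose y t : 'cV[R]_n := \col_i lim (zs k t i 0 @[k --> \oo]).
have yz k t i : `|y t i 0 - zs k t i 0| <= D * 2^-1 ^+ k.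
  rewrite mxE.
  have H : `|zs m t i 0 - zs k t i 0| @[m --> \oo] --> `|lim (zs m t i 0 @[m --> \oo]) - zs k t i
    0|.
    apply: cvg_norm; apply: cvgB; [exact: cvgz|exact: cvg_cst].
  rewrite -(cvg_lim (@Rhausdorff R) H); apply: limr_le.
    by apply/cvg_ex; eexists; exact: H.
  by exists k => // m /= km; exact: tail'.
have ccst (c : R) : continuous (fun _ : R => c) by move=> x; exact: cvg_cst.
have cy : mx_cts y.
  move=> i j x; rewrite ord1; apply/cvgrPdist_lt => e' e'0.
  have e3 : 0 < e' / 3 by rewrite divr_gt0.
  have [k hk] := geo0 D _ e3.
  have /cvgrPdist_lt /(_ _ e3) := @mx_cts_zs k i 0 x.
  apply: filterS => w hw.
  have h1 := yz k x i; have h2 := yz k w i; rewrite distrC in h2.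
  apply: (le_lt_trans (ler_distD (zs k x i 0) _ _)).
  apply: (@le_lt_trans _ _ (D * 2^-1 ^+ k + (e'/3 + D * 2^-1 ^+ k))); last by lra.
  apply: lerD => //.
  apply: (le_trans (ler_distD (zs k w i 0) _ _)).
  by apply: lerD => //; exact: ltW.
have zs0 k : zs k 0 = y0.
  case: k => // k; rewrite /zs /= /step clamp_id; last by rewrite in_itv /= lexx ltW.
  apply/matrixP => i j; rewrite !mxE ord1.
  by rewrite Rintegral_leb ?set_itv1 ?Rintegral_set1 ?addr0 //; exact: (mx_cts_rhs (@mx_cts_zs k)).
exists y; split => //.
  apply/matrixP => i j; rewrite mxE ord1.
  have -> : (fun k => zs k 0 i 0) = (fun=> y0 i 0) by apply/funext => k; rewrite zs0.
  exact: lim_cst.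
move=> t tT i.
have yst : y t i 0 - step y t i 0 = 0.
  apply/normr0_eq0; apply/eqP; rewrite eq_le normr_ge0 andbT.
  apply: (@le_geometric_le0 _ (D + n%:R * M * D * T)) => k.
  apply: (le_trans (ler_distD (zs k.+1 t i 0) _ _)).
  rewrite mulrDl; apply: lerD.
    apply: (le_trans (yz _ _ _)); rewrite exprS mulrA ler_wpM2r //.
    lra.
  have Hs := @step_diff (zs k) y M 0 (fun=> D * 2^-1 ^+ k)
    (@mx_cts_zs k) cy (ccst _) hM _ _ t tT i.
  apply: (le_trans (Hs _ _)).
  - by move=> s _; rewrite mulr_ge0 //.
  - by move=> s _ j; rewrite distrC.
  move: tT; rewrite in_itv /= => /andP[t0 tT].
  rewrite Rintegral_leb_cst //.
  have -> : n%:R * M * D * T * 2^-1 ^+ k = n%:R * M * (D * 2^-1 ^+ k) * T by ring.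
  by rewrite ler_wpM2l // mulr_ge0 // mulr_ge0.
move/eqP: yst; rewrite subr_eq0 => /eqP ->.
by rewrite /step clamp_id // !mxE.
Qed.
End picard.
End linear_ode.

(** * Integrable real functions *)

Section integrable_real.
Context d (U : measurableType d) {R : realType}.
Variables (mu : {measure set U -> \bar R}) (D : set U).
Hypothesis mD : measurable D.
Implicit Types f g h : U -> R.

Lemma le_integrable_real f g : measurable_fun D f ->
  (forall x, D x -> `|f x| <= g x) -> mu.-integrable D (EFin \o g) ->
  mu.-integrable D (EFin \o f).
Proof.
move=> mf fg; apply: le_integrable => //; first exact/measurable_EFinP.
by move=> x Dx; rewrite /= lee_fin (le_trans (fg x Dx)) // ler_norm.
Qed.

Lemma integrable_boundedM (C : R) h f : measurable_fun D h ->
  (forall x, D x -> `|h x| <= C) -> mu.-integrable D (EFin \o f) ->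
  mu.-integrable D (EFin \o (fun x => h x * f x)).
Proof.
move=> mh hC fi.
have := @integrableMr _ _ _ mu D mD h (EFin \o f) mh _ fi; apply.
exists C; split; first exact: num_real.
by move=> M CM x Dx; rewrite /= (le_trans (hC x Dx)) // ltW.
Qed.

Lemma integrableD_real f g : mu.-integrable D (EFin \o f) ->
  mu.-integrable D (EFin \o g) -> mu.-integrable D (EFin \o (fun x => f x + g x)).
Proof. by move=> fi gi; exact: (integrableD mD fi gi). Qed.

Lemma integrableZ_real (c : R) f : mu.-integrable D (EFin \o f) ->
  mu.-integrable D (EFin \o (fun x => c * f x)).
Proof. by move=> fi; exact: (integrableZl mD c fi). Qed.

Lemma integrable_sum_real n (f : 'I_n -> U -> R) :
  (forall i, mu.-integrable D (EFin \o f i)) ->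
  mu.-integrable D (EFin \o (fun x => \sum_i f i x)).
Proof.
move=> fi; have := @integrable_sum _ _ _ mu D mD 'I_n (index_enum 'I_n) xpredT (fun i =>
  EFin \o f i) (fun i _ => fi i).
by apply: eq_integrable => // x _; rewrite /= sumEFin.
Qed.

Lemma Rintegral_sum n (f : 'I_n -> U -> R) :
  (forall i, mu.-integrable D (EFin \o f i)) ->
  \int[mu]_(x in D) (\sum_i f i x) = \sum_i \int[mu]_(x in D) f i x.
Proof.
elim: n f => [|n IH] f fi.
  under eq_Rintegral do rewrite big_ord0.
  by rewrite big_ord0 Rintegral_cst // mul0r.
rewrite big_ord_recl -IH // -RintegralD //.
  by apply: eq_Rintegral => x _; rewrite big_ord_recl.
exact: integrable_sum_real.
Qed.

(** Stated for three terms because the quantities to be expanded are quadratic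
    polynomials in the size of a perturbation. *)
Lemma Rintegral_affine (c e : R) f g h : mu.-integrable D (EFin \o f) ->
  mu.-integrable D (EFin \o g) -> mu.-integrable D (EFin \o h) ->
  \int[mu]_(x in D) (f x + c * g x + e * h x) =
  \int[mu]_(x in D) f x + c * \int[mu]_(x in D) g x + e * \int[mu]_(x in D) h x.
Proof.
move=> fi gi hi.
have cgi := integrableZ_real c gi; have ehi := integrableZ_real e hi.
have fgi := integrableD_real fi cgi.
by rewrite (RintegralD mD fgi ehi) (RintegralD mD fi cgi) !RintegralZl.
Qed.

Lemma integrable_rowM n (C : R) (a : U -> 'rV[R]_n) (f : U -> 'cV[R]_n) :
  (forall i, measurable_fun D (fun x => a x 0 i)) ->
  (forall x, D x -> forall i, `|a x 0 i| <= C) ->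
  (forall i, mu.-integrable D (EFin \o (fun x => f x i 0))) ->
  mu.-integrable D (EFin \o (fun x => (a x *m f x) 0 0)).
Proof.
move=> ma aC fi.
rewrite (_ : (fun x => _) = (fun x => \sum_i a x 0 i * f x i 0)); last first.
  by apply/funext => x; rewrite mxE.
apply: integrable_sum_real => i.
by apply: (@integrable_boundedM C) => // x Dx; exact: aC.
Qed.

End integrable_real.

(** * Uniqueness and backward problems for linear differential equations *)

Section uniqueness.
Context {R : realType}.

(** Gronwall backwards in time: the derivative of |q|^2 is at least - K |q|^2,
    so e^(K t) |q(t)|^2 is nondecreasing, and it vanishes at T. *)
Lemma linear_ode_unique n (T : R) (N : R -> 'M[R]_n) (q : R -> 'cV[R]_n) :
  0 < T -> mx_cts N -> mx_cts q ->
  (forall t, t \in `]0, T[ -> mx_derive q t (N t *m q t)) -> q T = 0 ->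
  forall t, t \in `[0, T] -> q t = 0.
Proof.
move=> T0 cN cq dq qT.
have [M M0 hM] := mx_cts_bounded (ltW T0) cN.
pose K : R := 2 * (n%:R * M).
pose phi t : R := ((q t)^T *m q t) 0 0.
have phiE t : phi t = \sum_i q t i 0 ^+ 2.
  by rewrite /phi mxE; apply: eq_bigr => i _; rewrite mxE expr2.
have dphi t : t \in `]0, T[ -> is_derive t (1:R) phi (2 * ((q t)^T *m (N t *m q t)) 0 0).
  move=> tT; have H := mx_deriveM (mx_deriveT (dq _ tT)) (dq _ tT) 0 0; apply: (is_derive_eq H).
  rewrite mxE mulr2n mulrDl mul1r; congr (_ + _).
  by rewrite -[in LHS](trmxK (q t)) -trmx_mul mxE trmxK.
have dphi_ge t : t \in `]0, T[ -> - (K * phi t) <= 2 * ((q t)^T *m (N t *m q t)) 0 0.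
  move=> tT; have tT' : t \in `[0, T] by exact: subset_itv_oo_cc tT.
  rewrite /K -mulrA -mulrN ler_pM2l //.
  suff : `|((q t)^T *m (N t *m q t)) 0 0| <= n%:R * M * phi t.
    by rewrite ler_norml => /andP[].
  rewrite mxE; apply: (le_trans (ler_norm_sum _ _ _)).
  apply: (@le_trans _ _ (\sum_i \sum_j M * 2^-1 * (q t i 0 ^+ 2 + q t j 0 ^+ 2))).
    apply: ler_sum => i _; rewrite !mxE normrM.
    apply: (le_trans (ler_wpM2l (normr_ge0 _) (ler_norm_sum _ _ _))).
    rewrite mulr_sumr; apply: ler_sum => j _.
    rewrite normrM mulrCA -mulrA; apply: ler_pM => //.
      exact: hM.
    rewrite -normrM ler_norml.
    have h1 := sqr_ge0 (q t i 0 - q t j 0); have h2 := sqr_ge0 (q t i 0 + q t j 0).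
    by apply/andP; split; nra.
  have -> : \sum_i \sum_j M / 2 * (q t i 0 ^+ 2 + q t j 0 ^+ 2) = n%:R * M * phi t.
    transitivity (\sum_(i < n) (M / 2 * (n%:R * q t i 0 ^+ 2 + phi t))).
      apply: eq_bigr => i _; rewrite -mulr_sumr; congr (_ * _).
      by rewrite big_split /= sumr_const card_ord -phiE mulr_natl.
    rewrite -mulr_sumr big_split /= -mulr_sumr -phiE sumr_const card_ord -mulr_natl.
    by field.
  by [].
pose psi t := expR (K * t) * phi t.
have dpsi t : t \in `]0, T[ -> is_derive t (1:R) psi
   (expR (K * t) * (2 * ((q t)^T *m (N t *m q t)) 0 0 + K * phi t)).
  move=> tT.
  have H : is_derive t (1:R) (fun x => K * x) (K *: 1) by exact: is_deriveZ.
  have H1 := @is_derive1_comp R expR (fun x => K * x) t _ _ (is_derive_expR (K * t)) H.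
  have H2 := @is_deriveM R R^o (expR \o (fun x => K * x)) phi t 1 _ _ H1 (dphi _ tT).
  by apply: (is_derive_eq H2); rewrite /GRing.scale /=; ring.
have cphi : continuous phi by apply: mx_ctsM => //; exact: mx_ctsT.
have cpsi : continuous psi.
  move=> x; apply: cvgM; last exact: cphi.
  apply: (@continuous_comp _ _ _ (fun t => K * t) expR).
    by apply: cvgM; [exact: cvg_cst|exact: cvg_id].
  exact: continuous_expR.
move=> t tT.
have psi_le : psi t <= psi T.
  have := tT; rewrite in_itv /= => /andP[t0 t1].
  apply: (@ger0_derive1_le_cc R psi 0 T).
  - by move=> x xT; have [dx _] := dpsi x xT.
  - move=> x xT; rewrite derive1E (@derive_val _ _ _ _ _ _ _ (dpsi x xT)).
    rewrite mulr_ge0 ?expR_ge0 //.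
    by have := dphi_ge x xT; lra.
  - exact: continuous_subspaceT.
  - exact: tT.
  - by rewrite in_itv /= lexx (ltW T0).
  - exact: t1.
have phiT : phi T = 0 by rewrite /phi qT trmx0 mul0mx mxE.
have phit : phi t <= 0.
  by move: psi_le; rewrite /psi phiT mulr0 pmulr_rle0 // expR_gt0.
have phi0 : phi t = 0.
  by apply/eqP; rewrite eq_le phit phiE sumr_ge0 // => i _; exact: sqr_ge0.
apply/matrixP => i j; rewrite ord1 !mxE; move/eqP: phi0.
rewrite phiE psumr_eq0; last by move=> k _; exact: sqr_ge0.
by move/allP => /(_ i (mem_index_enum i)); rewrite sqrf_eq0 => /eqP.
Qed.

(** Reversal of time, t -> T - t, in the initial value problem. *)
Lemma linear_ode_backward n (T : R) (A : R -> 'M[R]_n) (f : R -> 'cV[R]_n) (yT : 'cV[R]_n) :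
  0 < T -> mx_cts A -> mx_cts f -> exists p : R -> 'cV[R]_n, [/\ mx_cts p, p T = yT &
  forall t, t \in `]0, T[ -> mx_derive p t (A t *m p t + f t)].
Proof.
move=> T0 cA cf.
have crev : continuous (fun t => T - t) by move=> x; apply: cvgB; [exact: cvg_cst|exact: cvg_id].
have crevm m k (M : R -> 'M[R]_(m, k)) : mx_cts M -> mx_cts (fun t => M (T - t)).
  by move=> cM i j x; apply: (@continuous_comp _ _ _ (fun t => T - t) (fun t => M t i j));
    [exact: crev|exact: cM].
have [z [cz z0 zE]] := linear_ode_exists yT T0 (mx_ctsN (crevm _ _ _ cA)) (mx_ctsN (crevm _ _ _
  cf)).
exists (fun t => z (T - t)); split; [exact: crevm|by rewrite subrr|].
move=> t tT i j; rewrite ord1.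
have tT' : T - t \in `]0, T[ by move: tT; rewrite !in_itv /= => /andP[? ?]; apply/andP; split; lra.
have cr : continuous (fun s => (- A (T - s) *m z s + - f (T - s)) i 0).
  by apply: mx_ctsD; [apply: mx_ctsM => //;
    exact: mx_ctsN (crevm _ _ _ cA)|exact: mx_ctsN (crevm _ _ _ cf)].
have dz := primitive_derive cr (fun t tT => zE t tT i) tT'.
have dr : is_derive t (1:R) (fun s => T - s) (0 - 1) by exact: is_deriveB.
have H := @is_derive1_comp R (fun s => z s i 0) (fun s => T - s) t _ _ dz dr.
apply: (is_derive_eq H); rewrite subKr !mxE sub0r mulrN1 opprD opprK; congr (_ + _).
rewrite -sumrN; apply: eq_bigr => k _; by rewrite mxE mulNr opprK.
Qed.

End uniqueness.

(** * Test functions with short support *)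

Section trapezoid.
Context {R : realType}.

(** Continuous functions supported in [a, b] which converge to the indicator
    of ]a, b[: they localize a control to a short interval without destroying
    its continuity. *)
Definition trapezoid (a b : R) (k : nat) (t : R) : R :=
  Num.max 0 (Num.min 1 (Num.min (k%:R * (t - a)) (k%:R * (b - t)))).

Lemma continuous_trapezoid a b k : continuous (trapezoid a b k).
Proof.
have c1 : continuous (fun t => k%:R * (t - a)).
  by move=> x; apply: cvgM; [exact: cvg_cst|apply: cvgB; [exact: cvg_id|exact: cvg_cst]].
have c2 : continuous (fun t => k%:R * (b - t)).
  by move=> x; apply: cvgM; [exact: cvg_cst|apply: cvgB; [exact: cvg_cst|exact: cvg_id]].
pose f t := Num.min (k%:R * (t - a)) (k%:R * (b - t)).
have cf : continuous f.
  move=> x; apply: (@continuous_min _ _ (fun t => k%:R * (t - a)) (fun t => k%:R * (b - t))).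
    exact: c1.
  exact: c2.
have cg : continuous (fun t => Num.min 1 (f t)).
  by move=> x; apply: (@continuous_min _ _ (fun=> 1) f); [exact: cvg_cst|exact: cf].
move=> x; apply: (@continuous_max _ _ (fun=> 0) (fun t => Num.min 1 (f t))).
  exact: cvg_cst.
exact: cg.
Qed.

Lemma trapezoid_bounds a b k t : 0 <= trapezoid a b k t <= 1.
Proof. by rewrite /trapezoid le_max lexx /= ge_max ler01 ge_min lexx. Qed.

Lemma trapezoid_out a b k t : t \notin `]a, b[ -> trapezoid a b k t = 0.
Proof.
rewrite in_itv /= negb_and -!leNgt => H; apply: max_l; rewrite !ge_min.
case/orP: H => H.
  by rewrite [k%:R * (t - a) <= 0]mulr_ge0_le0 ?subr_le0 ?orbT.
by rewrite [k%:R * (b - t) <= 0]mulr_ge0_le0 ?subr_le0 ?orbT.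
Qed.

Lemma trapezoid_cvg a b t :
  trapezoid a b k t @[k --> \oo] --> ((t \in `]a, b[)%:R : R).
Proof.
have [tab|tab] := boolP (t \in `]a, b[); last first.
  by under eq_fun do rewrite trapezoid_out //; exact: cvg_cst.
have := tab; rewrite in_itv /= => /andP[ta tb].
apply: (@cvg_near_cst _ R^o).
have h (c : R) : 0 < c -> \forall k \near \oo, 1 <= k%:R * c.
  move=> c0; near=> k; rewrite -ler_pdivrMr // mul1r.
  by near: k; exact: nbhs_infty_ger.
near=> k; apply/eqP; rewrite /trapezoid.
rewrite min_l ?max_r // le_min.
by apply/andP; split; near: k; apply: h; rewrite subr_gt0.
Unshelve. all: by end_near. Qed.

End trapezoid.

Section stationary.
Context {R : realType}.
Notation mul := (@completed_lebesgue_measure R).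
Notation int0 f t := (\int[mul]_(s in (`[0%R, t] : set (lebesgueType R))) f s).

Lemma measurable_mx_cts_leb m n (D : interval R) (M : R -> 'M[R]_(m, n)) i j : mx_cts M ->
  measurable_fun ([set` D] : set (lebesgueType R)) ((fun t => M t i j) : lebesgueType R -> R).
Proof.
move=> cM; apply: measurable_fun_leb; first exact: measurable_itv.
apply: measurable_funTS; exact: continuous_measurable_fun.
Qed.

Lemma integrable_mx_cts_rowM n (T : R) (a : R -> 'rV[R]_n) (u : R -> 'cV[R]_n) :
  0 <= T -> mx_cts a ->
  (forall i, mul.-integrable (`[0%R, T] : set (lebesgueType R)) (EFin \o (fun t => u t i 0))) ->
  mul.-integrable (`[0%R, T] : set (lebesgueType R)) (EFin \o (fun t => (a t *m u t) 0 0)).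
Proof.
move=> T0 ca ui; have [C C0 hC] := mx_cts_bounded T0 ca.
apply: (@integrable_rowM _ (lebesgueType R) R mul _ (measurable_itv_leb _) n C (a : lebesgueType R
  -> _) u).
- by move=> i; exact: measurable_mx_cts_leb.
- by move=> t tT i; exact: hC.
- exact: ui.
Qed.

Lemma leb_set1 (b : R) : mul ([set b] : set (lebesgueType R)) = 0%E.
Proof. exact: (@lebesgue_measure_set1 R b). Qed.

Lemma Rintegral_leb_set1 (T b : R) (f : R -> R) : b \in `[0, T] ->
  mul.-integrable (`[0%R, T] : set (lebesgueType R)) (EFin \o f) ->
  \int[mul]_(s in ([set b] : set (lebesgueType R))) f s = 0.
Proof.
move=> bT fi; have mb : measurable ([set b] : set (lebesgueType R)).
  by rewrite -set_itv1; exact: measurable_itv_leb.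
have mf : measurable_fun ([set b] : set (lebesgueType R)) (EFin \o f).
  apply: (measurable_int mul); apply: integrableS fi; [exact: measurable_itv_leb|exact: mb|].
  by move=> x /= ->.
by have := null_set_integral mb mf (leb_set1 b); rewrite /Rintegral => ->.
Qed.

Lemma Rintegral_leb_oo (T a b : R) (f : R -> R) : 0 <= a -> a <= b -> b <= T ->
  mul.-integrable (`[0%R, T] : set (lebesgueType R)) (EFin \o f) ->
  \int[mul]_(s in (`]a, b[ : set (lebesgueType R))) f s = int0 f b - int0 f a.
Proof.
move=> a0 ab bT fi.
have sub (i : interval R) : [set` i] `<=` `[0, T] ->
    mul.-integrable ([set` i] : set (lebesgueType R)) (EFin \o f).
  by move=> H; apply: integrableS fi => //; exact: measurable_itv_leb.
have [->|ab'] := eqVneq a b.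
  by rewrite subrr set_itvoo0 Rintegral_set0.
have lab : a < b by rewrite lt_neqAle ab' ab.
have -> : `[0, b]%classic = (`[0, a]%classic `|` `]a, b]%classic) :> set R.
  by rewrite -itv_bndbnd_setU // bnd_simp.
rewrite Rintegral_setU.
- rewrite addrC addKr -(@setUitv1 _ _ (BRight a) b true); last by rewrite bnd_simp.
  rewrite Rintegral_setU.
  + by rewrite (Rintegral_leb_set1 _ fi) ?addr0 // in_itv /= bT (le_trans a0).
  + exact: measurable_itv_leb.
  + by rewrite -set_itv1; exact: measurable_itv_leb.
  + rewrite setUitv1 ?bnd_simp //; apply: sub => x /=; rewrite !in_itv /= => /andP[ax xb].
    by rewrite (le_trans a0 (ltW ax)) (le_trans xb).
  + apply/disj_setPLR => x /=; rewrite in_itv /= => /andP[_ xb] xE; move: xb; rewrite xE ltxx //.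
- exact: measurable_itv_leb.
- exact: measurable_itv_leb.
- rewrite -itv_bndbnd_setU ?bnd_simp //; apply: sub => x /=.
  by rewrite !in_itv /= => /andP[-> xb]; exact: le_trans bT.
- apply/disj_setPLR => x /=; rewrite !in_itv /= => /andP[_ xa] /andP[ax _].
  by move: xa; rewrite leNgt ax.
Qed.

(** A fundamental lemma of the calculus of variations. Test functions on short
    intervals determine the increments of the primitive of phi over intervals
    of length at most eps, and these increments add up to its value at t. *)
Lemma short_support_primitive0 (T eps : R) (phi : R -> R) : 0 <= T -> 0 < eps ->
  mul.-integrable (`[0%R, T] : set (lebesgueType R)) (EFin \o phi) ->
  (forall a b k, 0 <= a -> a <= b -> b <= T -> b - a <= eps ->
     int0 (fun s => trapezoid a b k s * phi s) T = 0) ->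
  forall t, t \in `[0, T] -> int0 phi t = 0.
Proof.
move=> T0 e0 fi H.
have step a b : 0 <= a -> a <= b -> b <= T -> b - a <= eps -> int0 phi b = int0 phi a.
  move=> a0 ab bT bae.
  apply/eqP; rewrite -subr_eq0 -(Rintegral_leb_oo a0 ab bT fi); apply/eqP.
  have mt k : measurable_fun (`[0%R,
    T] : set (lebesgueType R)) (trapezoid a b k : lebesgueType R -> R).
    apply: measurable_fun_leb; first exact: measurable_itv.
    apply: measurable_funTS; apply: continuous_measurable_fun; exact: continuous_trapezoid.
  have mphi : measurable_fun (`[0%R, T] : set (lebesgueType R)) (phi : lebesgueType R -> R).
    by apply/measurable_EFinP; exact: (measurable_int mul).
  have tle k s : `|trapezoid a b k s| <= 1.
    by have /andP[h0 h1] := trapezoid_bounds a b k s; rewrite ger0_norm.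
  have := @dominated_cvg _ (lebesgueType R) R mul (`[0%R, T]%classic) (measurable_itv_leb _)
    (fun k s => (trapezoid a b k s * phi s)%:E) (fun s => ((s \in `]a, b[)%:R * phi s)%:E)
    (fun s => `|phi s|%:E).
  have -> : (fun k => \int[mul]_(x in `[0%R, T]) (trapezoid a b k x * phi x)%:E)%E = (fun=> 0%E).
    apply/funext => k.
    rewrite -[LHS]fineK; last first.
      apply: integrable_fin_num; first exact: measurable_itv_leb.
      apply: (@integrable_boundedM _ (lebesgueType R) R mul _ _ 1 (trapezoid a b k : lebesgueType
        R -> R)) => //.
      exact: measurable_itv_leb.
    by have := H a b k a0 ab bT bae; rewrite /Rintegral => ->.
  have Habs k s : (`[0, T]%classic : set R) s ->
    (`|(trapezoid a b k s * phi s)%:E| <= `|phi s|%:E)%E.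
    by move=> _; rewrite /= lee_fin normrM ler_piMl.
  move=> /(_ _ _ _ _ Habs) H0.
  have {}H0 : (fun=> 0%E) @ \oo --> (\int[mul]_(x in (`[0%R,
    T] : set (lebesgueType R))) ((x \in `]a, b[)%:R * phi x)%:E)%E.
    apply: H0.
    - by move=> k; apply/measurable_EFinP; apply: measurable_funM.
    - move=> s _; apply: cvg_EFin; first exact: nearW.
      by apply: cvgM; [exact: trapezoid_cvg|exact: cvg_cst].
    - by [].
    - exact: (integrable_norm fi).
  have E0 : (0 = \int[mul]_(x in (`[0%R, T] : set (lebesgueType R))) ((x \in `]a,
    b[)%:R * phi x)%:E)%E.
    by apply: (cvg_unique _ _ H0); [exact: ereal_hausdorff|exact: cvg_cst].
  have -> : `]a, b[%classic = `[0, T] `&` `]a, b[ :> set R.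
    rewrite setIidr // => x /=; rewrite !in_itv /= => /andP[ax xb].
    by rewrite (le_trans a0 (ltW ax)) (le_trans (ltW xb)).
  rewrite Rintegral_mkcondr /Rintegral.
  transitivity (fine (\int[mul]_(x in (`[0%R, T] : set (lebesgueType R))) ((x \in `]a,
    b[)%:R * phi x)%:E)%E).
    congr fine; apply: eq_integral => x _; rewrite patchE.
    by rewrite mem_setE; case: ifP => _; rewrite ?mul1r ?mul0r.
  by rewrite -E0.
have phi0 : int0 phi 0 = 0.
  have -> : `[0%R, 0%R]%classic = [set 0%R] :> set R by rewrite set_itv1.
  by apply: Rintegral_leb_set1 fi; rewrite in_itv /= lexx.
have main n t : t \in `[0, T] -> t <= n%:R * eps -> int0 phi t = 0.
  elim: n t => [|n IH] t; rewrite in_itv /= => /andP[t0 tT].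
    by rewrite mul0r => tle0; rewrite (@le_anti _ _ t 0) ?tle0.
  rewrite -natr1 mulrDl mul1r => tn.
  have [te|te] := leP eps t; last by rewrite (step 0 t) // subr0 ltW.
  have te' : t - eps <= t by rewrite gerBl ltW.
  rewrite (step (t - eps) t) // ?subr_ge0 ?subKr //.
  by apply: IH; [rewrite in_itv /= subr_ge0 te (le_trans te')|rewrite lerBlDr].
move=> t tT; have [n hn] : exists n : nat, t <= n%:R * eps.
  exists (Num.bound (t / eps)); rewrite -ler_pdivrMr // ltW // archi_boundP //.
  by rewrite divr_ge0 ?(ltW e0) //; move: tT; rewrite in_itv /= => /andP[].
exact: main tT hn.
Qed.

End stationary.

(** * The deterministic feedback law *)

Section feedback.
Context {R : realType}.
Notation mul := (@completed_lebesgue_measure R).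
Notation int0 f t := (\int[mul]_(s in (`[0%R, t] : set (lebesgueType R))) f s).
Variables (n m : nat) (T eps : R).
Variables (A : R -> 'M[R]_n) (B : R -> 'M[R]_(n, m)) (S Si : R -> 'M[R]_m).
Variables (Q : R -> 'M[R]_n) (K : 'M[R]_n) (Pi : R -> 'M[R]_n).
Variables (x : R -> 'cV[R]_n) (u : R -> 'cV[R]_m).
Hypotheses (T0 : 0 < T) (e0 : 0 < eps).
Hypotheses (cA : mx_cts A) (cB : mx_cts B) (cS : mx_cts S) (cSi : mx_cts Si) (cQ : mx_cts Q)
  (cPi : mx_cts Pi) (cx : mx_cts x).
Hypothesis SiS : forall t, t \in `[0, T] -> Si t *m S t = 1%:M.
Hypothesis ui : forall j,
  mul.-integrable (`[0%R, T] : set (lebesgueType R)) (EFin \o (fun t => u t j 0)).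
Hypothesis xE : forall t, t \in `[0, T] -> forall i,
  x t i 0 = x 0 i 0 + int0 (fun s => (A s *m x s + B s *m u s) i 0) t.
Hypothesis stat : forall (eta : R -> 'cV[R]_m) (y : R -> 'cV[R]_n) (a b : R),
  mx_cts eta -> mx_cts y -> 0 <= a -> a <= b -> b <= T -> b - a <= eps ->
  (forall t, t \notin `]a, b[ -> eta t = 0) -> y 0 = 0 ->
  (forall t, t \in `[0, T] -> forall i,
    y t i 0 = int0 (fun s => (A s *m y s + B s *m eta s) i 0) t) ->
  int0 (fun s => ((y s)^T *m Q s *m x s + (eta s)^T *m S s *m u s) 0 0) T
    + ((y T)^T *m K *m x T) 0 0 = 0.
Hypothesis dPi : forall t, t \in `]0, T[ -> mx_derive Pi t
  (- (Pi t *m A t) - (A t)^T *m Pi t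
   + Pi t *m B t *m Si t *m (B t)^T *m Pi t - Q t).
Hypothesis PiT : Pi T = K.

Let tT : T \in `[0, T]. Proof. by rewrite in_itv /= lexx (ltW T0). Qed.

Let int_row p (a : R -> 'rV[R]_p) (v : R -> 'cV[R]_p) : mx_cts a ->
  (forall i, mul.-integrable (`[0%R, T] : set (lebesgueType R)) (EFin \o (fun t => v t i 0))) ->
  mul.-integrable (`[0%R, T] : set (lebesgueType R)) (EFin \o (fun t => (a t *m v t) 0 0)).
Proof. by apply: integrable_mx_cts_rowM; exact: ltW. Qed.

Let int_cts m' n' (M : R -> 'M[R]_(m', n')) i j : mx_cts M ->
  mul.-integrable (`[0%R, T] : set (lebesgueType R)) (EFin \o (fun t => M t i j)).
Proof. by move=> cM; apply: (@continuous_integrable_leb _ (fun t => M t i j)); exact: cM. Qed.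

(** The adjoint argument: stationarity says that S u + B^T p has zero integral
    over all intervals, hence u has the same primitives as the continuous
    control v = - Si B^T p, and the Riccati equation identifies p with Pi x.
    The conclusion is about primitives because u is only integrable. *)
Lemma stationary_feedback t j : t \in `[0, T] ->
  int0 (fun s => (u s + Si s *m (B s)^T *m Pi s *m x s) j 0) t = 0.
Proof.
have cQx : mx_cts (fun s => Q s *m x s) by exact: mx_ctsM.
(* the adjoint state: p' = - A^T p - Q x and p(T) = K x(T) *)
have [p [cp pT dp]] := linear_ode_backward (K *m x T) T0 (mx_ctsN (mx_ctsT cA)) (mx_ctsN cQx).
have Sup_int (zeta : R -> 'rV[R]_m) : mx_cts zeta ->
  mul.-integrable (`[0%R, T] : set (lebesgueType R))
    (EFin \o (fun s => (zeta s *m (S s *m u s + (B s)^T *m p s)) 0 0)).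
  move=> cz.
  have -> : (fun s => (zeta s *m (S s *m u s + (B s)^T *m p s)) 0 0) =
     (fun s => (zeta s *m S s *m u s) 0 0 + (zeta s *m (B s)^T *m p s) 0 0).
    by apply/funext => s; rewrite mulmxDr mxE !mulmxA.
  apply: (@integrableD_real _ (lebesgueType R)); first exact: measurable_itv_leb.
    by apply: int_row => //; exact: mx_ctsM.
  by apply: int_cts; apply: mx_ctsM => //; apply: mx_ctsM => //; exact: mx_ctsT.
(* integrating y^T p by parts removes y from the stationarity condition *)
have weak (eta : R -> 'cV[R]_m) a b : mx_cts eta -> 0 <= a -> a <= b -> b <= T -> b - a <= eps ->
  (forall t, t \notin `]a, b[ -> eta t = 0) ->
  int0 (fun s => ((eta s)^T *m (S s *m u s + (B s)^T *m p s)) 0 0) T = 0.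
  move=> ceta a0 ab bT bae eta0.
  have [y [cy y0 yE]] := linear_ode_exists 0 T0 cA (mx_ctsM cB ceta).
  have cr : mx_cts (fun s => A s *m y s + B s *m eta s).
    by apply: mx_ctsD; exact: mx_ctsM.
  have dy s : s \in `]0, T[ -> mx_derive y s (A s *m y s + B s *m eta s).
    move=> sT i k; rewrite ord1; apply: (@primitive_derive _ T (fun s =>
      (A s *m y s + B s *m eta s) i 0) _ (y 0 i 0)) => //.
    by move=> r rT; rewrite y0; exact: yE.
  have yE' r : r \in `[0, T] -> forall i,
    y r i 0 = int0 (fun s => (A s *m y s + B s *m eta s) i 0) r.
    by move=> rT i; rewrite yE // mxE add0r.
  have st := stat ceta cy a0 ab bT bae eta0 y0 yE'.
  pose g s := ((eta s)^T *m (B s)^T *m p s - (y s)^T *m Q s *m x s) 0 0.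
  have cg : mx_cts (fun s => (eta s)^T *m (B s)^T *m p s - (y s)^T *m Q s *m x s).
    apply: mx_ctsD; first by apply: mx_ctsM => //; apply: mx_ctsM; exact: mx_ctsT.
    by apply: mx_ctsN; apply: mx_ctsM => //; apply: mx_ctsM => //; exact: mx_ctsT.
  have ibp : int0 g T = ((y T)^T *m K *m x T) 0 0.
    pose F s := ((y s)^T *m p s) 0 0.
    have cF : continuous F by apply: mx_ctsM => //; exact: mx_ctsT.
    have dF s : s \in `]0, T[ -> is_derive s (1:R) F (g s).
      move=> sT; have H := mx_deriveM (mx_deriveT (dy _ sT)) (dp _ sT) 0 0.
      apply: (is_derive_eq H); congr fun_of_matrix; rewrite linearD /= mulmxDl.
      rewrite !trmx_mul mulmxDr mulNmx !mulmxN !mulmxA.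
      by rewrite addrACA subrr add0r.
    by rewrite (ftc_leb (cg 0 0) cF dF tT) /F y0 trmx0 mul0mx [X in _ - X]mxE subr0 pT mulmxA.
  rewrite -[RHS]st -ibp -RintegralD.
  - apply: eq_Rintegral => s _; rewrite /g mulmxDr !mulmxA !mxE; ring.
  - exact: measurable_itv_leb.
  - have -> : (fun s => ((y s)^T *m Q s *m x s + (eta s)^T *m S s *m u s) 0 0) =
      (fun s => ((y s)^T *m Q s *m x s) 0 0 + ((eta s)^T *m S s *m u s) 0 0).
      by apply/funext => s; rewrite mxE.
    apply: (@integrableD_real _ (lebesgueType R)); first exact: measurable_itv_leb.
      by apply: int_cts; apply: mx_ctsM => //; apply: mx_ctsM => //; exact: mx_ctsT.
    by apply: int_row => //; apply: mx_ctsM => //; exact: mx_ctsT.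
  - exact: (int_cts 0 0 cg).
(* localized multiples of zeta are admissible test functions *)
have strong (zeta : R -> 'rV[R]_m) : mx_cts zeta -> forall t, t \in `[0, T] ->
  int0 (fun s => (zeta s *m (S s *m u s + (B s)^T *m p s)) 0 0) t = 0.
  move=> cz; apply: (short_support_primitive0 (ltW T0) e0); first exact: Sup_int.
  move=> a b k a0 ab bT bae.
  rewrite -[RHS](weak (fun s => trapezoid a b k s *: (zeta s)^T) a b) //.
  - by apply: eq_Rintegral => s _; rewrite linearZ /= trmxK -scalemxAl [in RHS]mxE.
  - by apply: mx_ctsZ; [exact: continuous_trapezoid|exact: mx_ctsT].
  - by move=> s sab; rewrite trapezoid_out // scale0r.
pose v s := - (Si s *m (B s)^T *m p s).
have cv : mx_cts v.
  by apply: mx_ctsN; apply: mx_ctsM => //; apply: mx_ctsM => //; exact: mx_ctsT.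
have cl s : s \in `[0, T] -> Si s *m (S s *m u s + (B s)^T *m p s) = u s - v s.
  by move=> sT; rewrite mulmxDr mulmxA SiS // mul1mx /v opprK mulmxA.
have sub s r : s \in `[0, T] -> r \in `[0, s] -> r \in `[0, T].
  by rewrite !in_itv /= => /andP[_ sT] /andP[-> rs]; exact: le_trans sT.
(* u may be replaced by the continuous v under the integral, so x is differentiable *)
have dx s : s \in `]0, T[ -> mx_derive x s (A s *m x s + B s *m v s).
  move=> sT i k; rewrite ord1.
  have cr : mx_cts (fun s => A s *m x s + B s *m v s) by apply: mx_ctsD; exact: mx_ctsM.
  apply: (@primitive_derive _ T (fun s => (A s *m x s + B s *m v s) i 0) _ (x 0 i 0)) => //.
  move=> r rT; rewrite xE //; congr (_ + _).
  have crow : mx_cts (fun s => row i (B s *m Si s)).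
    by move=> i' k'; under eq_fun do rewrite mxE; exact: mx_ctsM.
  have inS (f : R -> R) : mul.-integrable (`[0%R, T] : set (lebesgueType R)) (EFin \o f) ->
      mul.-integrable (`[0%R, r] : set (lebesgueType R)) (EFin \o f).
    move=> fi; apply: integrableS fi => //; try exact: measurable_itv_leb.
    by move=> w /=; exact: sub.
  rewrite -[RHS]addr0 -[X in _ + X](strong _ crow r rT) -RintegralD.
  - apply: eq_Rintegral => w; rewrite inE /= => wr.
    rewrite -row_mul [in RHS]mxE -mulmxA cl; last exact: sub wr.
    by rewrite mulmxBr !mxE; ring.
  - exact: measurable_itv_leb.
  - by apply: inS; exact: (int_cts i 0 cr).
  - by apply: inS; exact: Sup_int.
(* by the Riccati equation q solves a homogeneous linear equation backwards from 0 *)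
pose q s := p s - Pi s *m x s.
have q0 s : s \in `[0, T] -> q s = 0.
  apply: (@linear_ode_unique _ _ T (fun s => - (A s)^T + Pi s *m B s *m Si s *m (B s)^T)) => //.
  - apply: mx_ctsD; first by apply: mx_ctsN; exact: mx_ctsT.
    by apply: mx_ctsM; [do 2 apply: mx_ctsM => //|exact: mx_ctsT].
  - by apply: mx_ctsD => //; apply: mx_ctsN; exact: mx_ctsM.
  - move=> r rT i k; have H := mx_deriveD (dp _ rT) (mx_deriveN (mx_deriveM (dPi rT) (dx _ rT))) i
    k.
    apply: (is_derive_eq H); congr fun_of_matrix.
    rewrite /q /v !(mulmxDl, mulmxDr, mulNmx, mulmxN, mulmxA, opprD, opprK).
    move: ((A r)^T *m p r) (Q r *m x r) (Pi r *m A r *m x r) ((A r)^T *m Pi r *m x r)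
      (_ *m Pi r *m x r) (_ *m p r) => c1 c2 c3 c4 c5 c6.
    by apply/matrixP => i' k'; rewrite !mxE; ring.
  - by rewrite /q pT PiT subrr.
move=> tT'.
have crow : mx_cts (fun s => row j (Si s)).
  by move=> i' k'; under eq_fun do rewrite mxE; exact: cSi.
rewrite -[RHS](strong _ crow t tT'); apply: eq_Rintegral => w; rewrite inE /= => wt.
have wT : w \in `[0, T] by exact: sub wt.
rewrite -row_mul [in RHS]mxE cl // /v opprK -mulmxA.
by move: (q0 w wT) => /eqP; rewrite subr_eq0 => /eqP ->; rewrite !mulmxA.
Qed.

End feedback.

(** * Null sets and Fubini's theorem on time and chance *)

Section null_insensitive.
Local Open Scope ereal_scope.
Context d (U : measurableType d) {R : realType}.
Variable (mu : {measure set U -> \bar R}).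
Import HBNNSimple.

(** The integral of a nonnegative function is a supremum over the simple
    functions below it, and setting these to 0 on N does not change their
    integrals. This is why functions that may fail to be measurable can be
    compared off N. *)
Lemma ge0_le_integral_off_null (N : set U) (f g : U -> \bar R) :
  measurable N -> mu N = 0 -> (forall x, 0 <= f x) -> (forall x, 0 <= g x) ->
  (forall x, ~ N x -> f x <= g x) ->
  \int[mu]_x f x <= \int[mu]_x g x.
Proof.
move=> mN N0 f0 g0 fg.
rewrite !ge0_integralTE //; apply/ge_ereal_sup => _ [h /= hf <-].
have mNC : measurable (~` N) by exact: measurableC.
have hE : sintegral mu h = sintegral mu (proj_nnsfun h mNC).
  have E (k : {nnsfun U >-> R}) : sintegral mu k = \int[mu]_x (k x)%:E.
    by rewrite integral_nnsfun // patch_setT.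
  rewrite !E; apply: ae_eq_integral => //.
  - by apply/measurable_EFinP.
  - by apply/measurable_EFinP.
  - exists N; split => // x /= H; apply: contrapT => Nx; apply: H => _.
    by rewrite /proj_nnsfun /= mindicE mem_set //= mulr1.
rewrite hE; apply: ereal_sup_ubound; exists (proj_nnsfun h mNC) => //= x.
rewrite mindicE; case: (boolP (x \in ~` N)) => [|_]; last by rewrite mulr0; exact: g0.
by rewrite inE mulr1 => /fg; apply: le_trans; exact: hf.
Qed.

Lemma integral_off_null (N : set U) (f g : U -> \bar R) :
  measurable N -> mu N = 0 -> (forall x, ~ N x -> f x = g x) ->
  \int[mu]_x f x = \int[mu]_x g x.
Proof.
move=> mN N0 fg; rewrite integralE [RHS]integralE.
by congr (_ - _); apply/eqP; rewrite eq_le; apply/andP; split;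
  apply: (ge0_le_integral_off_null mN N0) => // x Nx;
  rewrite ?funeposE ?funenegE fg.
Qed.

End null_insensitive.

Section fubini_time.
Context {R : realType} {dO : measure_display} {Omega : measurableType dO}.
Variable P : probability Omega R.
Notation mul := (@completed_lebesgue_measure R).
Notation time_space T := (@time_space R dO Omega T).

(** Processes are curried, while the product measure lives on pairs. *)
Definition pintegrable (T : R) (f : R -> Omega -> R) : Prop :=
  (mul \x P)%E.-integrable (time_space T) (fun z => (f z.1 z.2)%:E).

Lemma measurable_time_space (T : R) : measurable (time_space T).
Proof. by apply: measurableX => //; exact: measurable_itv_leb. Qed.

Lemma pintegrableS (s T : R) f : s <= T -> pintegrable T f -> pintegrable s f.
Proof.
move=> sT; apply: integrableS; [exact: measurable_time_space|exact: measurable_time_space|].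
move=> [t w] /= [/= + _]; rewrite in_itv /= => /andP[t0 ts]; split => //=.
by rewrite in_itv /= t0 (le_trans ts).
Qed.

Let pf (T : R) (f : R -> Omega -> R) : lebesgueType R * Omega -> \bar R :=
  (fun z => (f z.1 z.2)%:E) \_ (time_space T).

Let pf_int T f : pintegrable T f -> (mul \x P)%E.-integrable setT (pf T f).
Proof. by move/(integrable_mkcond _ (measurable_time_space T)). Qed.

Let pfE T f (t : lebesgueType R) w : pf T f (t, w) = if t \in `[0, T] then (f t w)%:E else 0%E.
Proof.
rewrite /pf patchE; congr (if _ then _ else _).
by apply/idP/idP; rewrite inE => H; [case: H|split].
Qed.

Lemma pintegrable_ae_w T f : pintegrable T f ->
  {ae P, forall w, mul.-integrable (`[0%R, T] : set (lebesgueType R)) (EFin \o (fun t => f t w))}.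
Proof.
move=> /pf_int H; have := ae_integrable2 H; apply: filterS => w.
move=> H1; apply/(integrable_mkcond _ (measurable_itv_leb _)).
move: H1; apply: eq_integrable => // t _; rewrite pfE patchE.
by rewrite mem_setE.
Qed.

Lemma pintegrable_ae_t T f : pintegrable T f ->
  {ae mul, forall t : lebesgueType R, t \in `[0, T] -> P.-integrable setT (EFin \o f t)}.
Proof.
move=> /pf_int H; have := ae_integrable1 H; apply: filterS => t + tT.
by apply: eq_integrable => // w _; rewrite pfE tT.
Qed.

(** The inner integral is made real by sending infinite values to 0, on a null
    set of times; measurability is inherited from fubini_F. *)
Lemma pintegrable_mean T f : pintegrable T f ->
  mul.-integrable (`[0%R, T] : set (lebesgueType R)) (EFin \o (fun t => \int[P]_w f t w)).
Proof.
move=> /pf_int H; have := integrable_fubini_F H => H1.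
apply/(integrable_mkcond _ (measurable_itv_leb _)).
have ae := integrable_ae measurableT H1.
have mG : measurable_fun setT ((EFin \o (fun t => \int[P]_w f t w)) \_ (`[0,
  T]%classic : set (lebesgueType R))).
  have -> : (EFin \o (fun t => \int[P]_w f t w)) \_ (`[0, T]%classic : set (lebesgueType R)) =
      (fun t => (fine (fubini_F P (pf T f) t))%:E).
    apply/funext => t; rewrite patchE mem_setE /fubini_F /=.
    under eq_integral do rewrite pfE.
    by case: ifP => // _; rewrite integral0.
  apply/measurable_EFinP.
  exact: (measurableT_comp (fine_measurable measurableT) (measurable_int _ H1)).
apply: (le_integrable measurableT mG _ H1) => t _.
rewrite patchE mem_setE /fubini_F /=.
under [in leRHS]eq_integral do rewrite pfE.
case: ifP => _; last by rewrite integral0.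
by rewrite /Rintegral; case: (\int[P]_x (f t x)%:E)%E => [r| |] //=; rewrite normr0 leey.
Qed.

Let integrable_G (g : lebesgueType R * Omega -> \bar R) :
  (mul \x P)%E.-integrable setT g -> P.-integrable setT (fubini_G mul g).
Proof.
move=> gi; have mg := measurable_int _ gi.
have mag : measurable_fun setT (abse \o g) by exact: measurableT_comp.
have mG := measurable_fubini_G gi.
apply/integrableP; split => //.
have := (integrable21ltyP _ _ mg).1 gi; apply: le_lt_trans.
apply: (@ge0_le_integral _ _ _ P setT measurableT).
- by move=> w _; exact: abse_ge0.
- exact: measurableT_comp.
- by apply: (measurable_fun_fubini_tonelli_G (abse \o g)) => // z; exact: abse_ge0.
- move=> w _; rewrite /fubini_G.
  exact: (@le_abse_integral _ (lebesgueType R) R mul setT (fun t => g (t, w)) measurableT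
    (measurableT_comp mg (pair2_measurable w))).
Qed.

Lemma pintegrable_path T f : pintegrable T f ->
  P.-integrable setT (EFin \o (fun w => \int[mul]_(t in (`[0%R, T] : set (lebesgueType R))) f t w)).
Proof.
move=> /pf_int H; have := integrable_G H => H1.
have GE w : \int[mul]_(t in (`[0%R, T] : set (lebesgueType R))) f t w =
    fine (fubini_G mul (pf T f) w).
  rewrite /fubini_G /Rintegral integral_mkcond; congr fine; apply: eq_integral => t _.
  by rewrite pfE patchE mem_setE.
have mG : measurable_fun setT
    (EFin \o (fun w => \int[mul]_(t in (`[0%R, T] : set (lebesgueType R))) f t w)).
  apply/measurable_EFinP; under eq_fun do rewrite GE.
  by apply: measurableT_comp => //; exact: measurable_int H1.
apply: (le_integrable measurableT mG _ H1) => w _.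
by rewrite /= GE; case: (fubini_G _ _ w) => [r| |] //=; rewrite normr0 leey.
Qed.

Lemma pintegrable_prod T f : pintegrable T f ->
  \int[P]_w (\int[mul]_(t in (`[0%R, T] : set (lebesgueType R))) f t w) =
  \int[(mul \x P)%E]_(z in time_space T) f z.1 z.2.
Proof.
move=> tf; have pi := pintegrable_path tf.
have /pf_int H := tf.
transitivity (fine (\int[P]_w fubini_G mul (pf T f) w)).
  congr fine; apply: ae_eq_integral => //.
  - exact: measurable_int pi.
  - exact: measurable_int (integrable_G H).
  - have := integrable_ae measurableT (integrable_G H).
    apply: filterS => w /(_ I) fw _.
    rewrite -[RHS]fineK //; congr (fine _)%:E.
    rewrite /fubini_G integral_mkcond; apply: eq_integral => t _.
    by rewrite pfE patchE mem_setE.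
by rewrite (integral21_prod_meas1 H) [RHS]/Rintegral integral_mkcond.
Qed.

Lemma pintegrable_swap T f : pintegrable T f ->
  \int[P]_w (\int[mul]_(t in (`[0%R, T] : set (lebesgueType R))) f t w) =
  \int[mul]_(t in (`[0%R, T] : set (lebesgueType R))) (\int[P]_w f t w).
Proof.
move=> tf; have mi := pintegrable_mean tf.
have /pf_int H := tf.
transitivity (fine (\int[mul]_t fubini_F P (pf T f) t)).
  rewrite (pintegrable_prod tf) /Rintegral [in LHS]integral_mkcond -/(pf T f).
  by rewrite -(integral12_prod_meas1 H).
rewrite [RHS]/Rintegral [in RHS]integral_mkcond; congr fine.
apply: ae_eq_integral; first exact: measurableT.
- exact: measurable_int (integrable_fubini_F H).
- apply: (measurable_int mul); exact/(integrable_mkcond _ (measurable_itv_leb _)).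
- have := integrable_ae measurableT (integrable_fubini_F H).
  apply: filterS => t /(_ I) ft _; rewrite patchE mem_setE.
  rewrite -[LHS]fineK // /fubini_F.
  under eq_integral do rewrite pfE.
  by case: ifP => _ //; rewrite integral0.
Qed.

End fubini_time.

(** * Integrable processes and their means over events *)

Section pintegrable_algebra.
Context {R : realType} {dO : measure_display} {Omega : measurableType dO}.
Variable P : probability Omega R.
Notation mul := (@completed_lebesgue_measure R).
Notation time_space T := (@time_space R dO Omega T).
Notation int0 f t := (\int[mul]_(s in (`[0%R, t] : set (lebesgueType R))) f s).
Notation pintegrable := (pintegrable P).

Definition pmeasurable (T : R) (f : R -> Omega -> R) :=
  measurable_fun (time_space T) (fun z : lebesgueType R * Omega => f z.1 z.2).

Lemma pintegrableD T f g : pintegrable T f -> pintegrable T g ->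
  pintegrable T (fun t w => f t w + g t w).
Proof. by move=> fi gi; exact: (integrableD_real (measurable_time_space T) fi gi). Qed.

Lemma pintegrableZ T c f : pintegrable T f -> pintegrable T (fun t w => c * f t w).
Proof. by move=> fi; exact: (integrableZ_real (measurable_time_space T) c fi). Qed.

Lemma pintegrable_sum T n (f : 'I_n -> R -> Omega -> R) : (forall i, pintegrable T (f i)) ->
  pintegrable T (fun t w => \sum_i f i t w).
Proof.
move=> fi; exact: (@integrable_sum_real _ _ R (mul \x P)%E _ (measurable_time_space T) n (fun i z
  => f i z.1 z.2) fi).
Qed.

Lemma pintegrableM T C h f : pmeasurable T h -> (forall t w, t \in `[0, T] -> `|h t w| <= C) ->
  pintegrable T f -> pintegrable T (fun t w => h t w * f t w).
Proof.
move=> mh hC fi; apply: (@integrable_boundedM _ _ R (mul \x P)%E _ (measurable_time_space T) C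
  (fun z => h z.1 z.2) (fun z => f z.1 z.2) mh _ fi).
by move=> [t w] [/= tT _]; exact: hC.
Qed.

Lemma le_pintegrable T f g : pmeasurable T f -> (forall t w, t \in `[0, T] -> `|f t w| <= g t w) ->
  pintegrable T g -> pintegrable T f.
Proof.
move=> mf fg gi; apply: (@le_integrable_real _ _ R (mul \x P)%E _ (measurable_time_space T) (fun z
  => f z.1 z.2) (fun z => g z.1 z.2) mf _ gi).
by move=> [t w] [/= tT _]; exact: fg.
Qed.

Lemma eq_pintegrable T f g : (forall t w, t \in `[0, T] -> f t w = g t w) -> pintegrable T f ->
  pintegrable T g.
Proof.
move=> fg; apply: eq_integrable; first exact: measurable_time_space.
by move=> [t w]; rewrite inE => -[/= tT _]; rewrite fg.
Qed.

Lemma pmeasurable_time T (a : R -> R) : continuous a -> pmeasurable T (fun t _ => a t).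
Proof.
move=> ca; apply: (@measurable_comp _ _ _ _ _ _ setT (a : lebesgueType R -> R)) => //.
  apply: measurable_fun_leb; first exact: measurableT.
  exact: continuous_measurable_fun.
exact: measurable_funTS.
Qed.

Lemma pmeasurable_chance T (g : Omega -> R) : measurable_fun setT g ->
  pmeasurable T (fun _ w => g w).
Proof.
move=> mg; apply: (@measurable_comp _ _ _ _ _ _ setT g) => //.
exact: measurable_funTS.
Qed.

Lemma measurable_indic_real (F : set Omega) : measurable F -> measurable_fun setT
    (\1_F : Omega -> R).
Proof. by move=> mF; exact: measurable_indic. Qed.

Lemma indic_le1 (F : set Omega) w : `|\1_F w : R| <= 1.
Proof. by rewrite indicE; case: (w \in F); rewrite ?normr1 ?normr0. Qed.

Lemma pintegrable_indic T F f : measurable F -> pintegrable T f ->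
  pintegrable T (fun t w => \1_F w * f t w).
Proof.
move=> mF; apply: (@pintegrableM T 1 (fun _ w => \1_F w)); last by move=> *; exact: indic_le1.
by apply: pmeasurable_chance; exact: measurable_indic_real.
Qed.

Lemma pintegrable_time (T : R) (a : R -> R) f : 0 <= T -> continuous a -> pintegrable T f ->
  pintegrable T (fun t w => a t * f t w).
Proof.
move=> T0 ca fi; have [C C0 hC] := @mx_cts_bounded R 1 1 T (fun t => (a t)%:M) T0
  (fun i j => ltac:(by rewrite !ord1; under eq_fun do rewrite mxE; exact: ca)).
apply: (@pintegrableM T C (fun t _ => a t)) => //; first exact: pmeasurable_time.
by move=> t w tT; have := hC t tT 0 0; rewrite !mxE eqxx mulr1n.
Qed.

Lemma pintegrable_row (T : R) n (a : R -> 'rV[R]_n) (f : R -> Omega -> 'cV[R]_n) : 0 <= T ->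
  mx_cts a ->
  (forall i, pintegrable T (fun t w => f t w i 0)) -> pintegrable T (fun t w => (a t *m f t w) 0 0).
Proof.
move=> T0 ca fi; apply: (@eq_pintegrable T (fun t w => \sum_i a t 0 i * f t w i 0)).
  by move=> t w _; rewrite mxE.
by apply: pintegrable_sum => i; apply: pintegrable_time => //; exact: ca.
Qed.

Lemma leb_itv0 (T : R) : 0 <= T -> mul (`[0%R, T] : set (lebesgueType R)) = T%:E.
Proof.
move=> T0; have : lebesgue_measure (`[0%R, T] : set R) = T%:E.
  rewrite lebesgue_measure_itv /= lte_fin.
  by case: ltgtP T0 => // [_ _|<- _]; rewrite ?sube0.
exact.
Qed.

Lemma measure_rect (E : set R) (F : set Omega) :
  measurable (E : set (lebesgueType R)) -> measurable F ->
  (mul \x P)%E ((E : set (lebesgueType R)) `*` F) = (mul E * P F)%E.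
Proof. exact: product_measure1E. Qed.

Lemma measure_time_space (T : R) : 0 <= T -> (mul \x P)%E (time_space T) = T%:E.
Proof.
move=> T0; rewrite measure_rect //; last exact: measurable_itv_leb.
by rewrite leb_itv0 // [X in (_ * X)%E]probability_setT mule1.
Qed.

Lemma pintegrable_cst T (c : R) : 0 <= T -> pintegrable T (fun _ _ => c).
Proof.
move=> T0; apply: (@measurable_bounded_integrable _ _ R (mul \x P)%E (fun=> c)).
- exact: measurable_time_space.
- by rewrite [X in (X < _)%E]measure_time_space // ltry.
- exact: measurable_cst.
- exact: bounded_cst.
Qed.

(** E[1_F f(t)]: testing a process against all events F turns a statement
    about random vectors into statements about deterministic functions of
    time. *)
Definition mean_on (F : set Omega) n (f : R -> Omega -> 'cV[R]_n) (t : R) : 'cV[R]_n :=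
  \col_i \int[P]_w (\1_F w * f t w i 0).

Lemma mean_on_integrable T F n (f : R -> Omega -> 'cV[R]_n) i : measurable F ->
  (forall i, pintegrable T (fun t w => f t w i 0)) ->
  mul.-integrable (`[0%R, T] : set (lebesgueType R)) (EFin \o (fun t => mean_on F f t i 0)).
Proof.
move=> mF fi; have := pintegrable_mean (pintegrable_indic mF (fi i)).
by apply: eq_integrable; [exact: measurable_itv_leb|move=> t _; rewrite /= mxE].
Qed.

Lemma integrable_indicM F (f : Omega -> R) : measurable F ->
  P.-integrable setT (EFin \o f) -> P.-integrable setT (EFin \o (fun w => \1_F w * f w)).
Proof.
move=> mF; apply: (@integrable_boundedM _ _ R P setT measurableT 1).
  exact: measurable_indic_real.
by move=> w _; exact: indic_le1.
Qed.

Lemma Rintegral_row F n (a : 'rV[R]_n) (f : Omega -> 'cV[R]_n) : measurable F ->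
  (forall i, P.-integrable setT (EFin \o (fun w => f w i 0))) ->
  \int[P]_w (\1_F w * (a *m f w) 0 0) = (a *m \col_i \int[P]_w (\1_F w * f w i 0)) 0 0.
Proof.
move=> mF fi.
have gi i : P.-integrable setT (EFin \o (fun w => \1_F w * f w i 0)) by exact: integrable_indicM.
rewrite mxE; under [RHS]eq_bigr => i _ do rewrite mxE -RintegralZl //.
rewrite -Rintegral_sum //; last by move=> i; exact: integrableZ_real.
by apply: eq_Rintegral => w _; rewrite mxE mulr_sumr; apply: eq_bigr => i _; rewrite mulrCA.
Qed.

Lemma integrable_row n (a : 'rV[R]_n) (f : Omega -> 'cV[R]_n) :
  (forall i, P.-integrable setT (EFin \o (fun w => f w i 0))) ->
  P.-integrable setT (EFin \o (fun w => (a *m f w) 0 0)).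
Proof.
move=> fi; rewrite (_ : (fun w => _) = (fun w => \sum_i a 0 i * f w i 0)); last first.
  by apply/funext => w; rewrite mxE.
by apply: integrable_sum_real => // i; exact: integrableZ_real.
Qed.

Lemma pintegrable_swap_rows (T : R) F n m (a : R -> 'rV[R]_n) (b : R -> 'rV[R]_m)
    (f : R -> Omega -> 'cV[R]_n) (g : R -> Omega -> 'cV[R]_m) : 0 <= T -> measurable F ->
  mx_cts a -> mx_cts b ->
  (forall i, pintegrable T (fun t w => f t w i 0)) ->
    (forall i, pintegrable T (fun t w => g t w i 0)) ->
  \int[P]_w (int0 (fun t => \1_F w * ((a t *m f t w) 0 0 + (b t *m g t w) 0 0)) T) =
  int0 (fun t => (a t *m mean_on F f t) 0 0 + (b t *m mean_on F g t) 0 0) T.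
Proof.
move=> T0 mF ca cb fi gi.
have fgi := pintegrableD (pintegrable_row T0 ca fi) (pintegrable_row T0 cb gi).
rewrite (pintegrable_swap (pintegrable_indic mF fgi)).
have iR : mul.-integrable (`[0%R, T] : set (lebesgueType R))
   (EFin \o (fun t => (a t *m mean_on F f t) 0 0 + (b t *m mean_on F g t) 0 0)).
  apply: (@integrableD_real _ (lebesgueType R)); first exact: measurable_itv_leb.
    by apply: integrable_mx_cts_rowM => // i; exact: mean_on_integrable.
  by apply: integrable_mx_cts_rowM => // i; exact: mean_on_integrable.
congr fine; apply: ae_eq_integral.
- exact: measurable_itv_leb.
- exact: (measurable_int mul (pintegrable_mean (pintegrable_indic mF fgi))).
- exact: (measurable_int mul iR).
have ae_all k (h : R -> Omega -> 'cV[R]_k) : (forall i, pintegrable T (fun t w => h t w i 0)) ->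
    {ae mul, forall t : lebesgueType R, forall i, t \in `[0, T] ->
      P.-integrable setT (EFin \o (fun w => h t w i 0))}.
  by move=> hi; apply: filter_forall => i; exact: pintegrable_ae_t.
have aef := ae_all _ _ fi; have aeg := ae_all _ _ gi.
apply: filterS2 aef aeg => t ft gt tT; congr (_%:E).
rewrite -!Rintegral_row //; [|by move=> i; exact: gt|by move=> i; exact: ft].
rewrite -RintegralD //; first by apply: eq_Rintegral => w _; rewrite mulrDr.
  by apply: integrable_indicM => //; apply: integrable_row => i; exact: ft.
by apply: integrable_indicM => //; apply: integrable_row => i; exact: gt.
Qed.

(** The case of pintegrable_swap_rows in which the second family has dimension
    0. *)
Lemma pintegrable_swap_row (T : R) F n (a : R -> 'rV[R]_n)
    (f : R -> Omega -> 'cV[R]_n) : 0 <= T -> measurable F ->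
  mx_cts a -> (forall i, pintegrable T (fun t w => f t w i 0)) ->
  \int[P]_w (int0 (fun t => \1_F w * (a t *m f t w) 0 0) T) =
  int0 (fun t => (a t *m mean_on F f t) 0 0) T.
Proof.
move=> T0 mF ca fi.
have c0 : @mx_cts R 1 0 (fun=> 0) by exact: mx_cts_cst.
have := @pintegrable_swap_rows T F n 0 a (fun=> 0) f (fun _ _ => 0) T0 mF ca c0 fi.
have Z : ((0 : 'rV[R]_0) *m (0 : 'cV[R]_0)) 0 0 = 0 by rewrite mul0mx mxE.
move=> /(_ (fun i => ltac:(by case: i))) H.
transitivity (\int[P]_w (int0 (fun t =>
  \1_F w * ((a t *m f t w) 0 0 + ((0 : 'rV[R]_0) *m (0 : 'cV[R]_0)) 0 0)) T)).
  by apply: eq_Rintegral => w _; apply: eq_Rintegral => t _; rewrite Z addr0.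
by rewrite H; apply: eq_Rintegral => t _; rewrite mul0mx [X in _ + X]mxE addr0.
Qed.

End pintegrable_algebra.

(** * Square-integrable processes and the dynamics of means *)

Section processes.
Context {R : realType} {dO : measure_display} {Omega : measurableType dO}.
Variable P : probability Omega R.
Notation mul := (@completed_lebesgue_measure R).
Notation int0 f t := (\int[mul]_(s in (`[0%R, t] : set (lebesgueType R))) f s).
Notation pintegrable := (pintegrable P).

(** Absolute continuity of the integral. *)
Lemma integral_primitive_continuous (T : R) (f : R -> R) : 0 < T ->
  mul.-integrable (`[0%R, T] : set (lebesgueType R)) (EFin \o f) ->
  continuous (fun t => int0 f (clamp T t)).
Proof.
move=> T0 fi.
pose fT : lebesgueType R -> R := f \_ `[0, T].
have fTi : mul.-integrable setT (EFin \o fT).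
  rewrite /fT -restrict_EFin; exact/(integrable_mkcond _ (measurable_itv_leb _)).
have unif (e : R) : 0 < e -> exists2 d : R, 0 < d & forall s t, s \in `[0, T] -> t \in `[0, T] ->
    s <= t -> t - s < d -> `|int0 f t - int0 f s| < e.
  move=> e0; have [d [d0 H]] := integral_normr_continuous fTi e0.
  exists d => // s t sT tT st tsd.
  move: sT tT; rewrite !in_itv /= => /andP[s0 _] /andP[_ tT].
  rewrite -(Rintegral_leb_oo s0 st tT fi).
  have mI : measurable (`]s, t[%classic : set (lebesgueType R)) by exact: measurable_itv_leb.
  have IT : `]s, t[ `<=` `[0, T].
    by move=> x /=; rewrite !in_itv /= => /andP[? ?]; apply/andP; split; lra.
  have fI : mul.-integrable (`]s, t[ : set (lebesgueType R)) (EFin \o f).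
    by apply: integrableS fi => //; exact: measurable_itv_leb.
  apply: (le_lt_trans (le_normr_Rintegral mI fI)).
  have -> : \int[mul]_(x in (`]s, t[ : set (lebesgueType R))) `|f x| =
     \int[mul]_(x in (`]s, t[ : set (lebesgueType R))) `|fT x|.
    by apply: eq_Rintegral => x; rewrite inE => xI; rewrite /fT patchE mem_set //; exact: IT.
  apply: H => //.
  have : lebesgue_measure (`]s, t[%classic : set R) = (t - s)%:E.
    rewrite lebesgue_measure_itv /= lte_fin.
    by have [->|ne] := eqVneq s t; rewrite ?ltxx ?subrr // lt_neqAle ne st EFinB.
  by move=> E; rewrite [X in (X < _)%E]E lte_fin.
move=> x; apply/cvgrPdist_lt => e e0.
have [d d0 H] := unif e e0.
have /cvgrPdist_lt /(_ _ d0) := @continuous_clamp R T x.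
apply: filterS => y; rewrite /= => hd.
have [xy|/ltW yx] := leP (clamp T x) (clamp T y).
- rewrite distrC; apply: H => //; try exact: clamp_in.
  by rewrite distrC ger0_norm ?subr_ge0 // in hd.
- apply: H => //; try exact: clamp_in.
  by rewrite ger0_norm ?subr_ge0 // in hd.
Qed.

(** The bound on second moments is uniform in time, which makes the process
    square integrable at each time and, by Tonelli's theorem, on [0, T] x
    Omega. *)
Record L2_process (T : R) n (X : R -> Omega -> 'cV[R]_n) : Prop := {
  L2_process_pmeasurable : forall i, pmeasurable T (fun t w => X t w i 0);
  L2_process_meas : forall t i, t \in `[0, T] -> measurable_fun setT (fun w => X t w i 0);
  L2_process_bound : exists C : R, forall t i, t \in `[0, T] ->
    (\int[P]_w ((X t w i 0) ^+ 2)%:E <= C%:E)%E }.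

Lemma normM_le (a b : R) : `|a * b| <= a ^+ 2 + b ^+ 2.
Proof.
rewrite ler_norml; have := sqr_ge0 (a - b); have := sqr_ge0 (a + b).
have := sqr_ge0 a; have := sqr_ge0 b.
by move=> h1 h2 h3 h4; apply/andP; split; nra.
Qed.

Lemma norm_le_sqr (a : R) : `|a| <= 1 + a ^+ 2.
Proof. by have := normM_le a 1; rewrite mulr1 expr1n addrC. Qed.

Lemma L2_process_sqr T n X i t : @L2_process T n X -> t \in `[0, T] ->
  P.-integrable setT (EFin \o (fun w => X t w i 0 ^+ 2)).
Proof.
move=> [_ mX [C hC]] tT; apply/integrableP; split.
  by apply/measurable_EFinP; apply: measurable_funX; exact: mX.
apply: le_lt_trans (ltry C); apply: le_trans (hC t i tT).
rewrite le_eqVlt; apply/orP; left; apply/eqP; apply: eq_integral => w _.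
by rewrite /= ger0_norm // sqr_ge0.
Qed.

Lemma L2_process_mul T n X i j t : @L2_process T n X -> t \in `[0, T] ->
  P.-integrable setT (EFin \o (fun w => X t w i 0 * X t w j 0)).
Proof.
move=> LX tT; apply: (@le_integrable_real _ _ _ P setT measurableT _ (fun w =>
  X t w i 0 ^+ 2 + X t w j 0 ^+ 2)).
- by apply: measurable_funM; exact: L2_process_meas LX _ _ tT.
- by move=> w _; exact: normM_le.
- by apply: (integrableD_real measurableT);
  [exact: (L2_process_sqr i LX tT)|exact: (L2_process_sqr j LX tT)].
Qed.

Lemma L2_process_int T n X i t : @L2_process T n X -> t \in `[0, T] ->
  P.-integrable setT (EFin \o (fun w => X t w i 0)).
Proof.
move=> LX tT; apply: (@le_integrable_real _ _ _ P setT measurableT _ (fun w => 1 + X t w i 0 ^+ 2)).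
- exact: L2_process_meas LX _ _ tT.
- by move=> w _; exact: norm_le_sqr.
- apply: (integrableD_real measurableT).
    exact: finite_measure_integrable_cst.
  exact: (L2_process_sqr i LX tT).
Qed.

Lemma L2_process_pintegrable_sqr T n X i : 0 <= T -> @L2_process T n X ->
  pintegrable T (fun t w => X t w i 0 ^+ 2).
Proof.
move=> T0 [mX _ [C hC]].
have mX2 : pmeasurable T (fun t w => X t w i 0 ^+ 2) by apply: measurable_funX; exact: mX.
apply/(integrable_mkcond _ (measurable_time_space T)).
set h := _ \_ _.
have mh : measurable_fun setT h.
  by apply/(measurable_restrictT _ (measurable_time_space T)); apply/measurable_EFinP.
apply/(integrable12ltyP _ _ mh).
apply: (@le_lt_trans _ _ (\int[mul]_(x in (`[0%R, T] : set (lebesgueType R))) C%:E)%E); last first.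
  rewrite integral_cst; last exact: measurable_itv_leb.
  by rewrite /= [X in (_ * X)%E]leb_itv0 // ltry.
have hE t w : h (t, w) = if t \in `[0, T] then (X t w i 0 ^+ 2)%:E else 0%E.
  rewrite /h patchE; congr (if _ then _ else _).
  by apply/idP/idP; rewrite inE => H; [case: H|split].
rewrite [leRHS]integral_mkcond.
apply: (@ge0_le_integral _ (lebesgueType R) R mul setT measurableT).
- by move=> t _; apply: integral_ge0.
- have mah : measurable_fun setT (abse \o h) by exact: measurableT_comp.
  by apply: (measurable_fun_fubini_tonelli_F (abse \o h)) => // z; exact: abse_ge0.
- by apply/(measurable_restrictT _ (measurable_itv_leb _)); exact: measurable_cst.
- move=> t _; rewrite patchE mem_setE.
  under eq_integral do rewrite hE.
  case: ifPn => tT; last by rewrite abse0 integral0.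
  apply: le_trans (hC t i tT); rewrite le_eqVlt; apply/orP; left; apply/eqP.
  by apply: eq_integral => w _; rewrite /= ger0_norm // sqr_ge0.
Qed.

Lemma pintegrable_sqr_mul T f g : pmeasurable T f -> pmeasurable T g ->
  pintegrable T (fun t w => f t w ^+ 2) -> pintegrable T (fun t w => g t w ^+ 2) ->
  pintegrable T (fun t w => f t w * g t w).
Proof.
move=> mf mg fi gi; apply: le_pintegrable (pintegrableD fi gi); first exact: measurable_funM.
by move=> t w _; exact: normM_le.
Qed.

Lemma pintegrable_sqr_int T f : 0 <= T -> pmeasurable T f ->
  pintegrable T (fun t w => f t w ^+ 2) -> pintegrable T f.
Proof.
move=> T0 mf fi; apply: (le_pintegrable mf _ (pintegrableD (pintegrable_cst P 1 T0) fi)).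
by move=> t w _; exact: norm_le_sqr.
Qed.

Lemma pintegrable_quad T n (Q : R -> 'M[R]_n) (X : R -> Omega -> 'cV[R]_n) : 0 <= T -> mx_cts Q ->
  (forall i j, pintegrable T (fun t w => X t w i 0 * X t w j 0)) ->
  pintegrable T (fun t w => quad (Q t) (X t w)).
Proof.
move=> T0 cQ Xi; apply: (@eq_pintegrable _ _ _ P T (fun t w =>
  \sum_j \sum_i Q t i j * (X t w i 0 * X t w j 0))).
  move=> t w _; rewrite /quad mxE; apply: eq_bigr => j _; rewrite mxE mulr_suml.
  by apply: eq_bigr => i _; rewrite mxE; ring.
by apply: pintegrable_sum => j; apply: pintegrable_sum => i; apply: pintegrable_time => //;
  exact: cQ.
Qed.

Lemma integrable_quad n (Q : 'M[R]_n) (X : Omega -> 'cV[R]_n) :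
  (forall i j, P.-integrable setT (EFin \o (fun w => X w i 0 * X w j 0))) ->
  P.-integrable setT (EFin \o (fun w => quad Q (X w))).
Proof.
move=> Xi; rewrite (_ : (fun w => _) = (fun w => \sum_j \sum_i Q i j * (X w i 0 * X w j 0)));
  last first.
  apply/funext => w; rewrite /quad mxE; apply: eq_bigr => j _; rewrite mxE mulr_suml.
  by apply: eq_bigr => i _; rewrite mxE; ring.
by apply: integrable_sum_real => // j; apply: integrable_sum_real => // i; exact: integrableZ_real.
Qed.

Section mean_dynamics.
Variables (n m : nat) (T : R) (A : R -> 'M[R]_n) (B : R -> 'M[R]_(n, m)).
Variables (X : R -> Omega -> 'cV[R]_n) (u : R -> Omega -> 'cV[R]_m) (F : set Omega).
Hypotheses (T0 : 0 < T) (cA : mx_cts A) (cB : mx_cts B) (mF : measurable F).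
Hypotheses (Xi : forall i, pintegrable T (fun t w => X t w i 0))
    (ui : forall j, pintegrable T (fun t w => u t w j 0)).
Hypothesis X0i : forall i, P.-integrable setT (EFin \o (fun w => X 0 w i 0)).
Hypothesis Xs : forall w t, t \in `[0, T] -> forall i, X t w i 0 = X 0 w i 0 +
  int0 (fun s => (A s *m X s w + B s *m u s w) i 0) t.

Lemma mx_cts_row k l (M : R -> 'M[R]_(k, l)) i : mx_cts M -> mx_cts (fun t => row i (M t)).
Proof. by move=> cM i' j; under eq_fun do rewrite mxE; exact: cM. Qed.

(** The event F does not depend on time, so multiplying the state equation by
    1_F and taking expectations commutes with the time integral. *)
Lemma mean_on_dynamics t i : t \in `[0, T] ->
  mean_on P F X t i 0 = mean_on P F X 0 i 0 +
    int0 (fun s => (A s *m mean_on P F X s + B s *m mean_on P F u s) i 0) t.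
Proof.
move=> tT; have := tT; rewrite in_itv /= => /andP[t0 t1].
have rowE (Y : 'cV[R]_n) (v : 'cV[R]_m) s : (A s *m Y + B s *m v) i 0 =
    (row i (A s) *m Y) 0 0 + (row i (B s) *m v) 0 0.
  by rewrite -!row_mul !mxE.
have Xi' k : pintegrable t (fun t w => X t w k 0) by exact: pintegrableS (Xi k).
have ui' k : pintegrable t (fun t w => u t w k 0) by exact: pintegrableS (ui k).
transitivity (\int[P]_w (\1_F w * X 0 w i 0 + int0 (fun s =>
  \1_F w * ((row i (A s) *m X s w) 0 0 + (row i (B s) *m u s w) 0 0)) t)).
  rewrite mxE; apply: eq_Rintegral => w _; rewrite Xs // mulrDr; congr (_ + _).
  rewrite indicE; case: (w \in F).
    by rewrite mul1r; apply: eq_Rintegral => s _; rewrite mul1r rowE.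
  rewrite mul0r; under eq_Rintegral do rewrite mul0r.
  by rewrite Rintegral_cst ?mul0r //; exact: measurable_itv_leb.
rewrite RintegralD //.
- rewrite [in RHS]mxE; congr (_ + _).
  rewrite (pintegrable_swap_rows t0 mF (mx_cts_row (i := i) cA) (mx_cts_row (i := i) cB) Xi' ui').
  by apply: eq_Rintegral => s _; rewrite rowE.
- exact: integrable_indicM.
- apply: pintegrable_path; apply: pintegrable_indic => //; apply: pintegrableD;
  apply: pintegrable_row => //; exact: mx_cts_row.
Qed.

Lemma mean_on_mx_cts : (forall t w, X t w = X (clamp T t) w) -> mx_cts (mean_on P F X).
Proof.
move=> Xc i j; rewrite ord1.
have -> : (fun t => mean_on P F X t i 0) = (fun t => mean_on P F X 0 i 0 +
    int0 (fun s => (A s *m mean_on P F X s + B s *m mean_on P F u s) i 0) (clamp T t)).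
  apply/funext => t; rewrite -mean_on_dynamics ?clamp_in // !mxE.
  by apply: eq_Rintegral => w _; rewrite Xc.
move=> x; apply: cvgD; first exact: cvg_cst.
apply: (@integral_primitive_continuous T (fun s =>
  (A s *m mean_on P F X s + B s *m mean_on P F u s) i 0)) => //.
have -> : (fun s => (A s *m mean_on P F X s + B s *m mean_on P F u s) i 0) =
  (fun s => (row i (A s) *m mean_on P F X s) 0 0 + (row i (B s) *m mean_on P F u s) 0 0).
  by apply/funext => s; rewrite -!row_mul !mxE.
apply: (@integrableD_real _ (lebesgueType R)); first exact: measurable_itv_leb.
  by apply: integrable_mx_cts_rowM; [exact: ltW|exact: mx_cts_row|move=> k;
    exact: mean_on_integrable].
by apply: integrable_mx_cts_rowM; [exact: ltW|exact: mx_cts_row|move=> k;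
  exact: mean_on_integrable].
Qed.

End mean_dynamics.
End processes.

(** * Expansion of the cost along a perturbation *)

Section cost_expansion.
Context {R : realType} {dO : measure_display} {Omega : measurableType dO}.
Variable P : probability Omega R.
Notation mul := (@completed_lebesgue_measure R).
Notation int0 f t := (\int[mul]_(s in (`[0%R, t] : set (lebesgueType R))) f s).
Notation pintegrable := (pintegrable P).

Lemma fine_expectation (f : Omega -> R) : fine ('E_P[f])%E = \int[P]_w f w.
Proof. by rewrite unlock. Qed.

Lemma quad_affine n (Q : 'M[R]_n) (x y : 'cV[R]_n) (c : R) : Q^T = Q ->
  quad Q (x + c *: y) = quad Q x + 2 * c * (y^T *m Q *m x) 0 0 + c ^+ 2 * quad Q y.
Proof.
move=> symQ; rewrite /quad [(x + c *: y)^T]linearD /= [(c *: y)^T]linearZ /= !mulmxDl !mulmxDr.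
have E : x^T *m Q *m y = y^T *m Q *m x.
  transitivity ((x^T *m Q *m y)^T); first by apply/matrixP => i j; rewrite !ord1 [RHS]mxE.
  by rewrite !trmx_mul trmxK symQ mulmxA.
by rewrite -!scalemxAl -!scalemxAr E !mxE; ring.
Qed.

Lemma continuous_quad k (Q : R -> 'M[R]_k) (v : R -> 'cV[R]_k) : mx_cts Q -> mx_cts v ->
  continuous (fun t => quad (Q t) (v t)).
Proof. by move=> cQ cv; have H := mx_ctsM (mx_ctsM (mx_ctsT cv) cQ) cv; exact: (H 0 0). Qed.

Definition pintegral (T : R) (f : R -> Omega -> R) : R := \int[P]_w (int0 (fun t => f t w) T).

Lemma pintegral_affine T f g h (c e : R) : pintegrable T f -> pintegrable T g -> pintegrable T h ->
  pintegral T (fun t w => f t w + c * g t w + e * h t w) =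
    pintegral T f + c * pintegral T g + e * pintegral T h.
Proof.
move=> fi gi hi; have mts := measurable_time_space (Omega := Omega) T.
by rewrite /pintegral (pintegrable_prod (pintegrableD (pintegrableD fi (pintegrableZ c gi))
  (pintegrableZ e hi))) Rintegral_affine // !pintegrable_prod.
Qed.

Definition prob (F : set Omega) : R := \int[P]_w \1_F w.

Definition centered_mean_on (F : set Omega) n (X : R -> Omega -> 'cV[R]_n) t :=
  mean_on P F X t - prob F *: mean_on P setT X t.

Lemma integrable_indic_real (F : set Omega) : measurable F ->
  P.-integrable setT (EFin \o (\1_F : Omega -> R)).
Proof.
move=> mF; have := @integrable_indicM R dO Omega P F (fun=> 1) mF.
have E : EFin \o (fun w => \1_F w * 1 : R) = EFin \o (\1_F : Omega -> R).
  by apply/funext => w; rewrite /= mulr1.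
rewrite E; apply.
exact: (finite_measure_integrable_cst P 1).
Qed.

Variables (n m : nat) (T : R).
Variables (Qx Qm : R -> 'M[R]_n) (Kx Km : 'M[R]_n) (Ru : R -> 'M[R]_m).
Variables (X : R -> Omega -> 'cV[R]_n) (u : R -> Omega -> 'cV[R]_m) (F : set Omega).
Variables (y : R -> 'cV[R]_n) (eta : R -> 'cV[R]_m).
Hypotheses (T0 : 0 < T) (cQx : mx_cts Qx) (cQm : mx_cts Qm) (cRu : mx_cts Ru) (mF : measurable F)
  (cy : mx_cts y) (ceta : mx_cts eta).
Hypotheses (symQx : forall t, t \in `[0, T] -> (Qx t)^T = Qx t)
  (symQm : forall t, t \in `[0, T] -> (Qm t)^T = Qm t)
  (symRu : forall t, t \in `[0, T] -> (Ru t)^T = Ru t)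
  (symKx : Kx^T = Kx) (symKm : Km^T = Km).
Hypotheses (LX : L2_process P T X) (mu : forall j, pmeasurable T (fun t w => u t w j 0))
  (u2 : forall j, pintegrable T (fun t w => u t w j 0 ^+ 2)).
Hypothesis cm : mx_cts (mean_on P setT X).

Let T0' : 0 <= T := ltW T0.
Let tT : T \in `[0, T]. Proof. by rewrite in_itv /= lexx T0'. Qed.
Notation pF := (prob F).
Let Xp (th : R) t w := X t w + (th * \1_F w) *: y t.
Let up (th : R) t w := u t w + (th * \1_F w) *: eta t.
Let Z t w := X t w - mean_on P setT X t.
Let g (w : Omega) : R := \1_F w - pF.

Let indicT1 w : \1_[set: Omega] w = 1 :> R.
Proof. by rewrite indicE in_setT. Qed.

Let indic_sqr w : \1_F w ^+ 2 = \1_F w :> R.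
Proof. by rewrite indicE; case: (w \in F); rewrite ?expr1n ?expr0n. Qed.

Let Fi : P.-integrable setT (EFin \o (\1_F : Omega -> R)) := integrable_indic_real mF.

Lemma mean_setT t : mean P X t = mean_on P setT X t.
Proof.
apply/matrixP => i j; rewrite !mxE fine_expectation.
by apply: eq_Rintegral => w _; rewrite indicE in_setT mul1r.
Qed.

Let mean_Xp th t : t \in `[0, T] -> mean P (Xp th) t = mean_on P setT X t + (th * pF) *: y t.
Proof.
move=> t01; apply/matrixP => i j; rewrite ord1 -mean_setT !mxE !fine_expectation.
have -> : th * pF * y t i 0 = \int[P]_w (th * y t i 0 * \1_F w).
  by rewrite RintegralZl // -/(prob F); ring.
rewrite -RintegralD //.
- by apply: eq_Rintegral => w _; rewrite !mxE; ring.
- exact: L2_process_int LX t01.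
- exact: integrableZ_real.
Qed.

Let ui j : pintegrable T (fun t w => u t w j 0).
Proof. exact: pintegrable_sqr_int. Qed.
Let uui i j : pintegrable T (fun t w => u t w i 0 * u t w j 0).
Proof. exact: pintegrable_sqr_mul. Qed.
Let Xi j : pintegrable T (fun t w => X t w j 0).
Proof. by apply: pintegrable_sqr_int => //;
  [exact: (L2_process_pmeasurable LX)|exact: L2_process_pintegrable_sqr LX]. Qed.
Let XXi i j : pintegrable T (fun t w => X t w i 0 * X t w j 0).
Proof. by apply: pintegrable_sqr_mul; try exact: (L2_process_pmeasurable LX);
  exact: L2_process_pintegrable_sqr LX. Qed.

Let mZ i : pmeasurable T (fun t w => Z t w i 0).
Proof.
have E : (fun z : lebesgueType R * Omega => Z z.1 z.2 i 0) =
  (fun z : lebesgueType R * Omega => X z.1 z.2 i 0 - mean_on P setT X z.1 i 0).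
  by apply/funext => z; rewrite !mxE.
rewrite /pmeasurable E; apply: measurable_funB; first exact: (L2_process_pmeasurable LX).
exact: (@pmeasurable_time R dO Omega T (fun t => mean_on P setT X t i 0) (@cm i 0)).
Qed.
Let Z2 i : pintegrable T (fun t w => Z t w i 0 ^+ 2).
Proof.
have c1 : continuous (fun t => 2 * mean_on P setT X t i 0 ^+ 2).
  move=> x; apply: cvgM; first exact: cvg_cst.
  by apply: cvgM; exact: cm.
apply: (le_pintegrable _ _ (pintegrableD (pintegrableZ 2 (L2_process_pintegrable_sqr i T0' LX))
  (pintegrable_time T0' c1 (pintegrable_cst P 1 T0')))).
  by apply: measurable_funX; exact: mZ.
move=> t w _; rewrite ger0_norm ?sqr_ge0 // /Z !mxE mulr1.
set a := X t w i 0; set b := \int[P]_w0 _.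
by have := sqr_ge0 (a + b); nra.
Qed.
Lemma pintegrable_centered j : pintegrable T (fun t w => (X t w - mean_on P setT X t) j 0).
Proof. exact: pintegrable_sqr_int. Qed.
Let Zi j : pintegrable T (fun t w => Z t w j 0) := pintegrable_centered j.
Let ZZi i j : pintegrable T (fun t w => Z t w i 0 * Z t w j 0).
Proof. exact: pintegrable_sqr_mul. Qed.

Let Zit t j : t \in `[0, T] -> P.-integrable setT (EFin \o (fun w => Z t w j 0)).
Proof.
move=> t01; have E : EFin \o (fun w => Z t w j 0) =
  EFin \o (fun w => X t w j 0 + (- mean_on P setT X t j 0)).
  by apply/funext => w; rewrite /= [Z t w j 0]mxE [X in _ + X]mxE.
rewrite E; apply: integrableD_real => //; first exact: L2_process_int LX t01.
exact: (finite_measure_integrable_cst P (- mean_on P setT X t j 0)).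
Qed.

Let ZZit t i j : t \in `[0, T] -> P.-integrable setT (EFin \o (fun w => Z t w i 0 * Z t w j 0)).
Proof.
move=> t01; have E : EFin \o (fun w => Z t w i 0 * Z t w j 0) =
  EFin \o (fun w => X t w i 0 * X t w j 0 + (- mean_on P setT X t j 0) * X t w i 0 +
     (- mean_on P setT X t i 0) * Z t w j 0).
  apply/funext => w; rewrite /= ![Z t w _ 0]mxE; congr (_%:E).
  set a := (- mean_on P setT X t) i 0; have -> : a = - mean_on P setT X t i 0 by rewrite [LHS]mxE.
  set b := (- mean_on P setT X t) j 0; have -> : b = - mean_on P setT X t j 0 by rewrite [LHS]mxE.
  by ring.
rewrite E; apply: (integrableD_real measurableT); last by apply: integrableZ_real => //; exact: Zit.
apply: (integrableD_real measurableT); first exact: L2_process_mul LX t01.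
by apply: integrableZ_real => //; exact: L2_process_int LX t01.
Qed.

Notation cvm := (centered_mean_on F X).

Lemma mean_on_centered t : t \in `[0, T] ->
  mean_on P F (fun t w => X t w - mean_on P setT X t) t = cvm t.
Proof.
move=> t01; apply/matrixP => i j; rewrite ord1 !mxE.
have -> : pF * \int[P]_w (\1_[set: Omega] w * X t w i 0) =
  \int[P]_w (mean_on P setT X t i 0 * \1_F w).
  by rewrite RintegralZl // -/(prob F) mxE mulrC.
rewrite -RintegralB //.
- apply: eq_Rintegral => w _; rewrite [Z t w i 0]mxE [X in _ + X]mxE; ring.
- by apply: integrable_indicM => //; exact: L2_process_int LX t01.
- exact: integrableZ_real.
Qed.

Let mean_onT_Z t : t \in `[0, T] -> mean_on P setT Z t = 0.
Proof.
move=> t01; apply/matrixP => i j; rewrite ord1 !mxE.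
transitivity (\int[P]_w (X t w i 0 - mean_on P setT X t i 0)).
  by apply: eq_Rintegral => w _; rewrite indicE in_setT mul1r [Z t w i 0]mxE [X in _ + X]mxE.
rewrite RintegralB //.
- have p1 : fine (P [set: Omega]) = 1 by rewrite probability_setT.
  by rewrite Rintegral_cst // [X in _ * X]p1 mulr1 -mean_setT mxE fine_expectation subrr.
- exact: L2_process_int LX t01.
- exact: (finite_measure_integrable_cst P (mean_on P setT X t i 0)).
Qed.

(** The derivative of the cost in the direction 1_F (y, eta). The pair (X, u)
    enters only through its means over F and over the sure event. *)
Definition first_variation : R :=
  int0 (fun t => ((y t)^T *m Qx t *m mean_on P F X t) 0 0 +
    ((eta t)^T *m Ru t *m mean_on P F u t) 0 0) T
  + ((y T)^T *m Kx *m mean_on P F X T) 0 0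
  + int0 (fun t => ((y t)^T *m Qm t *m cvm t) 0 0) T
  + ((y T)^T *m Km *m cvm T) 0 0.

Let cyQ (Q : R -> 'M[R]_n) : mx_cts Q -> mx_cts (fun t => (y t)^T *m Q t).
Proof. by move=> cQ; apply: mx_ctsM => //; exact: mx_ctsT. Qed.
Let ceR : mx_cts (fun t => (eta t)^T *m Ru t).
Proof. by apply: mx_ctsM => //; exact: mx_ctsT. Qed.

Let running : exists c0 c2 : R, forall th,
  pintegral T (fun t w => quad (Qx t) (Xp th t w) + quad (Ru t) (up th t w)) =
  c0 + th * (2 * int0 (fun t => ((y t)^T *m Qx t *m mean_on P F X t) 0 0 +
    ((eta t)^T *m Ru t *m mean_on P F u t) 0 0) T) + th ^+ 2 * c2
  /\ pintegrable T (fun t w => quad (Qx t) (Xp th t w) + quad (Ru t) (up th t w)).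
Proof.
pose a0 t w := quad (Qx t) (X t w) + quad (Ru t) (u t w).
pose a1 t w := \1_F w * (((y t)^T *m Qx t *m X t w) 0 0 + ((eta t)^T *m Ru t *m u t w) 0 0).
pose q t : R := quad (Qx t) (y t) + quad (Ru t) (eta t).
pose a2 t w := q t * \1_F w.
have a0i : pintegrable T a0 by apply: pintegrableD; exact: pintegrable_quad.
have a1i : pintegrable T a1.
  by apply: pintegrable_indic => //; apply: pintegrableD; apply: pintegrable_row => //; exact: cyQ.
have cq : continuous q.
  by move=> x; apply: cvgD; exact: continuous_quad.
have a2i : pintegrable T a2.
  apply: pintegrable_time => //; have := pintegrable_indic mF (pintegrable_cst P 1 T0').
  by apply: eq_pintegrable => t w _; rewrite mulr1.
have E th t w : t \in `[0, T] -> quad (Qx t) (Xp th t w) + quad (Ru t) (up th t w) =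
    a0 t w + (th * 2) * a1 t w + th ^+ 2 * a2 t w.
  move=> t01; rewrite !quad_affine ?symQx ?symRu // /a0 /a1 /a2 /q !exprMn indic_sqr; ring.
exists (pintegral T a0), (pintegral T a2) => th; split; last first.
  apply: (@eq_pintegrable _ _ _ P T (fun t w => a0 t w + (th * 2) * a1 t w + th ^+ 2 * a2 t w)).
    by move=> t w t01; rewrite E.
  by apply: pintegrableD; [apply: pintegrableD => //|]; exact: pintegrableZ.
transitivity (pintegral T (fun t w => a0 t w + (th * 2) * a1 t w + th ^+ 2 * a2 t w)).
  by apply: eq_Rintegral => w _; apply: eq_Rintegral => t; rewrite inE => t01; exact: E.
rewrite pintegral_affine // mulrA; congr (_ + _ * _ + _).
by rewrite /pintegral /a1 (pintegrable_swap_rows T0' mF (cyQ cQx) ceR Xi ui).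
Qed.

Let terminal : exists c0 c2 : R, forall th,
  \int[P]_w quad Kx (Xp th T w) =
  c0 + th * (2 * ((y T)^T *m Kx *m mean_on P F X T) 0 0) + th ^+ 2 * c2
  /\ P.-integrable setT (EFin \o (fun w => quad Kx (Xp th T w))).
Proof.
pose b0 w := quad Kx (X T w).
pose b1 w := \1_F w * ((y T)^T *m Kx *m X T w) 0 0.
pose b2 w := quad Kx (y T) * \1_F w.
have XTi k := L2_process_int k LX tT.
have b0i : P.-integrable setT (EFin \o b0).
  by apply: integrable_quad => i j; exact: L2_process_mul LX tT.
have b1i : P.-integrable setT (EFin \o b1) by apply: integrable_indicM => //; exact: integrable_row.
have b2i : P.-integrable setT (EFin \o b2) by exact: integrableZ_real.
have E th : (fun w => quad Kx (Xp th T w)) = (fun w => b0 w + (th * 2) * b1 w + th ^+ 2 * b2 w).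
  by apply/funext => w; rewrite quad_affine // /b0 /b1 /b2 !exprMn indic_sqr; ring.
exists (\int[P]_w b0 w), (\int[P]_w b2 w) => th; rewrite E; split; last first.
  apply: (integrableD_real measurableT); last exact: integrableZ_real.
  by apply: (integrableD_real measurableT) => //; exact: integrableZ_real.
rewrite Rintegral_affine // mulrA; congr (_ + _ * _ + _).
exact: Rintegral_row.
Qed.

Let Xp_centered th t w : t \in `[0, T] -> Xp th t w - mean P (Xp th) t = Z t w + (th * g w) *: y t.
Proof. by move=> t01; rewrite mean_Xp // /Z /g; apply/matrixP => i j; rewrite !mxE; ring. Qed.

Let running_var : exists c0 c2 : R, forall th,
  int0 (fun t => \int[P]_w quad (Qm t) (Xp th t w - mean P (Xp th) t)) T =
  c0 + th * (2 * int0 (fun t => ((y t)^T *m Qm t *m cvm t) 0 0) T) + th ^+ 2 * c2.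
Proof.
pose a0 t w := quad (Qm t) (Z t w).
pose r t w := ((y t)^T *m Qm t *m Z t w) 0 0.
pose a1 t w := \1_F w * r t w + - pF * (\1_[set: Omega] w * r t w).
pose q t : R := quad (Qm t) (y t).
pose a2 t w := q t * (g w ^+ 2).
have a0i : pintegrable T a0 by exact: pintegrable_quad.
have ri : pintegrable T r by apply: pintegrable_row => //; exact: cyQ.
have a11 : pintegrable T (fun t w => \1_F w * r t w) by exact: pintegrable_indic.
have a12 : pintegrable T (fun t w => \1_[set: Omega] w * r t w) by exact: pintegrable_indic.
have a1i : pintegrable T a1 by apply: pintegrableD => //; exact: pintegrableZ.
have cq : continuous q by exact: continuous_quad.
have a2i : pintegrable T a2.
  apply: pintegrable_time => //; apply: (@le_pintegrable _ _ _ P T _ (fun _ _ =>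
    (1 + `|pF|) ^+ 2)); last exact: pintegrable_cst.
    apply: (pmeasurable_chance (g := fun w => g w ^+ 2)); apply: measurable_funX;
      apply: measurable_funB => //.
  move=> t w _; rewrite normrX lerXn2r ?nnegrE ?addr_ge0 //.
  by apply: (le_trans (ler_normB _ _)); rewrite lerD2r; exact: indic_le1.
have E th t w : t \in `[0, T] -> quad (Qm t) (Xp th t w - mean P (Xp th) t) =
    a0 t w + (th * 2) * a1 t w + th ^+ 2 * a2 t w.
  move=> t01; rewrite Xp_centered // quad_affine ?symQm // /a0 /a1 /a2 /q /r /g indicT1 !exprMn;
    ring.
exists (pintegral T a0), (pintegral T a2) => th.
transitivity (pintegral T (fun t w => a0 t w + (th * 2) * a1 t w + th ^+ 2 * a2 t w)).
  have ai : pintegrable T (fun t w => a0 t w + (th * 2) * a1 t w + th ^+ 2 * a2 t w).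
    by apply: pintegrableD; [apply: pintegrableD => //|]; exact: pintegrableZ.
  rewrite /pintegral (pintegrable_swap ai); apply: eq_Rintegral => t; rewrite inE => t01.
  by apply: eq_Rintegral => w _; exact: E.
rewrite pintegral_affine // mulrA; congr (_ + _ * _ + _).
have -> : pintegral T a1 = pintegral T (fun t w =>
  \1_F w * r t w + - pF * (\1_[set: Omega] w * r t w) + 0 * (\1_F w * r t w)).
  by apply: eq_Rintegral => w _; apply: eq_Rintegral => t _; rewrite mul0r addr0.
rewrite pintegral_affine // mul0r addr0 /pintegral /r.
rewrite (pintegrable_swap_row T0' mF (cyQ cQm) Zi) (pintegrable_swap_row T0' measurableT (cyQ cQm)
  Zi).
have -> : int0 (fun t => ((y t)^T *m Qm t *m mean_on P [set: Omega] Z t) 0 0) T = 0.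
  transitivity (int0 (fun=> 0) T); last by rewrite Rintegral_cst ?mul0r //;
    exact: measurable_itv_leb.
  by apply: eq_Rintegral => t; rewrite inE => t01; rewrite mean_onT_Z // mulmx0 mxE.
rewrite mulr0 addr0; apply: eq_Rintegral => t; rewrite inE => t01.
by rewrite mean_on_centered.
Qed.

Let terminal_var : exists c0 c2 : R, forall th,
  \int[P]_w quad Km (Xp th T w - mean P (Xp th) T) =
  c0 + th * (2 * ((y T)^T *m Km *m cvm T) 0 0) + th ^+ 2 * c2.
Proof.
pose b0 w := quad Km (Z T w).
pose r w := ((y T)^T *m Km *m Z T w) 0 0.
pose b1 w := \1_F w * r w + - pF * (\1_[set: Omega] w * r w) + 0 * r w.
pose b2 w := quad Km (y T) * (g w ^+ 2).
have ZTi k := Zit k tT.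
have b0i : P.-integrable setT (EFin \o b0).
  by apply: integrable_quad => i j; exact: ZZit.
have ri : P.-integrable setT (EFin \o r) by exact: integrable_row.
have r1 : P.-integrable setT (EFin \o (fun w => \1_F w * r w)) by exact: integrable_indicM.
have r2 : P.-integrable setT (EFin \o (fun w =>
  \1_[set: Omega] w * r w)) by exact: integrable_indicM.
have b1i : P.-integrable setT (EFin \o b1).
  apply: (integrableD_real measurableT); last exact: integrableZ_real.
  by apply: (integrableD_real measurableT) => //; exact: integrableZ_real.
have b2i : P.-integrable setT (EFin \o b2).
  apply: integrableZ_real => //.
  apply: (@le_integrable_real _ _ _ P setT measurableT _ (fun=> (1 + `|pF|) ^+ 2)).
  - by apply: measurable_funX; apply: measurable_funB.
  - move=> w _; rewrite normrX lerXn2r ?nnegrE ?addr_ge0 //.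
    by apply: (le_trans (ler_normB _ _)); rewrite lerD2r; exact: indic_le1.
  - exact: finite_measure_integrable_cst.
exists (\int[P]_w b0 w), (\int[P]_w b2 w) => th.
transitivity (\int[P]_w (b0 w + (th * 2) * b1 w + th ^+ 2 * b2 w)).
  apply: eq_Rintegral => w _; rewrite Xp_centered // quad_affine // /b0 /b1 /b2 /r /g indicT1
    !exprMn; ring.
rewrite Rintegral_affine // mulrA; congr (_ + _ * _ + _).
rewrite /b1 Rintegral_affine // mul0r addr0 /r !Rintegral_row //.
rewrite -/(mean_on P F Z T) -/(mean_on P setT Z T) mean_onT_Z // mean_on_centered //.
by rewrite mulmx0 [X in _ * X]mxE mulr0 addr0.
Qed.

(** Each of the four terms of the cost is expanded by quad_affine. In the
    variance terms the mean moves as well: the centered state becomes Z + th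
    (1_F - P(F)) y with Z = X - E X, and the linear term is E[(1_F - P(F)) Z]
    = E[1_F Z] because E Z = 0. *)
Lemma cost_expansion : exists c0 c2 : R, forall th : R,
  cost P T Qx Qm Kx Km Ru (fun t w => X t w + (th * \1_F w) *: y t)
    (fun t w => u t w + (th * \1_F w) *: eta t) = c0 + th * first_variation + th ^+ 2 * c2.
Proof.
have [a0 [a2 ha]] := running; have [b0 [b2 hb]] := terminal.
have [d0 [d2 hd]] := running_var; have [e0 [e2 he]] := terminal_var.
exists (2^-1 * (a0 + b0 + d0 + e0)), (2^-1 * (a2 + b2 + d2 + e2)) => th.
rewrite /cost !fine_expectation.
have [aE ai] := ha th; have [bE bi] := hb th.
rewrite RintegralD //; last exact: pintegrable_path.
rewrite -/(pintegral T (fun t w => quad (Qx t) (Xp th t w) + quad (Ru t) (up th t w))) aE bE he.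
have -> : int0 (fun t => fine ('E_P[fun w => quad (Qm t) (Xp th t w - mean P (Xp th) t)])%E) T
    = int0 (fun t => \int[P]_w quad (Qm t) (Xp th t w - mean P (Xp th) t)) T.
  by apply: eq_Rintegral => t _; rewrite fine_expectation.
by rewrite hd /first_variation; field.
Qed.

End cost_expansion.

(** * Functions whose integrals over rectangles vanish *)

Section vanishing.
Context {R : realType}.
Notation mul := (@completed_lebesgue_measure R).
Notation int0 f t := (\int[mul]_(s in (`[0%R, t] : set (lebesgueType R))) f s).

Section dynkin.
Context d (U : measurableType d) (mu : {measure set U -> \bar R}) (f : U -> \bar R).
Hypothesis fi : mu.-integrable setT f.
Local Open Scope ereal_scope.

Lemma integral0_setC (S : set U) : measurable S -> \int[mu]_x f x = 0 ->
  \int[mu]_(x in S) f x = 0 -> \int[mu]_(x in ~` S) f x = 0.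
Proof.
move=> mS fT fS; have mSC := measurableC mS.
have := @integral_setU _ _ _ mu S (~` S) f mS mSC.
rewrite setUv fT fS add0e => <- //.
- exact: measurable_int fi.
- exact/disj_setPCl.
Qed.

Lemma integral0_bigcup (F : (set U)^nat) : (forall n, measurable (F n)) ->
  trivIset [set: nat] F -> (forall n, \int[mu]_(x in F n) f x = 0) ->
  \int[mu]_(x in \bigcup_k F k) f x = 0.
Proof.
move=> mF tF F0; rewrite integral_bigcup //.
  by rewrite eseries0 // => n _ _; exact: F0.
by apply: integrableS fi => //; exact: bigcupT_measurable.
Qed.

(** If f has zero integral over the whole space, the sets over which its
    integral is 0 form a Dynkin system. *)
Lemma dynkin_integral0 (G : set (set U)) : @measurable _ U = <<s G >> ->
  setI_closed G -> \int[mu]_x f x = 0 -> (forall A, G A -> \int[mu]_(x in A) f x = 0) ->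
  forall A, measurable A -> \int[mu]_(x in A) f x = 0.
Proof.
move=> gen GI fT fG A mA.
apply: (@dynkin_induction _ U G (fun A => \int[mu]_(x in A) f x = 0) gen GI fT fG).
- by move=> S mS; exact: integral0_setC.
- by move=> F mF tF; exact: integral0_bigcup.
- by rewrite -gen.
Qed.

End dynkin.

(** Intervals generate the Borel sets, and a Lebesgue set differs from a Borel
    set by a null set; so the integral of phi vanishes over every Lebesgue
    subset of [0, T]. *)
Lemma ae0_of_primitive0 (T : R) (phi : R -> R) : 0 <= T ->
  mul.-integrable (`[0%R, T] : set (lebesgueType R)) (EFin \o phi) ->
  (forall t, t \in `[0, T] -> int0 phi t = 0) ->
  {ae mul, forall t : lebesgueType R, t \in `[0, T] -> phi t = 0}.
Proof.
move=> T0 phii H.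
pose f : lebesgueType R -> \bar R := (EFin \o phi) \_ (`[0, T]%classic : set (lebesgueType R)).
have fi : mul.-integrable setT f by apply/(integrable_mkcond _ (measurable_itv_leb _)).
have fB (E : set R) : (\int[mul]_(x in (E : set (lebesgueType R))) f x =
    \int[mul]_(x in (E `&` `[0%R, T] : set (lebesgueType R))) (phi x)%:E)%E.
  by rewrite integral_mkcondr.
have H' t : t \in `[0, T] -> (\int[mul]_(x in (`[0%R, t] : set (lebesgueType R))) (phi x)%:E = 0)%E.
  move=> tT; have := H t tT; rewrite /Rintegral => H0.
  rewrite -[LHS]fineK ?H0 //; apply: integrable_fin_num; first exact: measurable_itv_leb.
  apply: integrableS phii; [exact: measurable_itv_leb|exact: measurable_itv_leb|].
  by move=> x /=; move: tT; rewrite !in_itv /= => /andP[_ tT] /andP[-> xt]; exact: le_trans tT.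
have fT : (\int[mul]_x f x = 0)%E.
  by rewrite fB setTI H' // in_itv /= lexx T0.
have borel (E : set R) : measurable (E : set (measurableTypeR R)) ->
    (\int[mul]_(x in (E : set (lebesgueType R))) f x = 0)%E.
  move=> mE.
  apply: (@dynkin_induction _ (measurableTypeR R) (@RGenOInfty.G R)
    (fun E : set R => (\int[mul]_(x in (E : set (lebesgueType R))) f x = 0)%E)).
  - exact: RGenOInfty.measurableE.
  - move=> _ _ [x ->] [y ->]; exists (Num.max x y).
    apply/seteqP; split => z /=; rewrite !in_itv /= !andbT gt_max; first by move=> [-> ->].
    by move=> /andP[].
  - exact: fT.
  - move=> _ [x ->].
    have -> : `]x, +oo[%classic = ~` `]-oo, x]%classic :> set R by rewrite setCitvl.
    apply: integral0_setC => //; first exact: measurable_itv_leb.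
    rewrite fB.
    have [x0|x0] := ltP x 0.
      rewrite (_ : _ `&` _ = set0) ?integral_set0 //.
      by apply/seteqP; split => z //=; rewrite !in_itv /= => -[? /andP[? ?]]; lra.
    have [xT|xT] := leP x T.
      rewrite (_ : _ `&` _ = `[0, x]%classic); first by rewrite H' // in_itv /= x0.
      apply/seteqP; split => z /=; rewrite !in_itv /=.
        by move=> [-> /andP[-> _]].
      by move=> /andP[-> zx]; rewrite zx (le_trans zx).
    rewrite (_ : _ `&` _ = `[0, T]%classic); first by rewrite H' // in_itv /= lexx T0.
    apply/seteqP; split => z /=; rewrite !in_itv /=; first by case.
    by move=> /andP[-> zT]; rewrite zT (le_trans zT (ltW xT)).
  - move=> S mS; apply: integral0_setC => //; exact: measurable_leb.
  - by move=> G mG tG G0; apply: (integral0_bigcup fi) => // n; exact: measurable_leb (mG n).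
  - by have : ((@ocitv R).-sigma.-measurable E) by []; rewrite RGenOInfty.measurableE.
(* a Lebesgue set is a Borel set up to a subset of a Borel null set *)
have lebE (E : set R) : measurable (E : set (lebesgueType R)) ->
    (\int[mul]_(x in (E : set (lebesgueType R))) f x = 0)%E.
  move=> mE.
  have : ((@wlength R idfun)^*%mu.-cara.-measurable) E by exact: mE.
  rewrite -completed_caratheodory_measurable g_sigma_completed_algebra_genE.
  move=> [A mA [N [N' [mN' N'0 NN']] AN]].
  have mAl := measurable_leb mA; have mNl := measurable_leb mN'.
  have N'0l : (mul (N' : set (lebesgueType R)) = 0)%E by exact: N'0.
  have fiS (S : set (lebesgueType R)) : measurable S -> mul.-integrable S f.
    by move=> mS; apply: integrableS fi.
  rewrite (negligible_integral mNl mE (fiS _ mE) N'0l).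
  rewrite (_ : E `\` N' = A `\` N'); last first.
    rewrite -AN; apply/seteqP; split => z /=; first by move=> [[Az|/NN']//].
    by move=> [Az N'z]; split => //; left.
  by rewrite -(negligible_integral mNl mAl (fiS _ mAl) N'0l) borel.
have : ae_eq mul setT f (cst 0%E).
  apply: integral_ae_eq => //.
  by move=> E _ mE; rewrite integral0 lebE.
apply: filterS => t /(_ I) + tT; rewrite /f patchE mem_set //= => -[].
exact.
Qed.

Context {dO : measure_display} {Omega : measurableType dO} (P : probability Omega R).
Notation time_space T := (@time_space R dO Omega T).

(** Rectangles E x F generate the product sigma-algebra. The integral of g
    over E x F is the integral over E of the function E[1_F g(t)], which is 0
    for almost every t since its primitive vanishes. *)
Lemma pintegrable_ae0 (T : R) (g : R -> Omega -> R) : 0 <= T -> pintegrable P T g ->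
  (forall F, measurable F -> forall t, t \in `[0, T] ->
     int0 (fun s => \int[P]_w (\1_F w * g s w)) t = 0) ->
  {ae (mul \x P)%E, forall z : lebesgueType R * Omega, time_space T z -> g z.1 z.2 = 0}.
Proof.
move=> T0 gi H.
have mts := measurable_time_space (Omega := Omega) T.
pose f : lebesgueType R * Omega -> \bar R := (fun z => (g z.1 z.2)%:E) \_ (time_space T).
have fi : (mul \x P)%E.-integrable setT f by exact/(integrable_mkcond _ mts).
have rect (E : set (lebesgueType R)) F : measurable E -> measurable F ->
    (\int[(mul \x P)%E]_(z in E `*` F) f z = 0)%E.
  move=> mE mF.
  have mEF : measurable (E `*` F) by exact: measurableX.
  have gEF : pintegrable P T (fun t w => \1_E t * (\1_F w * g t w)).
    apply: (@pintegrableM _ _ _ P T 1 (fun t _ => \1_E t)); last exact: pintegrable_indic.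
      apply: (@measurable_comp _ _ _ _ _ _ setT (\1_E : lebesgueType R -> R)) => //.
      exact: measurable_funTS.
    by move=> t w _; rewrite indicE; case: (t \in E); rewrite ?normr1 ?normr0.
  have fin : (\int[(mul \x P)%E]_(z in E `*` F) f z)%E \is a fin_num.
    by apply: integrable_fin_num => //; apply: integrableS fi.
  rewrite -[LHS]fineK //; congr (_%:E).
  transitivity (pintegral P T (fun t w => \1_E t * (\1_F w * g t w))).
    rewrite /pintegral (pintegrable_prod gEF) /Rintegral; congr fine.
    rewrite [LHS]integral_mkcond [RHS]integral_mkcond.
    apply: eq_integral => -[t w] _; rewrite /f !patchE /=.
    have -> : ((t, w) \in E `*` F) = (t \in E) && (w \in F) by rewrite in_setX.
    rewrite !indicE; case: ifP => [/andP[-> ->]|]; first by rewrite !mul1r.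
    by case: (t \in E); case: (w \in F) => //= _; rewrite ?(mul0r, mulr0) if_same.
  rewrite /pintegral (pintegrable_swap gEF).
  have gF := pintegrable_indic mF gi.
  have ae0 := ae0_of_primitive0 T0 (pintegrable_mean gF) (H F mF).
  transitivity (int0 (fun=> 0) T); last by rewrite Rintegral_cst ?mul0r //;
    exact: measurable_itv_leb.
  congr fine; apply: ae_eq_integral.
  - exact: measurable_itv_leb.
  - exact: (measurable_int mul (pintegrable_mean gEF)).
  - exact: measurable_cst.
  - apply: filterS ae0 => t Ht tT; congr (_%:E).
    have : \int[P]_w (\1_E t * (\1_F w * g t w)) = \1_E t * \int[P]_w (\1_F w * g t w).
      rewrite indicE; case: (t \in E); first by rewrite mul1r; apply: eq_Rintegral => w _;
        rewrite mul1r.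
      by rewrite mul0r; under eq_Rintegral do rewrite mul0r; rewrite Rintegral_cst // mul0r.
    by move=> ->; rewrite Ht ?mulr0.
have fC C : measurable C -> (\int[(mul \x P)%E]_(z in C) f z = 0)%E.
  apply: (dynkin_integral0 fi (G := [set A `*` B | A in measurable & B in measurable])).
  - exact: measurable_prod_measurableType.
  - move=> _ _ [A mA [B mB <-]] [A' mA' [B' mB' <-]]; exists (A `&` A'); first exact: measurableI.
    by exists (B `&` B'); [exact: measurableI|rewrite setXI].
  - by rewrite -setXTT rect.
  - by move=> _ [A mA [B mB <-]]; exact: rect.
have : ae_eq (mul \x P)%E setT f (cst 0%E).
  apply: integral_ae_eq => //.
  by move=> E _ mE; rewrite integral0 fC.
apply: filterS => z /(_ I) + zT; rewrite /f patchE mem_set //= => -[].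
exact.
Qed.

End vanishing.

(** * Continuity of the matrix inverse and uniform convergence *)

Section matrix_continuity.
Context {R : realType}.

Lemma within_mx_cts_clamp (T : R) m n (M : R -> 'M[R]_(m, n)) : 0 < T ->
  {within `[0, T], continuous M} -> mx_cts (fun t => M (clamp T t)).
Proof.
move=> T0 cM i j x.
apply: (@continuous_comp _ _ _ (M \o clamp T) (fun N : 'M[R]_(m, n) => N i j)).
  exact: continuous_comp_clamp.
exact: coord_continuous.
Qed.

Lemma mx_cts_continuous m n (M : R -> 'M[R]_(m, n)) : mx_cts M -> continuous M.
Proof.
move=> cM x A /nbhs_ballP[e e0 eA].
have Hij i j : \forall y \near x, ball (M x i j) e (M y i j).
  by have /cvg_ballP /(_ _ e0) := cM i j x.
have Hi i : \forall y \near x, forall j, ball (M x i j) e (M y i j).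
  by apply: (@filter_forall R _ (fun j y => ball (M x i j) e (M y i j)) (nbhs x)) => j; exact: Hij.
have H : \forall y \near x, forall i j, ball (M x i j) e (M y i j).
  by apply: (@filter_forall R _ (fun i y => forall j, ball (M x i j) e (M y i j)) (nbhs x)) => i;
    exact: Hi.
by apply: filterS H => y Hy; apply: eA; split.
Qed.

Lemma continuous_det n (M : R -> 'M[R]_n) : mx_cts M -> continuous (fun t => \det (M t)).
Proof.
move=> cM; rewrite /determinant; apply: continuous_big => [|s _]; first exact: add_continuous.
move=> x; apply: cvgM; first exact: cvg_cst.
by apply: (@continuous_big R 'I_n *%R 1 xpredT (@mul_continuous R)) => i _; exact: cM.
Qed.

(** By Cramer's rule, since determinants are polynomials in the entries. *)
Lemma mx_cts_invmx n (M : R -> 'M[R]_n) : mx_cts M -> (forall t, M t \in unitmx) ->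
  mx_cts (fun t => invmx (M t)).
Proof.
move=> cM uM i j.
have -> : (fun t => invmx (M t) i j) =
   (fun t => (\det (M t))^-1 * ((-1) ^+ (j + i) * \det (row' j (col' i (M t))))).
  by apply/funext => t; rewrite /invmx uM !mxE.
move=> x; apply: cvgM.
  apply: (@cvgV R _ _ _ (fun t => \det (M t)) (\det (M x))); last exact: continuous_det.
  by have := uM x; rewrite unitmxE unitfE.
apply: cvgM; first exact: cvg_cst.
apply: (@continuous_det _ (fun t => row' j (col' i (M t)))) => k l.
by under eq_fun do rewrite !mxE; exact: cM.
Qed.

Lemma posdef_unitmx n (Q : 'M[R]_n) : posdef Q -> Q \in unitmx.
Proof.
move=> [symQ pos]; rewrite -row_free_unit -kermx_eq0; apply/eqP/row_matrixP => i.
rewrite row0; apply/eqP; apply: contrapT => /negP nz.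
have := pos (row i (kermx Q))^T; rewrite trmx_eq0 => /(_ nz).
by rewrite /quad trmxK -row_mul mulmx_ker row0 mul0mx mxE ltxx.
Qed.

Lemma uniform_entries (A : set R) n (h : nat -> R -> 'cV[R]_n) (f : R -> 'cV[R]_n) :
  {uniform A, h @ \oo --> f} <->
  (forall e : R, 0 < e -> \forall k \near \oo, forall t, A t ->
    forall i, `|f t i 0 - h k t i 0| < e).
Proof.
split=> [H e e0|H].
  pose E := [set xy : 'cV[R]_n * 'cV[R]_n | ball xy.1 e xy.2].
  have entE : entourage E by rewrite -entourage_from_ballE; exists e.
  have nb : nbhs (f : {uniform` A -> 'cV[R]_n}) [set g | forall y, A y -> E (f y, g y)].
    by apply/uniform_nbhs; exists E; split.
  have HH : \forall k \near \oo, forall y, A y -> E (f y, h k y) := H _ nb.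
  apply: filterS HH => k Hk t At i.
  by have [_ /(_ i 0)] := Hk t At.
move=> U /uniform_nbhs [E [entE EU]].
have [e e0 eE] : exists2 e : R, 0 < e & [set xy : 'cV[R]_n * 'cV[R]_n | ball xy.1 e xy.2] `<=` E.
  by move: entE; rewrite -entourage_from_ballE => -[e e0 eE]; exists e.
suff : \forall k \near \oo, U (h k) by [].
apply: filterS (H e e0) => k Hk; apply: EU => t At; apply: eE => /=.
by split => // i j; rewrite ord1; exact: Hk.
Qed.

End matrix_continuity.

(** * Integrals of functions that may fail to be measurable *)

Section nonmeasurable.
Context {R : realType} {dO : measure_display} {Omega : measurableType dO}.
Variable P : probability Omega R.
Local Open Scope ereal_scope.
Import HBNNSimple.

(** To be applied with f a supremum over uncountably many times, which may
    fail to be measurable. If h is simple and below 2 f + c, then max(0, (h -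
    c) / 2) is measurable and below f, which bounds the integral of h. *)
Lemma ge0_integral_affine_lty (f : Omega -> \bar R) (c : R) : (0 <= c)%R ->
  (forall w, 0 <= f w) -> \int[P]_w f w < +oo -> \int[P]_w (2%:E * f w + c%:E) < +oo.
Proof.
move=> c0 f0 fy.
apply: (@le_lt_trans _ _ (2%:E * \int[P]_w f w + c%:E)); last first.
  by rewrite lte_add_pinfty ?ltry // lte_mul_pinfty.
rewrite ge0_integralTE; last by move=> w; rewrite adde_ge0 ?mule_ge0 ?lee_fin.
apply/ge_ereal_sup => _ [h /= hf <-].
have -> : sintegral P h = \int[P]_w (h w)%:E by rewrite integral_nnsfun // patch_setT.
(* the least k >= 0 with h <= 2 k + c *)
pose k w : R := (Num.max 0 (h w - c) / 2)%R.
have mk : measurable_fun setT k.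
  apply: measurable_funM => //; apply: measurable_maxr => //.
  by apply: measurable_funB.
have k0 w : (0 <= k w)%R by rewrite divr_ge0 // le_max lexx.
apply: (@le_trans _ _ (\int[P]_w (2%:E * (k w)%:E + c%:E))).
  apply: ge0_le_integral => //.
  - by move=> w _; rewrite lee_fin.
  - by apply/measurable_EFinP.
  - apply: emeasurable_funD => //; apply: emeasurable_funM => //; exact/measurable_EFinP.
  - move=> w _; rewrite -EFinM -EFinD lee_fin /k mulrC divfK //.
    by rewrite -lerBlDr le_max lexx orbT.
rewrite ge0_integralD //; last 2 first.
  by move=> w _; rewrite mule_ge0 // lee_fin.
  by apply: emeasurable_funM => //; exact/measurable_EFinP.
rewrite integral_cst // [X in _ * X]probability_setT mule1 leeD2r //.
rewrite ge0_integralZl //; last 2 first.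
  by apply/measurable_EFinP.
  by move=> w _; rewrite lee_fin.
rewrite lee_pmul2l //.
apply: (@ge0_le_integral_off_null _ _ _ P set0) => //.
move=> w _; have := hf w; rewrite /k.
have := f0 w; case: (f w) => [r| |] //=; last by rewrite !leey.
rewrite -EFinM -EFinD !lee_fin => r0 hr.
rewrite ler_pdivrMr // ge_max; apply/andP; split; first by rewrite mulr_ge0.
by rewrite lerBlDr (mulrC r).
Qed.

End nonmeasurable.

Section cost_off_null.
Context {R : realType} {dO : measure_display} {Omega : measurableType dO}.
Variable P : probability Omega R.

Lemma mean_off_null n (N : set Omega) (X Y : R -> Omega -> 'cV[R]_n) t : measurable N ->
  P N = 0%E ->
  (forall w, ~ N w -> X t w = Y t w) -> mean P X t = mean P Y t.
Proof.
move=> mN N0 XY; apply/matrixP => i j; rewrite !mxE !fine_expectation; congr fine.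
by apply: (integral_off_null mN N0) => w Nw; rewrite XY.
Qed.

(** The way from a given pair to its regular version, and from the
    coefficients on [0, T] to their clamped extensions. *)
Lemma cost_off_null n m (T : R) (Qx Qm Qx' Qm' : R -> 'M[R]_n) (Kx Km : 'M[R]_n)
    (Ru Ru' : R -> 'M[R]_m)
    (N : set Omega) (X Y : R -> Omega -> 'cV[R]_n) (u v : R -> Omega -> 'cV[R]_m) : 0 <= T ->
  measurable N -> P N = 0%E ->
  (forall t, t \in `[0, T] -> [/\ Qx t = Qx' t, Qm t = Qm' t & Ru t = Ru' t]) ->
  (forall w t, ~ N w -> t \in `[0, T] -> X t w = Y t w /\ u t w = v t w) ->
  cost P T Qx Qm Kx Km Ru X u = cost P T Qx' Qm' Kx Km Ru' Y v.
Proof.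
move=> T0 mN N0 QE XY; rewrite /cost !fine_expectation.
have tT : T \in `[0, T] by rewrite in_itv /= lexx T0.
have mE t : t \in `[0, T] -> mean P X t = mean P Y t.
  by move=> t01; apply: (mean_off_null mN N0) => w Nw; case: (XY w t Nw t01).
apply: congr2; first apply: congr2.
- apply: congr1; congr fine; apply: (integral_off_null mN N0) => w Nw; congr (_%:E); congr (_ + _).
    apply: eq_Rintegral => t; rewrite inE => t01.
    by have [-> ->] := XY w t Nw t01; have [-> _ ->] := QE t t01.
  by have [-> _] := XY w T Nw tT.
- apply: congr1; apply: eq_Rintegral => t; rewrite inE => t01; rewrite !fine_expectation;
  congr fine.
  apply: (integral_off_null mN N0) => w Nw; rewrite mE //.
  by have [-> _] := XY w t Nw t01; have [_ -> _] := QE t t01.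
- apply: congr1; congr fine; apply: (integral_off_null mN N0) => w Nw; rewrite mE //.
  by have [-> _] := XY w T Nw tT.
Qed.

End cost_off_null.

(** * Regular versions of admissible pairs *)

Section regular_version.
Context {R : realType} {dO : measure_display} {Omega : measurableType dO}.
Variable P : probability Omega R.
Notation mul := (@completed_lebesgue_measure R).
Notation int0 f t := (\int[mul]_(s in (`[0%R, t] : set (lebesgueType R))) f s).

Lemma enorm_sqr n (x : 'cV[R]_n) : enorm x ^+ 2 = \sum_i x i 0 ^+ 2.
Proof. by rewrite sqr_sqrtr // sumr_ge0 // => i _; exact: sqr_ge0. Qed.

Lemma entry_le_enorm n (x : 'cV[R]_n) i : x i 0 ^+ 2 <= enorm x ^+ 2.
Proof.
by rewrite enorm_sqr (bigD1 i) //= lerDl sumr_ge0 // => j _; exact: sqr_ge0.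
Qed.

Definition sup_sqr (T : R) n (X : R -> Omega -> 'cV[R]_n) (w : Omega) : \bar R :=
  ereal_sup [set ((enorm (X t w)) ^+ 2)%:E | t in `[0%R, T]].

Lemma sup_sqr_ge T n (X : R -> Omega -> 'cV[R]_n) w t : t \in `[0, T] ->
  (((enorm (X t w)) ^+ 2)%:E <= sup_sqr T X w)%E.
Proof. by move=> tT; apply: ereal_sup_ubound; exists t. Qed.

Lemma sup_sqr_ge0 (T : R) n (X : R -> Omega -> 'cV[R]_n) w : 0 <= T -> (0 <= sup_sqr T X w)%E.
Proof.
move=> T0; apply: le_trans (@sup_sqr_ge T n X w 0 _).
  by rewrite lee_fin sqr_ge0.
by rewrite in_itv /= lexx.
Qed.

Lemma X2norm_lty T n (X : R -> Omega -> 'cV[R]_n) :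
  (X2norm P T X < +oo)%E <-> (\int[P]_w sup_sqr T X w < +oo)%E.
Proof.
rewrite /X2norm -/(sup_sqr _ _ _); split; last exact: poweR_lty.
case E : (\int[P]_w sup_sqr T X w)%E => [r| |]; [by move=> _; rewrite ltry| |by []].
by rewrite poweRyr ?invr_eq0 ?pnatr_eq0.
Qed.

(** There are finitely many paths, each continuous and taken on a measurable
    event, so preimages are finite unions of rectangles. *)
Lemma simple_path_measurable (T : R) n (Z : Omega -> R -> 'cV[R]_n) i : 0 < T ->
  simple_path T Z ->
  measurable_fun setT (fun z : lebesgueType R * Omega => Z z.2 (clamp T z.1) i 0).
Proof.
move=> T0 [finZ mZ cZ] _ Y mY; rewrite setTI.
have -> : (fun z : lebesgueType R * Omega => Z z.2 (clamp T z.1) i 0) @^-1` Y =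
   \bigcup_(q in range Z) ((([set t : R | Y (q (clamp T t) i 0)] : set (lebesgueType R)) `*` (Z
     @^-1` [set q]))).
  apply/seteqP; split => -[t w] /=; first by move=> H; exists (Z w) => //; exists w.
  by move=> [q _ [/= H ->]].
apply: fin_bigcup_measurable => // q [w _ <-]; apply: measurableX => //.
have cq : continuous (fun t => Z w (clamp T t) i 0).
  exact: (@within_mx_cts_clamp _ T _ _ (Z w) T0 (cZ w) i 0).
have := @measurable_fun_leb R setT _ measurableT (continuous_measurable_fun cq).
by move=> /(_ measurableT Y mY); rewrite setTI.
Qed.

(** All exceptional outcomes lie in a measurable null event N. Setting the
    pair to 0 on N and stopping the state outside [0, T] gives processes that
    solve the equation for every outcome. The state is jointly measurable as a
    pointwise limit of the simple paths that witness strong measurability. *)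
Lemma regular_version (T : R) n m (A : R -> 'M[R]_n) (B : R -> 'M[R]_(n, m))
    (X0 : Omega -> 'cV[R]_n) (Xs : R -> Omega -> 'cV[R]_n) (us : R -> Omega -> 'cV[R]_m) :
  0 < T -> admissible P T A B X0 Xs us ->
  exists (N : set Omega) (X : R -> Omega -> 'cV[R]_n) (u : R -> Omega -> 'cV[R]_m),
  [/\ measurable N /\ P N = 0%E, L2_process P T X,
      (forall j, pmeasurable T (fun t w => u t w j 0)) /\ (forall j,
        pintegrable P T (fun t w => u t w j 0 ^+ 2)),
      (forall t w, X t w = X (clamp T t) w) /\
      (forall w t, t \in `[0, T] -> forall i, X t w i 0 = X 0 w i 0 +
        int0 (fun s => (A (clamp T s) *m X s w + B (clamp T s) *m u s w) i 0) t) &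
      (forall w t, ~ N w -> t \in `[0, T] -> X t w = Xs t w /\ u t w = us t w)].
Proof.
move=> T0 [[_ [Z [sZ cvgZ]] X2n] [mus us2] sol _].
have T0' := ltW T0.
have [N [mN N0 NP]] : P.-negligible (~` [set w |
   {uniform `[0, T], (fun k => Z k w) @ \oo --> (fun t => Xs t w)} /\
   solves T A B (fun t => Xs t w) (fun t => us t w)]).
  by apply: filterS2 cvgZ sol => w h1 h2; split.
have good w : ~ N w -> {uniform `[0, T], (fun k => Z k w) @ \oo --> (fun t => Xs t w)} /\
   solves T A B (fun t => Xs t w) (fun t => us t w).
  by move=> Nw; apply: contrapT => H; apply: Nw; exact: NP.
pose D (w : Omega) : R := \1_(~` N) w.
have mNC : measurable (~` N) by exact: measurableC.
have D0 w : N w -> D w = 0 by move=> Nw; rewrite /D indicE memNset //= => /(_ Nw).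
have D1 w : ~ N w -> D w = 1 by move=> Nw; rewrite /D indicE mem_set.
have D2 w : D w ^+ 2 <= 1.
  by rewrite /D indicE; case: (_ \in _); rewrite ?expr1n ?expr0n.
have mD : measurable_fun setT D by exact: measurable_indic_real.
pose X t w := D w *: Xs (clamp T t) w.
pose u t w := D w *: us t w.
have mX i : measurable_fun setT (fun z : lebesgueType R * Omega => X z.1 z.2 i 0).
  apply: (@measurable_fun_cvg _ _ _ setT (fun k (z : lebesgueType R * Omega) =>
    D z.2 * Z k z.2 (clamp T z.1) i 0)).
    move=> k; apply: measurable_funM; last exact: simple_path_measurable.
    exact: (measurableT_comp mD).
  move=> [t w] _ /=; rewrite /X mxE.
  have [Nw|Nw] := pselect (N w).
    by rewrite D0 // mul0r; under eq_fun do rewrite mul0r; exact: cvg_cst.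
  apply: cvgM; first exact: cvg_cst.
  have [/uniform_entries H _] := good w Nw.
  apply/cvgrPdist_lt => e e0; have := H e e0; apply: filterS => k Hk.
  by apply: Hk; exact: clamp_in.
have uE t w j : u t w j 0 = D w * us t w j 0 by rewrite mxE.
have mu_ j : pmeasurable T (fun t w => u t w j 0).
  rewrite /pmeasurable; under eq_fun do rewrite uE.
  by apply: measurable_funM (mus j); exact: (@pmeasurable_chance _ _ _ T D mD).
exists N, X, u; split => //.
- split.
  + by move=> i; exact: measurable_funTS.
  + by move=> t i _; exact: (measurableT_comp (mX i) (@pair1_measurable _ _ (lebesgueType R) Omega
    t)).
  + have Sfin := (X2norm_lty T Xs).1 X2n.
    exists (fine (\int[P]_w sup_sqr T Xs w)) => t i tT.
    rewrite fineK; last first.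
      by rewrite ge0_fin_numE //; apply: integral_ge0 => w _; exact: sup_sqr_ge0.
    apply: (@ge0_le_integral_off_null _ _ _ P set0) => //.
    * by move=> w; rewrite lee_fin sqr_ge0.
    * by move=> w; exact: sup_sqr_ge0.
    * move=> w _; apply: le_trans (sup_sqr_ge Xs w tT); rewrite lee_fin.
      apply: le_trans (entry_le_enorm _ i); rewrite /X mxE clamp_id // exprMn.
      by rewrite ler_piMl // sqr_ge0.
- split => // j; apply/integrableP; split.
    by apply/measurable_EFinP; apply: measurable_funX; exact: mu_.
  apply: le_lt_trans us2; apply: ge0_le_integral => //.
  + exact: measurable_time_space.
  + by apply: measurableT_comp => //; apply/measurable_EFinP; apply: measurable_funX; exact: mu_.
  + apply/measurable_EFinP; under eq_fun do rewrite enorm_sqr.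
    by apply: measurable_sum => k; apply: measurable_funX; exact: mus.
  + move=> [t w] _ /=; rewrite lee_fin ger0_norm ?sqr_ge0 //.
    apply: le_trans (entry_le_enorm _ j); rewrite uE exprMn.
    by rewrite ler_piMl // sqr_ge0.
- split; first by move=> t w; rewrite /X (clamp_id (clamp_in t T0)).
  move=> w t tT i; rewrite /X.
  have c0 : clamp T 0 = 0 by rewrite clamp_id // in_itv /= lexx T0'.
  rewrite clamp_id // c0.
  have [Nw|Nw] := pselect (N w).
    rewrite D0 // !scale0r; under eq_Rintegral do rewrite /u D0 // !scale0r !mulmx0 addr0 mxE.
    by rewrite Rintegral_cst ?mul0r ?mxE ?addr0 //; exact: measurable_itv_leb.
  have [_ sw] := good w Nw; rewrite D1 // !scale1r.
  rewrite (sw t tT) [LHS]mxE [X in _ + X = _]mxE; congr (_ + _).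
  apply: eq_Rintegral => s; rewrite inE /= => st.
  have sT : s \in `[0, T].
    by move: st tT; rewrite !in_itv /= => /andP[-> st] /andP[_]; exact: le_trans.
  by rewrite clamp_id // /u D1 // !scale1r.
- by move=> w t Nw tT; rewrite /X /u D1 // !scale1r clamp_id.
Qed.

End regular_version.

(** * Admissible perturbations *)

Section perturbation.
Context {R : realType} {dO : measure_display} {Omega : measurableType dO}.
Variable P : probability Omega R.
Notation mul := (@completed_lebesgue_measure R).
Notation time_space T := (@time_space R dO Omega T).

Lemma enorm_sqrD n (x y : 'cV[R]_n) : enorm (x + y) ^+ 2 <= 2 * enorm x ^+ 2 + 2 * enorm y ^+ 2.
Proof.
rewrite !enorm_sqr !mulr_sumr -big_split /=; apply: ler_sum => i _.
by rewrite mxE; have := sqr_ge0 (x i 0 - y i 0); nra.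
Qed.

Lemma enorm_sqrZ n (c : R) (x : 'cV[R]_n) : enorm (c *: x) ^+ 2 = c ^+ 2 * enorm x ^+ 2.
Proof. by rewrite !enorm_sqr mulr_sumr; apply: eq_bigr => i _; rewrite mxE exprMn. Qed.

Lemma mx_cts_enorm_bounded (T : R) n (y : R -> 'cV[R]_n) : 0 <= T -> mx_cts y ->
  exists2 C : R, 0 <= C & forall t, t \in `[0, T] -> enorm (y t) ^+ 2 <= C.
Proof.
move=> T0 cy; have [C C0 hC] := mx_cts_bounded T0 cy.
exists (\sum_(i < n) C ^+ 2); first by rewrite sumr_ge0 // => i _; exact: sqr_ge0.
move=> t tT; rewrite enorm_sqr; apply: ler_sum => i _.
by rewrite -[leLHS]ger0_norm ?sqr_ge0 // normrX lerXn2r ?nnegrE ?(ltW C0) // hC.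
Qed.

Lemma L2_controlP (T : R) m (u : R -> Omega -> 'cV[R]_m) :
  (forall j, pmeasurable T (fun t w => u t w j 0)) ->
  (forall j, pintegrable P T (fun t w => u t w j 0 ^+ 2)) -> L2_control P T u.
Proof.
move=> mu u2; split => //.
have /integrableP[_] := pintegrable_sum u2; apply: le_lt_trans.
rewrite le_eqVlt; apply/orP; left; apply/eqP; apply: eq_integral => z _.
by rewrite enorm_sqr /= ger0_norm // sumr_ge0 // => i _; exact: sqr_ge0.
Qed.

Lemma L2_control_sqr (T : R) m (u : R -> Omega -> 'cV[R]_m) j : L2_control P T u ->
  pintegrable P T (fun t w => u t w j 0 ^+ 2).
Proof.
move=> [mu u2]; apply/integrableP; split.
  by apply/measurable_EFinP; apply: measurable_funX; exact: mu.
apply: le_lt_trans u2; apply: ge0_le_integral.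
- exact: measurable_time_space.
- by move=> z _; exact: abse_ge0.
- by apply: measurableT_comp => //; apply/measurable_EFinP; apply: measurable_funX; exact: mu.
- apply/measurable_EFinP; under eq_fun do rewrite enorm_sqr.
  by apply: measurable_sum => k; apply: measurable_funX; exact: mu.
- move=> z _; rewrite /= lee_fin ger0_norm ?sqr_ge0 //; exact: entry_le_enorm.
Qed.

Variables (T : R) (n m : nat).
Variables (F : set Omega) (y : R -> 'cV[R]_n) (eta : R -> 'cV[R]_m) (th : R).
Hypotheses (T0 : 0 < T) (mF : measurable F) (cy : mx_cts y) (ceta : mx_cts eta).

Let c (w : Omega) : R := th * \1_F w.

Let c_sqr w : c w ^+ 2 <= th ^+ 2.
Proof.
by rewrite /c exprMn ler_piMr ?sqr_ge0 // indicE; case: (w \in F); rewrite ?expr1n ?expr0n.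
Qed.

(** Adding the two-valued path th 1_F y to simple paths gives simple paths,
    with the same uniform errors. *)
Lemma strongly_measurable_perturb (X : R -> Omega -> 'cV[R]_n) :
  strongly_measurable P T X ->
  strongly_measurable P T (fun t w => X t w + (th * \1_F w) *: y t).
Proof.
move=> [Z [sZ cZ]].
exists (fun k w t => Z k w t + c w *: y t); split.
  move=> k; have [finZ mZ ctZ] := sZ k; split.
  - apply: (@sub_finite_set _ _ (range (Z k) `|` [set (fun t =>
    q t + th *: y t) | q in range (Z k)])).
      move=> _ [w _ <-]; rewrite /c indicE; case: (w \in F).
        by right; exists (Z k w); [exists w|rewrite mulr1].
      by left; exists w => //; apply/funext => t; rewrite mulr0 scale0r addr0.
    by rewrite finite_setU; split => //; exact: finite_image.
  - move=> q.
    have -> : (fun w t => Z k w t + c w *: y t) @^-1` [set q] =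
        (F `&` (Z k @^-1` [set (fun t => q t - th *: y t)])) `|` (~` F `&` (Z k @^-1` [set q])).
      apply/seteqP; split => w /=.
        move=> <-; rewrite /c indicE; have [Fw|Fw] := pselect (F w).
          by left; split => //; rewrite mem_set // mulr1; apply/funext => t; rewrite addrK.
        by right; split => //; rewrite memNset // mulr0; apply/funext => t; rewrite scale0r addr0.
      rewrite /c indicE; move=> [[Fw ->]|[Fw <-]].
        by rewrite mem_set // mulr1; apply/funext => t; rewrite subrK.
      by rewrite memNset // mulr0; apply/funext => t; rewrite scale0r addr0.
    by apply: measurableU; apply: measurableI => //; exact: measurableC.
  - move=> w t; apply: cvgD; first exact: ctZ.
    have H : continuous (fun t => c w *: y t).
      by apply: mx_cts_continuous; apply: mx_ctsZ => // s; exact: cvg_cst.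
    exact: (continuous_subspaceT H).
apply: filterS cZ => w /uniform_entries H; apply/uniform_entries => e e0.
apply: filterS (H e e0) => k Hk t tT i; rewrite !mxE opprD addrACA subrr addr0.
exact: Hk.
Qed.

Lemma X2norm_perturb_lty (X : R -> Omega -> 'cV[R]_n) :
  (X2norm P T X < +oo)%E -> (X2norm P T (fun t w => X t w + (th * \1_F w) *: y t)%R < +oo)%E.
Proof.
move=> /X2norm_lty Xfin; apply/X2norm_lty.
have [C C0 hC] := mx_cts_enorm_bounded (ltW T0) cy.
have C20 : 0 <= 2 * (th ^+ 2 * C) by rewrite mulr_ge0 // mulr_ge0 // sqr_ge0.
have := ge0_integral_affine_lty C20 (fun w => sup_sqr_ge0 X w (ltW T0)) Xfin.
apply: le_lt_trans; apply: (@ge0_le_integral_off_null _ _ _ P set0) => //.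
- by move=> w; exact: sup_sqr_ge0 (ltW T0).
- by move=> w; rewrite adde_ge0 ?mule_ge0 ?lee_fin //; exact: sup_sqr_ge0 (ltW T0).
move=> w _; apply/ge_ereal_sup => _ [t tT <-].
apply: (@le_trans _ _ (2%:E * (enorm (X t w) ^+ 2)%:E + (2 * (th ^+ 2 * C))%:E)%E).
  rewrite -EFinM -EFinD lee_fin; apply: (le_trans (enorm_sqrD _ _)).
  rewrite lerD2l ler_pM2l // enorm_sqrZ.
  exact: (ler_pM (sqr_ge0 _) (sqr_ge0 _) (c_sqr w) (hC t tT)).
by rewrite leeD2r // lee_pmul2l //; exact: sup_sqr_ge.
Qed.

Lemma X2norm_perturb_le (C e : R) (X : R -> Omega -> 'cV[R]_n) : 0 <= e ->
  (forall t, t \in `[0, T] -> enorm (y t) ^+ 2 <= C) -> th ^+ 2 * C <= e ^+ 2 ->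
  (X2norm P T (fun t w => X t w + (th * \1_F w) *: y t - X t w)%R <= e%:E)%E.
Proof.
move=> e0 hC Ce.
have -> : (fun t w => X t w + (th * \1_F w) *: y t - X t w) = (fun t w => (th * \1_F w) *: y t).
  by apply/funext => t; apply/funext => w; rewrite addrC addKr.
have C0 : 0 <= C by apply: le_trans (hC 0 _); rewrite ?sqr_ge0 // in_itv /= lexx ltW.
have I0 : (0 <= \int[P]_w sup_sqr T (fun t w => c w *: y t) w)%E.
  by apply: integral_ge0 => w _; exact: sup_sqr_ge0 (ltW T0).
have Ile : (\int[P]_w sup_sqr T (fun t w => c w *: y t) w <= (e ^+ 2)%:E)%E.
  have -> : (e ^+ 2)%:E = (\int[P]_w (cst (e ^+ 2)%:E w))%E.
    by rewrite integral_cst // [X in (_ * X)%E]probability_setT mule1.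
  apply: (@ge0_le_integral_off_null _ _ _ P set0) => //.
  - by move=> w; exact: sup_sqr_ge0 (ltW T0).
  - by move=> w; rewrite lee_fin sqr_ge0.
  move=> w _; apply/ge_ereal_sup => _ [t tT <-]; rewrite lee_fin enorm_sqrZ.
  exact: le_trans (ler_pM (sqr_ge0 _) (sqr_ge0 _) (c_sqr w) (hC t tT)) Ce.
rewrite /X2norm -/(sup_sqr _ _ _).
have -> : e%:E = ((e ^+ 2)%:E `^ 2^-1)%E.
  by rewrite poweR_EFin powR12_sqrt ?sqr_ge0 // sqrtr_sqr ger0_norm.
apply: gt0_ler_poweR => //.
- by rewrite in_itv /= I0 leey.
- by rewrite in_itv /= lee_fin sqr_ge0 leey.
Qed.

Lemma L2_control_perturb (u : R -> Omega -> 'cV[R]_m) : L2_control P T u ->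
  L2_control P T (fun t w => u t w + (th * \1_F w) *: eta t).
Proof.
move=> Lu.
have mc : measurable_fun setT c by apply: measurable_funM => //; exact: measurable_indic_real.
have mu' j : pmeasurable T (fun t w => (u t w + c w *: eta t) j 0).
  rewrite /pmeasurable; under eq_fun do rewrite !mxE.
  apply: measurable_funD; first exact: (Lu.1 j).
  apply: measurable_funM; first exact: (@pmeasurable_chance _ _ _ T c mc).
  exact: (@pmeasurable_time R dO Omega T (fun t => eta t j 0) (ceta (i := j) (j := 0))).
apply: L2_controlP => // j.
have [C C0 hC] := mx_cts_enorm_bounded (ltW T0) ceta.
apply: (le_pintegrable _ _ (pintegrableD (pintegrableZ 2 (L2_control_sqr j Lu)) (pintegrable_cst P
  (2 * (th ^+ 2 * C)) (ltW T0)))).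
  by apply: measurable_funX; exact: mu'.
move=> t w tT; rewrite ger0_norm ?sqr_ge0 // 2!mxE.
have h : (c w * eta t j 0) ^+ 2 <= th ^+ 2 * C.
  rewrite exprMn; apply: (ler_pM (sqr_ge0 _) (sqr_ge0 _) (c_sqr w)).
  by apply: le_trans (hC t tT); exact: entry_le_enorm.
have := sqr_ge0 (u t w j 0 - c w * eta t j 0).
move: h; set q := c w * _; set r := u t w j 0 => h h2.
by nra.
Qed.

(** The control changes only inside ]a, b[ x Omega. The set of change is
    measurable as the set where the sum of the squared entries of the change
    is nonzero. *)
Lemma perturb_support (a b : R) (u : R -> Omega -> 'cV[R]_m) : 0 <= a -> a <= b -> b <= T ->
  (forall t, t \notin `]a, b[ -> eta t = 0) ->
  ((mul \x P) [set z | time_space T z /\ u z.1 z.2 <> (u z.1 z.2 + (th * \1_F z.2) *: eta z.1)%R]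
    <= (b - a)%:E)%E.
Proof.
move=> a0 ab bT eta0.
have mc : measurable_fun setT c by apply: measurable_funM => //; exact: measurable_indic_real.
pose k (z : lebesgueType R * Omega) : R := \sum_j (c z.2 * eta z.1 j 0) ^+ 2.
have mk : measurable_fun (time_space T) k.
  apply: measurable_sum => j; apply: measurable_funX; apply: measurable_funM.
    exact: (@pmeasurable_chance _ _ _ T c mc).
  exact: (@pmeasurable_time R dO Omega T (fun t => eta t j 0) (ceta (i := j) (j := 0))).
have k0 (z : lebesgueType R * Omega) : k z = 0 <-> c z.2 *: eta z.1 = 0.
  split => [/eqP|H].
    rewrite /k psumr_eq0; last by move=> j _; exact: sqr_ge0.
    move=> /allP H; apply/matrixP => i j; rewrite ord1 !mxE.
    by have := H i (mem_index_enum i); rewrite sqrf_eq0 => /eqP.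
  apply: big1 => j _; have : (c z.2 *: eta z.1) j 0 = 0 by rewrite H mxE.
  by rewrite mxE => ->; rewrite expr0n.
have -> : [set z | time_space T z /\ u z.1 z.2 <> (u z.1 z.2 + (th * \1_F z.2) *: eta z.1)%R] =
    time_space T `&` k @^-1` [set~ 0].
  apply/seteqP; split => z /= [zT H]; split => //.
    by move=> /k0 kz; apply: H; rewrite -/(c _) kz addr0.
  by move=> E; apply: H; apply/k0; apply: (@addrI _ (u z.1 z.2)); rewrite addr0 {2}E.
have mS : measurable (time_space T `&` k @^-1` [set~ 0]).
  by apply: mk; [exact: measurable_time_space|exact: measurableC].
have mI : measurable (`]a, b[%classic : set (lebesgueType R)) by exact: measurable_itv_leb.
have mIO : measurable ((`]a, b[%classic : set (lebesgueType R)) `*` [set: Omega]) by exact: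
  measurableX.
have sub : time_space T `&` k @^-1` [set~ 0] `<=` (`]a,
  b[%classic : set (lebesgueType R)) `*` [set: Omega].
  move=> z [_ /= kz]; split => //=; apply: contrapT => /negP zab.
  by apply: kz; apply/k0; rewrite eta0 // scaler0.
apply: (@le_trans _ _ ((mul \x P)%E ((`]a, b[%classic : set (lebesgueType R)) `*` [set: Omega]))).
  by apply: le_measure => //; rewrite inE.
rewrite measure_rect // [X in (_ * X)%E]probability_setT mule1.
have : lebesgue_measure (`]a, b[%classic : set R) = (b - a)%:E.
  rewrite lebesgue_measure_itv /= lte_fin.
  by have [->|ne] := eqVneq a b; rewrite ?ltxx ?subrr // lt_neqAle ne ab EFinB.
by move=> E; rewrite [X in (X <= _)%E]E.
Qed.

End perturbation.

(** * The first variation at a minimizer *)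

Section optimality.
Context {R : realType} {dO : measure_display} {Omega : measurableType dO}.
Variable P : probability Omega R.
Notation mul := (@completed_lebesgue_measure R).
Notation time_space T := (@time_space R dO Omega T).
Notation int0 f t := (\int[mul]_(s in (`[0%R, t] : set (lebesgueType R))) f s).

Lemma admissible_perturb (T : R) n m (A : R -> 'M[R]_n) (B : R -> 'M[R]_(n, m))
    (X0 : Omega -> 'cV[R]_n) (Xs : R -> Omega -> 'cV[R]_n) (us : R -> Omega -> 'cV[R]_m)
    (F : set Omega) (y : R -> 'cV[R]_n) (eta : R -> 'cV[R]_m) (th : R) :
  0 < T -> {within `[0, T], continuous A} -> {within `[0, T], continuous B} ->
  admissible P T A B X0 Xs us -> measurable F -> mx_cts y -> mx_cts eta -> y 0 = 0 ->
  (forall t, t \in `[0, T] -> forall i, y t i 0 =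
     int0 (fun s => (A (clamp T s) *m y s + B (clamp T s) *m eta s) i 0) t) ->
  admissible P T A B X0 (fun t w => Xs t w + (th * \1_F w) *: y t)
    (fun t w => us t w + (th * \1_F w) *: eta t).
Proof.
move=> T0 cA cB adm mF cy ceta y0 yE.
have [N [X [u [[mN N0] LX [mu u2] [Xc XE] NE]]]] := regular_version T0 adm.
have [[ctX smX X2X] Lu sol ini] := adm.
have cAc := within_mx_cts_clamp T0 cA; have cBc := within_mx_cts_clamp T0 cB.
split.
- split.
  + apply: filterS ctX => w cw t; apply: cvgD; first exact: cw.
    have H : continuous (fun t => (th * \1_F w) *: y t).
      by apply: mx_cts_continuous; apply: mx_ctsZ => // s; exact: cvg_cst.
    exact: (continuous_subspaceT H).
  + exact: strongly_measurable_perturb.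
  + exact: X2norm_perturb_lty.
- exact: L2_control_perturb.
- have Xi i : pintegrable P T (fun t w => X t w i 0).
    apply: pintegrable_sqr_int; [exact: ltW|exact: (L2_process_pmeasurable LX)|].
    exact: L2_process_pintegrable_sqr (ltW T0) LX.
  have ui i : pintegrable P T (fun t w => u t w i 0) by apply: pintegrable_sqr_int => //;
    exact: ltW.
  have Gi i : pintegrable P T (fun t w => (A (clamp T t) *m X t w + B (clamp T t) *m u t w) i 0).
    apply: (@eq_pintegrable _ _ _ P T (fun t w =>
      (row i (A (clamp T t)) *m X t w) 0 0 + (row i (B (clamp T t)) *m u t w) 0 0)).
      by move=> t w _; rewrite -!row_mul !mxE.
    by apply: pintegrableD; apply: pintegrable_row; try exact: ltW; try exact: mx_cts_row.
  have aeG : {ae P, forall w, forall i, mul.-integrable (`[0%R, T] : set (lebesgueType R))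
      (EFin \o (fun t => (A (clamp T t) *m X t w + B (clamp T t) *m u t w) i 0))}.
    by apply: filter_forall => i; exact: pintegrable_ae_w.
  have aeN : {ae P, forall w, ~ N w}.
    by exists N; split => // w /= /contrapT.
  apply: filterS3 sol aeG aeN => w sw Gw Nw t tT.
  have sub s : s \in `[0, t] -> s \in `[0, T].
    by move: tT; rewrite !in_itv /= => /andP[_ tT] /andP[-> st]; exact: le_trans tT.
  rewrite y0 scaler0 addr0 (sw t tT) -addrA; congr (_ + _).
  apply/matrixP => i j; rewrite ord1 !mxE yE //.
  have GI : mul.-integrable (`[0%R, t] : set (lebesgueType R))
      (EFin \o (fun t => (A (clamp T t) *m X t w + B (clamp T t) *m u t w) i 0)).
    apply: integrableS (Gw i); [exact: measurable_itv_leb|exact: measurable_itv_leb|].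
    by move=> s /=; exact: sub.
  have yI : mul.-integrable (`[0%R, t] : set (lebesgueType R))
      (EFin \o (fun s => (A (clamp T s) *m y s + B (clamp T s) *m eta s) i 0)).
    have cr : mx_cts (fun s => A (clamp T s) *m y s + B (clamp T s) *m eta s).
      by apply: mx_ctsD; exact: mx_ctsM.
    by apply: continuous_integrable_leb; exact: cr.
  have mI := measurable_itv_leb `[0, t].
  transitivity (int0 (fun s => (A (clamp T s) *m X s w + B (clamp T s) *m u s w) i 0) t +
     (th * \1_F w) * int0 (fun s => (A (clamp T s) *m y s + B (clamp T s) *m eta s) i 0) t).
    congr (_ + _); apply: eq_Rintegral => s; rewrite inE /= => /sub sT.
    by have [-> ->] := NE w s Nw sT; rewrite clamp_id.
  rewrite -(RintegralZl _ mI yI) -(RintegralD mI GI); last exact: (integrableZ_real mI _ yI).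
  apply: eq_Rintegral => s; rewrite inE /= => /sub sT.
  have [-> ->] := NE w s Nw sT; rewrite clamp_id //.
  by rewrite !mulmxDr -!scalemxAr !mxE; ring.
- by apply: filterS ini => w ->; rewrite y0 scaler0 addr0.
Qed.

(** Taking th = s and th = - s gives |L| <= s |c| for every small s > 0. *)
Lemma linear_term_eq0 (d L c : R) : 0 < d ->
  (forall th, `|th| <= d -> 0 <= th * L + th ^+ 2 * c) -> L = 0.
Proof.
move=> d0 H; apply/eqP; rewrite -normr_eq0; apply/negPn/negP => L0.
have {}L0 : 0 < `|L| by rewrite lt_neqAle eq_sym L0 normr_ge0.
have bnd s : 0 < s -> s <= d -> `|L| <= s * `|c|.
  move=> s0 sd.
  have h1 := H s; have h2 := H (- s).
  rewrite normrN (ger0_norm (ltW s0)) in h1 h2; move/(_ sd) in h1; move/(_ sd) in h2.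
  have h3 : s * `|L| <= s * (s * `|c|).
    rewrite -[X in X * `|L|](ger0_norm (ltW s0)) -normrM ler_norml.
    have h4 : s ^+ 2 * c <= s * (s * `|c|).
      by rewrite mulrA -expr2 ler_wpM2l ?sqr_ge0 // ler_norm.
    rewrite sqrrN mulNr in h2; apply/andP; split; lra.
  by rewrite ler_pM2l in h3.
have C0 : 0 < 2 * (`|c| + 1) by rewrite mulr_gt0 // ltr_wpDl.
(* for this s the bound reads |L| <= s |c| < |L| unless L = 0 *)
pose s := Num.min d (`|L| / (2 * (`|c| + 1))).
have s0 : 0 < s by rewrite lt_min d0 divr_gt0.
have sd : s <= d by rewrite ge_min lexx.
have sL : s <= `|L| / (2 * (`|c| + 1)) by rewrite ge_min lexx orbT.
have h := bnd s s0 sd.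
have h5 : s * (2 * (`|c| + 1)) <= `|L| by rewrite -ler_pdivlMr.
have := normr_ge0 c; nra.
Qed.

Section minimizer.
Variables (T : R) (n m : nat) (A : R -> 'M[R]_n) (B : R -> 'M[R]_(n, m)) (Ru : R -> 'M[R]_m)
  (Qx Qm : R -> 'M[R]_n) (Kx Km : 'M[R]_n)
  (X0 : Omega -> 'cV[R]_n) (Xs : R -> Omega -> 'cV[R]_n) (us : R -> Omega -> 'cV[R]_m).
Hypotheses (T0 : 0 < T) (cA : {within `[0, T], continuous A}) (cB : {within `[0, T], continuous B})
  (cRu : {within `[0, T], continuous Ru}) (cQx : {within `[0, T], continuous Qx})
  (cQm : {within `[0, T], continuous Qm})
  (symRu : forall t, t \in `[0, T] -> (Ru t)^T = Ru t)
  (symQx : forall t, t \in `[0, T] -> (Qx t)^T = Qx t)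
  (symQm : forall t, t \in `[0, T] -> (Qm t)^T = Qm t)
  (symKx : Kx^T = Kx) (symKm : Km^T = Km).
Variable e : R.
Hypotheses (e0 : 0 < e) (adm : admissible P T A B X0 Xs us).
Hypothesis min : forall X u, admissible P T A B X0 X u ->
  (X2norm P T (fun t w => X t w - Xs t w)%R <= e%:E)%E ->
  ((mul \x P) [set z | time_space T z /\ us z.1 z.2 <> u z.1 z.2] <= e%:E)%E ->
  cost P T Qx Qm Kx Km Ru Xs us <= cost P T Qx Qm Kx Km Ru X u.
Variables (N : set Omega) (X : R -> Omega -> 'cV[R]_n) (u : R -> Omega -> 'cV[R]_m).
Hypotheses (mN : measurable N) (N0 : P N = 0%E) (LX : L2_process P T X)
  (mu : forall j, pmeasurable T (fun t w => u t w j 0))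
  (u2 : forall j, pintegrable P T (fun t w => u t w j 0 ^+ 2))
  (cm : mx_cts (mean_on P setT X))
  (XE : forall w t, ~ N w -> t \in `[0, T] -> X t w = Xs t w /\ u t w = us t w).

(** If C bounds |y|^2, the perturbation of size th moves the state by at most
    e in the norm of X^2 when |th| <= e / (C + 1), and changes the control on
    a set of measure at most b - a <= e. The cost of these competitors is a
    quadratic polynomial in th with its minimum at 0. *)
Lemma first_variation_eq0 (F : set Omega) (eta : R -> 'cV[R]_m) (y : R -> 'cV[R]_n) (a b : R) :
  measurable F -> mx_cts eta -> mx_cts y -> 0 <= a -> a <= b -> b <= T -> b - a <= e ->
  (forall t, t \notin `]a, b[ -> eta t = 0) -> y 0 = 0 ->
  (forall t, t \in `[0, T] -> forall i, y t i 0 =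
     int0 (fun s => (A (clamp T s) *m y s + B (clamp T s) *m eta s) i 0) t) ->
  first_variation P T (fun t => Qx (clamp T t)) (fun t => Qm (clamp T t)) Kx Km
    (fun t => Ru (clamp T t)) X u F y eta = 0.
Proof.
move=> mF ceta cy a0 ab bT bae eta0 y0 yE.
have [c0 [c2 JE]] := cost_expansion T0 (within_mx_cts_clamp T0 cQx) (within_mx_cts_clamp T0 cQm)
  (within_mx_cts_clamp T0 cRu) mF cy ceta
  (fun t _ => symQx (clamp_in t T0)) (fun t _ => symQm (clamp_in t T0))
  (fun t _ => symRu (clamp_in t T0)) symKx symKm LX mu u2 cm.
have costE th : cost P T Qx Qm Kx Km Ru (fun t w => Xs t w + (th * \1_F w) *: y t)
    (fun t w => us t w + (th * \1_F w) *: eta t) =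
  c0 + th * first_variation P T (fun t => Qx (clamp T t)) (fun t => Qm (clamp T t)) Kx Km
    (fun t => Ru (clamp T t)) X u F y eta + th ^+ 2 * c2.
  rewrite -JE; apply: (cost_off_null _ _ (ltW T0) mN N0).
    by move=> t tT; rewrite !clamp_id.
  by move=> w t Nw tT; have [-> ->] := XE Nw tT.
have cost0 : cost P T Qx Qm Kx Km Ru Xs us = c0.
  have := costE 0.
  have -> : (fun t w => Xs t w + (0 * \1_F w) *: y t) = Xs.
    by apply/funext => t; apply/funext => w; rewrite mul0r scale0r addr0.
  have -> : (fun t w => us t w + (0 * \1_F w) *: eta t) = us.
    by apply/funext => t; apply/funext => w; rewrite mul0r scale0r addr0.
  by move=> ->; rewrite mul0r addr0 expr0n mul0r addr0.
have [C C0 hC] := mx_cts_enorm_bounded (ltW T0) cy.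
have C10 : 0 < C + 1 by rewrite ltr_wpDl.
apply: (@linear_term_eq0 (e / (C + 1)) _ c2); first by rewrite divr_gt0.
move=> th hth.
(* C <= (C + 1)^2 *)
have thC : th ^+ 2 * C <= e ^+ 2.
  have h1 : `|th| * (C + 1) <= e by rewrite -ler_pdivlMr.
  have h2 : (`|th| * (C + 1)) ^+ 2 <= e ^+ 2.
    by rewrite lerXn2r ?nnegrE ?(ltW e0) // mulr_ge0 // ltW.
  apply: le_trans h2; rewrite exprMn real_normK ?num_real // ler_wpM2l ?sqr_ge0 //; nra.
have dX : (X2norm P T (fun t w => Xs t w + (th * \1_F w) *: y t - Xs t w)%R <= e%:E)%E.
  by apply: X2norm_perturb_le hC thC => //; exact: ltW.
have := min (admissible_perturb th T0 cA cB adm mF cy ceta y0 yE) dX.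
move=> /(_ (le_trans (perturb_support P th mF ceta us a0 ab bT eta0) _)).
by rewrite lee_fin => /(_ bae); rewrite costE cost0 -addrA lerDl.
Qed.

End minimizer.
End optimality.

(** * The feedback law *)

Section feedback_law.
Context {R : realType} {dO : measure_display} {Omega : measurableType dO}.
Variable P : probability Omega R.
Notation mul := (@completed_lebesgue_measure R).
Notation time_space T := (@time_space R dO Omega T).
Notation int0 f t := (\int[mul]_(s in (`[0%R, t] : set (lebesgueType R))) f s).

Lemma riccati_clamp (T : R) n m (A : R -> 'M[R]_n) (B : R -> 'M[R]_(n, m)) (Ru : R -> 'M[R]_m)
    (Q : R -> 'M[R]_n) (K : 'M[R]_n) (Pi : R -> 'M[R]_n) : 0 < T ->
  riccati_solution T A B Ru Q K Pi ->
  forall t, t \in `]0, T[ -> mx_derive (fun t => Pi (clamp T t)) t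
    (- (Pi (clamp T t) *m A (clamp T t)) - (A (clamp T t))^T *m Pi (clamp T t)
     + Pi (clamp T t) *m B (clamp T t) *m invmx (Ru (clamp T t)) *m (B (clamp T t))^T *m Pi (clamp
       T t)
     - Q (clamp T t)).
Proof.
move=> T0 [_ dPi _] t tT i j; rewrite clamp_id; last exact: subset_itv_oo_cc.
apply: near_eq_is_derive (mx_derive_is_derive (dPi t tT) i j).
near=> s; rewrite clamp_id //; apply: subset_itv_oo_cc; near: s; exact: near_in_itvoo.
Unshelve. all: by end_near. Qed.

Lemma terminal_combination n (y : 'rV[R]_n) (Q1 Q2 : 'M[R]_n) (v w : 'cV[R]_n) (p : R) :
  (y *m (Q1 + Q2) *m (v - p *: w)) 0 0 =
  (y *m Q1 *m v) 0 0 + (- p) * (y *m Q1 *m w) 0 0 + (y *m Q2 *m (v - p *: w)) 0 0.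
Proof.
rewrite (mulmxDr y) mulmxDl.
move: (y *m Q2 *m _) => z; rewrite mulmxBr -scalemxAr.
by move: (y *m Q1 *m v) (y *m Q1 *m w) => a b; rewrite !mxE mulNr.
Qed.

Lemma stationarity_combination n m (y : 'rV[R]_n) (eta : 'rV[R]_m) (Q1 Q2 : 'M[R]_n)
    (v w : 'cV[R]_n) (a b : 'cV[R]_m) (p : R) :
  (y *m (Q1 + Q2) *m (v - p *: w) + eta *m (a - p *: b)) 0 0 =
  ((y *m Q1 *m v) 0 0 + (eta *m a) 0 0) + (- p) * ((y *m Q1 *m w) 0 0 + (eta *m b) 0 0)
  + 1 * (y *m Q2 *m (v - p *: w)) 0 0.
Proof.
rewrite mxE terminal_combination; move: ((y *m Q2 *m _) 0 0) => z.
rewrite mulmxBr -scalemxAr; move: (eta *m a) (eta *m b) => c d.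
by rewrite [X in _ + X]mxE [X in _ + (_ + X)]mxE [X in _ + (_ - X)]mxE; ring.
Qed.

Variables (T e : R) (n m : nat) (A : R -> 'M[R]_n) (B : R -> 'M[R]_(n, m)) (Ru : R -> 'M[R]_m)
  (Qx Qm : R -> 'M[R]_n) (Kx Km : 'M[R]_n) (P1 P2 : R -> 'M[R]_n)
  (X : R -> Omega -> 'cV[R]_n) (u : R -> Omega -> 'cV[R]_m).
Hypotheses (T0 : 0 < T) (e0 : 0 < e) (cA : {within `[0, T], continuous A})
  (cB : {within `[0, T], continuous B})
  (cRu : {within `[0, T], continuous Ru}) (cQx : {within `[0, T], continuous Qx})
  (cQm : {within `[0, T], continuous Qm})
  (posRu : forall t, t \in `[0, T] -> posdef (Ru t))
  (hP1 : riccati_solution T A B Ru (fun t => Qx t + Qm t) (Kx + Km) P1)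
  (hP2 : riccati_solution T A B Ru Qx Kx P2).
Hypotheses (LX : L2_process P T X) (Xc : forall t w, X t w = X (clamp T t) w)
  (mu : forall j, pmeasurable T (fun t w => u t w j 0))
  (u2 : forall j, pintegrable P T (fun t w => u t w j 0 ^+ 2))
  (XE : forall w t, t \in `[0, T] -> forall i, X t w i 0 = X 0 w i 0 +
        int0 (fun s => (A (clamp T s) *m X s w + B (clamp T s) *m u s w) i 0) t).
Hypothesis stat : forall (F : set Omega) (eta : R -> 'cV[R]_m) (y : R -> 'cV[R]_n) (a b : R),
  measurable F -> mx_cts eta -> mx_cts y -> 0 <= a -> a <= b -> b <= T -> b - a <= e ->
  (forall t, t \notin `]a, b[ -> eta t = 0) -> y 0 = 0 ->
  (forall t, t \in `[0, T] -> forall i, y t i 0 =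
     int0 (fun s => (A (clamp T s) *m y s + B (clamp T s) *m eta s) i 0) t) ->
  first_variation P T (fun t => Qx (clamp T t)) (fun t => Qm (clamp T t)) Kx Km
    (fun t => Ru (clamp T t)) X u F y eta = 0.

Notation Ac := (fun t => A (clamp T t)).
Notation Bc := (fun t => B (clamp T t)).
Notation Sc := (fun t => Ru (clamp T t)).
Notation Si := (fun t => invmx (Ru (clamp T t))).
Notation Qxc := (fun t => Qx (clamp T t)).
Notation Qmc := (fun t => Qm (clamp T t)).
Notation P1c := (fun t => P1 (clamp T t)).
Notation P2c := (fun t => P2 (clamp T t)).
Notation mX := (mean_on P setT X).
Notation mu_ := (mean_on P setT u).

Let T0' : 0 <= T := ltW T0.
Let tT : T \in `[0, T]. Proof. by rewrite in_itv /= lexx T0'. Qed.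
Let t0T : 0 \in `[0, T]. Proof. by rewrite in_itv /= lexx T0'. Qed.
Let cAc := within_mx_cts_clamp T0 cA.
Let cBc := within_mx_cts_clamp T0 cB.
Let cSc := within_mx_cts_clamp T0 cRu.
Let cQxc := within_mx_cts_clamp T0 cQx.
Let cQmc := within_mx_cts_clamp T0 cQm.
Let Ru_unit t : Ru (clamp T t) \in unitmx.
Proof. by apply: posdef_unitmx; apply: posRu; exact: clamp_in. Qed.
Let cSi : mx_cts Si. Proof. exact: mx_cts_invmx. Qed.
Let SiS t : t \in `[0, T] -> Si t *m Sc t = 1%:M.
Proof. by move=> _; rewrite mulVmx. Qed.
Let cP1 : mx_cts P1c. Proof. by have [c1 _ _] := hP1; exact: within_mx_cts_clamp. Qed.
Let cP2 : mx_cts P2c. Proof. by have [c1 _ _] := hP2; exact: within_mx_cts_clamp. Qed.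

Let Xi i : pintegrable P T (fun t w => X t w i 0).
Proof. by apply: pintegrable_sqr_int => //;
  [exact: (L2_process_pmeasurable LX)|exact: L2_process_pintegrable_sqr LX]. Qed.
Let ui i : pintegrable P T (fun t w => u t w i 0).
Proof. exact: pintegrable_sqr_int. Qed.
Let X0i i : P.-integrable setT (EFin \o (fun w => X 0 w i 0)).
Proof. exact: L2_process_int LX t0T. Qed.
Let cF F : measurable F -> mx_cts (mean_on P F X).
Proof. by move=> mF; exact: (@mean_on_mx_cts _ _ _ P n m T Ac Bc X u F). Qed.
Let centered_mean_on_mx_cts F : measurable F -> mx_cts (centered_mean_on P F X).
Proof.
move=> mF; apply: mx_ctsD; first exact: cF.
by apply: mx_ctsN; apply: mx_ctsZ; [move=> s; exact: cvg_cst|exact: cF].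
Qed.
Let dynF F t i : measurable F -> t \in `[0, T] ->
  mean_on P F X t i 0 = mean_on P F X 0 i 0 +
    int0 (fun s => (Ac s *m mean_on P F X s + Bc s *m mean_on P F u s) i 0) t.
Proof. by move=> mF; exact: mean_on_dynamics. Qed.
Let uF F j : measurable F ->
  mul.-integrable (`[0%R, T] : set (lebesgueType R)) (EFin \o (fun t => mean_on P F u t j 0)).
Proof. by move=> mF; exact: mean_on_integrable. Qed.
Let XF F j : measurable F ->
  mul.-integrable (`[0%R, T] : set (lebesgueType R)) (EFin \o (fun t => mean_on P F X t j 0)).
Proof. by move=> mF; exact: mean_on_integrable. Qed.

Let prT : prob P setT = 1.
Proof.
rewrite /prob; transitivity (\int[P]_w (1 : R)).
  by apply: eq_Rintegral => w _; rewrite indicE in_setT.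
by rewrite Rintegral_cst // mul1r; have : fine (P [set: Omega]) = 1 by rewrite probability_setT.
Qed.

Let cvmT t : centered_mean_on P setT X t = 0.
Proof. by rewrite /centered_mean_on prT scale1r subrr. Qed.

(** For the sure event the centered mean is 0, so the first variation is that
    of the deterministic problem with weights Qx and Kx. *)
Lemma mean_feedback t j : t \in `[0, T] ->
  int0 (fun s => (mu_ s + Si s *m (Bc s)^T *m P2c s *m mX s) j 0) t = 0.
Proof.
apply: (@stationary_feedback R n m T e Ac Bc Sc Si Qxc Kx P2c mX mu_) => //.
- exact: cF.
- by move=> k; exact: uF.
- by move=> s sT i; exact: dynF.
- move=> eta y a b ceta cy a0 ab bT bae eta0 y0 yE.
  have FV := stat measurableT ceta cy a0 ab bT bae eta0 y0 yE.
  have Z2 : ((y T)^T *m Km *m centered_mean_on P setT X T) 0 0 = 0 by rewrite cvmT mulmx0 mxE.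
  have Z1 : int0 (fun s => ((y s)^T *m Qmc s *m centered_mean_on P setT X s) 0 0) T = 0.
    transitivity (int0 (fun=> 0 : R) T); last by rewrite Rintegral_leb_cst // mul0r.
    by apply: eq_Rintegral => s _; rewrite cvmT mulmx0 mxE.
  rewrite /first_variation Z1 Z2 !addr0 in FV; rewrite -[RHS]FV; congr (_ + _).
  by apply: eq_Rintegral => s _; rewrite mxE.
- by move=> s sT; exact: riccati_clamp hP2 _ sT.
- by have [_ _ P2T] := hP2; rewrite clamp_id.
Qed.

Let rhsE F s i : (Ac s *m mean_on P F X s + Bc s *m mean_on P F u s) i 0 =
  (row i (Ac s) *m mean_on P F X s) 0 0 + (row i (Bc s) *m mean_on P F u s) 0 0.
Proof. by rewrite -!row_mul !mxE. Qed.

Let rhs_int F t i : measurable F -> t \in `[0, T] ->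
  mul.-integrable (`[0%R, t] : set (lebesgueType R))
    (EFin \o (fun s => (Ac s *m mean_on P F X s + Bc s *m mean_on P F u s) i 0)).
Proof.
move=> mF t01; apply: (@integrableS _ (lebesgueType R) R mul `[0%R, T]).
- exact: measurable_itv_leb.
- exact: measurable_itv_leb.
- by move=> s /=; move: t01; rewrite !in_itv /= => /andP[_ tT'] /andP[-> st]; exact: le_trans tT'.
rewrite (_ : (fun s => _) = (fun s =>
  (row i (Ac s) *m mean_on P F X s) 0 0 + (row i (Bc s) *m mean_on P F u s) 0 0)); last first.
  by apply/funext => s; exact: rhsE.
apply: (@integrableD_real _ (lebesgueType R)); first exact: measurable_itv_leb.
  by apply: integrable_mx_cts_rowM => //; [exact: mx_cts_row|move=> k; exact: XF].
by apply: integrable_mx_cts_rowM => //; [exact: mx_cts_row|move=> k; exact: uF].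
Qed.

(** The first variation for F minus P(F) times the one for the sure event: in
    the difference the variance weights act on the same vector E[1_F (X - E
    X)] as Qx and Kx do. *)
Lemma centered_feedback F t j : measurable F -> t \in `[0, T] ->
  int0 (fun s => ((mean_on P F u s - prob P F *: mu_ s) +
     Si s *m (Bc s)^T *m P1c s *m centered_mean_on P F X s) j 0) t = 0.
Proof.
move=> mF.
apply: (@stationary_feedback R n m T e Ac Bc Sc Si (fun t => Qxc t + Qmc t) (Kx + Km) P1c
  (centered_mean_on P F X) (fun s => mean_on P F u s - prob P F *: mu_ s)) => //.
- exact: mx_ctsD.
- exact: centered_mean_on_mx_cts.
- move=> k.
  rewrite (_ : (fun s => _) = (fun s => mean_on P F u s k 0 + (- prob P F) * mu_ s k 0));
    last first.
    by apply/funext => s; rewrite !mxE mulNr.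
  apply: (@integrableD_real _ (lebesgueType R)); first exact: measurable_itv_leb.
    exact: uF.
  by apply: (@integrableZ_real _ (lebesgueType R)); [exact: measurable_itv_leb|exact: uF].
- move=> s sT i; have mI := measurable_itv_leb `[0, s].
  have iF := rhs_int i mF sT; have iT := rhs_int i measurableT sT.
  have cvE r : centered_mean_on P F X r i 0 = mean_on P F X r i 0 + (- prob P F) * mX r i 0.
    by rewrite /centered_mean_on; move: (mean_on P F X r) (mX r) => v1 v2; rewrite !mxE mulNr.
  rewrite !cvE (dynF i mF sT) (dynF i measurableT sT) mulrDr addrACA; congr (_ + _).
  rewrite -(RintegralZl _ mI iT) -(RintegralD mI iF (integrableZ_real mI _ iT)).
  apply: eq_Rintegral => r _; rewrite /centered_mean_on.
  move: (mean_on P F X r) (mX r) (mean_on P F u r) (mu_ r) => v1 v2 w1 w2.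
  by rewrite !mulmxBr -!scalemxAr !mxE; ring.
- move=> eta y a b ceta cy a0 ab bT bae eta0 y0 yE.
  have FV := stat mF ceta cy a0 ab bT bae eta0 y0 yE.
  have FVT := stat measurableT ceta cy a0 ab bT bae eta0 y0 yE.
  have mI := measurable_itv_leb `[0, T].
  have Z2 : ((y T)^T *m Km *m centered_mean_on P setT X T) 0 0 = 0 by rewrite cvmT mulmx0 mxE.
  have Z1 : int0 (fun s => ((y s)^T *m Qmc s *m centered_mean_on P setT X s) 0 0) T = 0.
    transitivity (int0 (fun=> 0 : R) T); last by rewrite Rintegral_leb_cst // mul0r.
    by apply: eq_Rintegral => s _; rewrite cvmT mulmx0 mxE.
  rewrite /first_variation Z1 Z2 !addr0 in FVT.
  rewrite /first_variation in FV.
  pose f G s := ((y s)^T *m Qxc s *m mean_on P G X s) 0 0 +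
    ((eta s)^T *m Sc s *m mean_on P G u s) 0 0.
  pose h s := ((y s)^T *m Qmc s *m centered_mean_on P F X s) 0 0.
  have fi G : measurable G -> mul.-integrable (`[0%R, T] : set (lebesgueType R)) (EFin \o f G).
    move=> mG; apply: (@integrableD_real _ (lebesgueType R)) => //.
      by apply: integrable_mx_cts_rowM => //; [apply: mx_ctsM => //; exact: mx_ctsT|move=> k;
        exact: XF].
    by apply: integrable_mx_cts_rowM => //; [apply: mx_ctsM => //; exact: mx_ctsT|move=> k;
      exact: uF].
  have ccv := centered_mean_on_mx_cts mF.
  have hi : mul.-integrable (`[0%R, T] : set (lebesgueType R)) (EFin \o h).
    have ch : mx_cts (fun s => (y s)^T *m Qmc s *m centered_mean_on P F X s).
      by apply: mx_ctsM => //; apply: mx_ctsM => //; exact: mx_ctsT.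
    by apply: continuous_integrable_leb; exact: ch.
  have -> : int0 (fun s => ((y s)^T *m (Qxc s + Qmc s) *m centered_mean_on P F X s +
      (eta s)^T *m Sc s *m (mean_on P F u s - prob P F *: mu_ s)) 0 0) T =
      int0 (f F) T + (- prob P F) * int0 (f setT) T + 1 * int0 h T.
    rewrite -(Rintegral_affine mI (- prob P F) 1 (fi F mF) (fi setT measurableT) hi).
    by apply: eq_Rintegral => s _; rewrite /f /h /centered_mean_on stationarity_combination.
  have -> : ((y T)^T *m (Kx + Km) *m centered_mean_on P F X T) 0 0 =
     ((y T)^T *m Kx *m mean_on P F X T) 0 0 + (- prob P F) * ((y T)^T *m Kx *m mX T) 0 0
      + ((y T)^T *m Km *m centered_mean_on P F X T) 0 0.
    by rewrite /centered_mean_on terminal_combination.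
  have combine (i1 k1 i2 k2 i3 k3 p : R) : i1 + k1 + i2 + k2 = 0 -> i3 + k3 = 0 ->
      i1 + - p * i3 + 1 * i2 + (k1 + - p * k3 + k2) = 0.
    move=> h1 h2; transitivity ((i1 + k1 + i2 + k2) - p * (i3 + k3)); first by ring.
    by rewrite h1 h2 mulr0 subr0.
  exact: combine FV FVT.
- by move=> s sT; exact: riccati_clamp hP1 _ sT.
- by have [_ _ P1T] := hP1; rewrite clamp_id.
Qed.

(** The mean over F of the residual is the sum of the residual of the centered
    law and P(F) times the residual of the law for the mean, so its primitives
    vanish. *)
Lemma feedback_residual_entry j : {ae (mul \x P)%E, forall z : lebesgueType R * Omega,
  time_space T z ->
  (u z.1 z.2 + Si z.1 *m (Bc z.1)^T *m (P1c z.1 *m (X z.1 z.2 - mX z.1) +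
    P2c z.1 *m mX z.1)) j 0 = 0}.
Proof.
pose K1 t := Si t *m (Bc t)^T *m P1c t; pose K2 t := Si t *m (Bc t)^T *m P2c t.
have cK1 : mx_cts K1 by apply: mx_ctsM => //; apply: mx_ctsM => //; exact: mx_ctsT.
have cK2 : mx_cts K2 by apply: mx_ctsM => //; apply: mx_ctsM => //; exact: mx_ctsT.
pose q t := ((K2 t - K1 t) *m mX t) j 0.
have cq : continuous q.
  have H : mx_cts (fun t => (K2 t - K1 t) *m mX t).
    by apply: mx_ctsM; [apply: mx_ctsD => //; exact: mx_ctsN|exact: cF].
  exact: (H j 0).
pose r t w := (row j (K1 t) *m X t w) 0 0 + (row j 1%:M *m u t w) 0 0.
have gE t w : (u t w + Si t *m (Bc t)^T *m (P1c t *m (X t w - mX t) + P2c t *m mX t)) j 0 =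
  r t w + q t * 1.
  rewrite /r /q mulr1 -!row_mul mul1mx mulmxDr !mulmxA -/(K1 t) -/(K2 t).
  by move: (X t w) (mX t) (u t w) (K1 t) (K2 t) => x c v k1 k2; rewrite mulmxBr mulmxBl !mxE; ring.
have c1 : mx_cts (fun=> row j (1%:M : 'M[R]_m)) by move=> k l s; exact: cvg_cst.
have ri : pintegrable P T r by apply: pintegrableD; apply: pintegrable_row => //; exact: mx_cts_row.
have qi : pintegrable P T (fun t w => q t * 1) by apply: pintegrable_time => //;
  exact: pintegrable_cst.
have gi := pintegrableD ri qi.
have rF F t : measurable F -> t \in `[0, T] ->
    int0 (fun s => \int[P]_w (\1_F w * (r s w + q s * 1))) t = 0.
  move=> mF t01; have /andP[t0 t1] : (0 <= t) && (t <= T) by move: t01; rewrite in_itv.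
  have mI := measurable_itv_leb `[0, t].
  have sub (f : R -> R) : mul.-integrable (`[0%R, T] : set (lebesgueType R)) (EFin \o f) ->
      mul.-integrable (`[0%R, t] : set (lebesgueType R)) (EFin \o f).
    apply: integrableS; [exact: measurable_itv_leb|exact: mI|].
    by move=> s /=; rewrite !in_itv /= => /andP[-> st]; exact: le_trans t1.
  rewrite -(pintegrable_swap (pintegrableS t1 (pintegrable_indic mF gi))).
  have ri' := pintegrable_indic mF (pintegrableS t1 ri);
    have qi' := pintegrable_indic mF (pintegrableS t1 qi).
  transitivity (pintegral P t (fun s w =>
    \1_F w * r s w + 1 * (\1_F w * (q s * 1)) + 0 * (\1_F w * (q s * 1)))).
    apply: eq_Rintegral => w _; apply: eq_Rintegral => s _.
    by rewrite mul0r addr0 mul1r mulrDr.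
  rewrite (pintegral_affine 1 0 ri' qi' qi') mul0r addr0 mul1r.
  have -> : pintegral P t (fun s w => \1_F w * r s w) =
      int0 (fun s => (row j (K1 s) *m mean_on P F X s) 0 0 + (row j 1%:M *m mean_on P F u s) 0 0) t.
    by apply: pintegrable_swap_rows => //; [exact: mx_cts_row|move=> i;
      exact: pintegrableS t1 (Xi i)|move=> i; exact: pintegrableS t1 (ui i)].
  have -> : pintegral P t (fun s w => \1_F w * (q s * 1)) = int0 (fun s => prob P F * q s) t.
    rewrite /pintegral (pintegrable_swap qi'); apply: eq_Rintegral => s _.
    transitivity (\int[P]_w (q s * \1_F w)).
      by apply: eq_Rintegral => w _; rewrite mulr1 mulrC.
    rewrite RintegralZl //; first by rewrite mulrC.
    exact: integrable_indic_real.
  have := mean_feedback j t01; have := centered_feedback j mF t01.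
  move=> hc hm; have vF := sub _ (uF j mF); have v1 := sub _ (uF j measurableT).
  have icont (f : R -> R) : continuous f ->
      mul.-integrable (`[0%R, t] : set (lebesgueType R)) (EFin \o f).
    exact: continuous_integrable_leb.
  have i1 : mul.-integrable (`[0%R, t] : set (lebesgueType R))
      (EFin \o (fun s => (K1 s *m centered_mean_on P F X s) j 0)).
    have H : mx_cts (fun s => K1 s *m centered_mean_on P F X s).
      by apply: mx_ctsM => //; exact: centered_mean_on_mx_cts.
    by apply: icont; exact: (H j 0).
  have i2 : mul.-integrable (`[0%R, t] : set (lebesgueType R))
      (EFin \o (fun s => (K2 s *m mX s) j 0)).
    have H : mx_cts (fun s => K2 s *m mX s) by apply: mx_ctsM => //; exact: cF.
    by apply: icont; exact: (H j 0).
  have iq : mul.-integrable (`[0%R, t] : set (lebesgueType R)) (EFin \o (fun s => prob P F * q s)).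
    by apply: (integrableZ_real mI); exact: icont.
  have ir : mul.-integrable (`[0%R, t] : set (lebesgueType R))
      (EFin \o (fun s => (row j (K1 s) *m mean_on P F X s) 0 0 +
        (row j 1%:M *m mean_on P F u s) 0 0)).
    apply: (integrableD_real mI); apply: sub; apply: integrable_mx_cts_rowM => //;
      [exact: mx_cts_row|by move=> k; exact: XF|by move=> k; exact: uF].
  rewrite -(RintegralD mI ir iq).
  transitivity (int0 (fun s => mean_on P F u s j 0 + prob P F * (K2 s *m mX s) j 0
      + 1 * (K1 s *m centered_mean_on P F X s) j 0) t).
    apply: eq_Rintegral => s _; rewrite -!row_mul mul1mx /q /centered_mean_on.
    move: (mean_on P F X s) (mX s) (mean_on P F u s) (K1 s) (K2 s) => x c v k1 k2.
    by rewrite mulmxBl mulmxBr -scalemxAr !mxE; ring.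
  rewrite (Rintegral_affine mI _ _ vF i2 i1).
  move: hm hc.
  have -> : int0 (fun s => (mu_ s + Si s *m (Bc s)^T *m P2c s *m mX s) j 0) t =
      int0 (fun s => mu_ s j 0) t + int0 (fun s => (K2 s *m mX s) j 0) t.
    rewrite -(RintegralD mI v1 i2); apply: eq_Rintegral => s _.
    by rewrite -/(K2 s); move: (mu_ s) (K2 s *m mX s) => v w; rewrite mxE.
  have -> : int0 (fun s => (mean_on P F u s - prob P F *: mu_ s +
      Si s *m (Bc s)^T *m P1c s *m centered_mean_on P F X s) j 0) t =
      int0 (fun s => mean_on P F u s j 0) t + (- prob P F) * int0 (fun s => mu_ s j 0) t
      + 1 * int0 (fun s => (K1 s *m centered_mean_on P F X s) j 0) t.
    rewrite -(Rintegral_affine mI _ _ vF v1 i1); apply: eq_Rintegral => s _.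
    rewrite -/(K1 s); move: (mean_on P F u s) (mu_ s) (K1 s *m _) => v w x.
    by rewrite !mxE; ring.
  have combine (a b c d p : R) : b + c = 0 -> a + - p * b + 1 * d = 0 -> a + p * c + 1 * d = 0.
    by move=> h1 h2; rewrite -h2 (_ : c = - b); [ring|apply/eqP; rewrite -addr_eq0 addrC h1].
  exact: combine.
have := pintegrable_ae0 (ltW T0) gi (fun F mF t => @rF F t mF); apply: filterS => z hz zT.
by rewrite -(hz zT) gE.
Qed.

Lemma feedback_residual : {ae (mul \x P)%E, forall z : lebesgueType R * Omega, time_space T z ->
  u z.1 z.2 + Si z.1 *m (Bc z.1)^T *m (P1c z.1 *m (X z.1 z.2 - mX z.1) + P2c z.1 *m mX z.1) = 0}.
Proof.
have : {ae (mul \x P)%E, forall z : lebesgueType R * Omega, forall j, time_space T z ->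
  (u z.1 z.2 + Si z.1 *m (Bc z.1)^T *m (P1c z.1 *m (X z.1 z.2 - mX z.1) +
    P2c z.1 *m mX z.1)) j 0 = 0}.
  by apply: filter_forall => j; exact: feedback_residual_entry.
by apply: filterS => z res zT; apply/matrixP => j k; rewrite ord1 res // mxE.
Qed.

End feedback_law.

Theorem theorem9p1 (R : realType) (dO : measure_display)
    (Omega : measurableType dO) (P : probability Omega R)
    (hOmega : standard_borel R Omega)
    (d d' : nat) (T : R) (hT : 0 < T)
    (A : R -> 'M[R]_d) (B : R -> 'M[R]_(d, d')) (Ru : R -> 'M[R]_d')
    (Qx Qm : R -> 'M[R]_d) (Kx Km : 'M[R]_d)
    (hA : {within `[0, T], continuous A})
    (hB : {within `[0, T], continuous B})
    (hRu : {within `[0, T], continuous Ru})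
    (hQx : {within `[0, T], continuous Qx})
    (hQm : {within `[0, T], continuous Qm})
    (hRu_pos : forall t, t \in `[0, T] -> posdef (Ru t))
    (hQx_sym : forall t, t \in `[0, T] -> (Qx t)^T = Qx t)
    (hQm_sym : forall t, t \in `[0, T] -> (Qm t)^T = Qm t)
    (hKx_sym : Kx^T = Kx) (hKm_sym : Km^T = Km)
    (X0 : Omega -> 'cV[R]_d) (hX0 : L2_rv P X0)
    (Xs : R -> Omega -> 'cV[R]_d) (us : R -> Omega -> 'cV[R]_d')
    (hmin : pontryagin_local_L2_minimizer P T A B X0
              (cost P T Qx Qm Kx Km Ru) Xs us)
    (P1 P2 : R -> 'M[R]_d)
    (hP1 : riccati_solution T A B Ru (fun t => Qx t + Qm t) (Kx + Km) P1)
    (hP2 : riccati_solution T A B Ru Qx Kx P2) :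
  {ae (@completed_lebesgue_measure R \x P)%E, forall z : lebesgueType R * Omega, time_space T z ->
    us z.1 z.2 =
      - (invmx (Ru z.1) *m (B z.1)^T *m
          (P1 z.1 *m (Xs z.1 z.2 - mean P Xs z.1)
           + P2 z.1 *m mean P Xs z.1))}.
Proof.
have [adm [e e0 hm]] := hmin.
have T0 := ltW hT.
have [N [X [u [[mN N0] LX [mu u2] [Xc XE] NE]]]] := regular_version hT adm.
have t0T : 0 \in `[0, T] by rewrite in_itv /= lexx T0.
have symRu t : t \in `[0, T] -> (Ru t)^T = Ru t by move=> tT; have [] := hRu_pos t tT.
have cm : mx_cts (mean_on P setT X).
  apply: (@mean_on_mx_cts _ _ _ P d d' T (fun t => A (clamp T t)) (fun t =>
    B (clamp T t)) X u setT) => //.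
  - exact: within_mx_cts_clamp.
  - exact: within_mx_cts_clamp.
  - move=> i; apply: pintegrable_sqr_int => //;
    [exact: (L2_process_pmeasurable LX)|exact: L2_process_pintegrable_sqr LX].
  - by move=> i; apply: pintegrable_sqr_int.
  - by move=> i; exact: L2_process_int LX t0T.
have stat := first_variation_eq0 hT hA hB hRu hQx hQm symRu hQx_sym hQm_sym hKx_sym hKm_sym
  e0 adm hm mN N0 LX mu u2 cm NE.
have res := feedback_residual hT e0 hA hB hRu hQx hQm hRu_pos hP1 hP2 LX Xc mu u2 XE stat.
have meanE t : t \in `[0, T] -> mean P Xs t = mean_on P setT X t.
  move=> tT; rewrite -mean_setT; apply: (mean_off_null mN N0) => w Nw.
  by have [-> _] := NE w t Nw tT.
have aeN : {ae (@completed_lebesgue_measure R \x P)%E, forall z : lebesgueType R * Omega, ~ N z.2}.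
  exists ([set: lebesgueType R] `*` N); split.
  - exact: measurableX.
  (* the convention +oo * 0 = 0 absorbs the infinite length of the time axis *)
  - by rewrite measure_rect // N0 mule0.
  - by move=> z /= /contrapT.
apply: filterS2 aeN res => -[t w] /= Nw res zT.
have tT : t \in `[0, T] by have [] := zT.
have [Xw uw] := NE w t Nw tT.
have := res zT; rewrite /= clamp_id // uw Xw -meanE //.
by move/eqP; rewrite addr_eq0 => /eqP.
Qed.
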